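(* Any Euclidean building $\Delta$ can be ordered. Moreover, an ordering is uniquely defined by an ordering of the special edges of a fixed alcove of the building starting at some fixed special vertex of this alcove. In particular, there are only finitely many orderings on any Euclidean building. For any ordering of $\Delta$, the isomorphisms $\Sigma\to\Sigma'$ in axiom (B2) can be taken to be order-preserving. If $\phi$ is an automorphism of a Euclidean building $\Delta$ and $\tau$ is an ordering of $\Delta$, then $\tau\phi$ is again an ordering on $\Delta$.
   Context: **Root systems and Coxeter complexes.** Let $\Phi$ be a reduced, irreducible, crystallographic root system spanning a Euclidean space $V$ of dimension $n$, with Weyl group $W$. Let $\mathbb{Z}\Phi^\#=\{\lambda\in V: (\lambda,\alpha)\in\mathbb{Z}\ \forall \alpha\in\Phi\}$ be the coweight lattice. For $\alpha\in\Phi,k\in\mathbb{Z}$ let $H_{\alpha,k}=\{\lambda\in V:(\lambda,\alpha)=k\}$ (the walls). The walls triangulate $V$; the resulting piecewise Euclidean simplicial complex is $\Sigma_\Phi$, and its top-dimensional closed simplices are called alcoves. The extended affine Weyl group $\widehat{W_a}=\mathbb{Z}\Phi^\#\rtimes W$ acts on $\Sigma_\Phi$ by simplicial isometries. A Euclidean Coxeter complex is a simplicial structure $\Sigma$ on a Euclidean space $V'$ that is the image of some $\Sigma_\Phi$ under an affine isometry $V\to V'$; all notions are transported by this isometry. A vertex $x$ is special if for every wall there is a parallel wall passing through $x$. **Buildings.** A Euclidean building is a simplicial piecewise Euclidean complex $\Delta$ that is the union of a family of subcomplexes (apartments) such that: (B0) there is a Euclidean Coxeter complex $\Sigma_0$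 such that each apartment is simplicially isometric to $\Sigma_0$; (B1) any two simplices of $\Delta$ lie in a common apartment; (B2) if two apartments $\Sigma,\Sigma'$ share a top-dimensional simplex (alcove), there is an isomorphism (simplicial isometry) $\Sigma\to\Sigma'$ fixing $\Sigma\cap\Sigma'$ pointwise. A vertex of $\Delta$ is special if it is special in some (equivalently any) apartment containing it. An automorphism of $\Delta$ is a simplicial isometry of $\Delta$ onto itself; it acts on directed edges. **Orderings.** A directed edge of $\Delta^{(1)}$ is special if its origin is a special vertex, and quasi-special if it lies on a line segment $[x,y]\subset\Delta^{(1)}$ with $x,y$ special vertices (and similarly for a Euclidean Coxeter complex). Special edges are quasi-special. An ordering of a Euclidean Coxeter complex $\Sigma$ of dimension $n$ is a function $\tau$ from the set of quasi-special edges to $\{1,\dots,n\}$ such that: 1) for each alcove $\langle x,x_1,\dots,x_n\rangle$ with $x$ a special vertex, $\tau$ is bijective on $\{[x,x_1],\dots,[x,x_n]\}$; 2) $\tau$ is $\widehat{W_a}$-invariant; 3) for any line segment $[x,y]\subset\Sigma^{(1)}$ with special end points, $\tau$ is constant on the quasi-special edges lying on $[x,y]$ and directed from $x$ to $y$. An ordering of a Euclidean building $\Delta$ of dimension $n$ is a function $\tau$ from its quasi-special edges to $\{1,\dots,n\}$ restricting to an ordering on each apartment. ''Can be ordered'' means an ordering exists. ''An ordering of the special edges of an alcove $\langle x,x_1,\dots,x_n\rangle$ starting at a special vertex $x$'' means a bijection $\{[x,x_1],\dots,[x,x_n]\}\to\{1,\dots,n\}$. A map is order-preserving if it preserves the values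 of $\tau$ on quasi-special edges. *)

(* Defs.v *)
From HB Require Import structures.
From mathcomp Require Import all_boot all_order all_algebra finmap.
From mathcomp Require Import boolp classical_sets functions cardinality reals.

Set Implicit Arguments.
Unset Strict Implicit.
Unset Printing Implicit Defensive.

Import Order.TTheory GRing.Theory Num.Theory.

Local Open Scope fset_scope.
Local Open Scope classical_set_scope.
Local Open Scope ring_scope.

Section Root_systems.
Variables (R : realType) (n : nat).
Local Notation V := 'rV[R]_n.
Implicit Types (u v x y a : V) (Phi : {fset V}).

(* The Euclidean inner product; the norm that the libraries put on matrices
   is the sup norm, which is not used here. *)
Definition dot u v : R := (u *m v^T) 0 0.
Definition edist u v : R := Num.sqrt (dot (u - v) (u - v)).

Definition reflection a v : V := v - (2 * dot v a / dot a a) *: a.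

Record root_system Phi : Prop := RootSystem {
  root_span : (<<Phi>> = fullv)%VS;
  root_neq0 : 0 \notin Phi;
  root_refl : forall a b, a \in Phi -> b \in Phi -> reflection a b \in Phi;
  root_crystallographic : forall a b, a \in Phi -> b \in Phi ->
    2 * dot b a / dot a a \in Num.int;
  root_reduced : forall a (c : R), a \in Phi -> c *: a \in Phi ->
    c = 1 \/ c = -1;
  root_nonempty : Phi != fset0;
  root_irreducible : forall Psi : {fset V}, (Psi `<=` Phi)%fset ->
    (forall a b, a \in Psi -> b \in (Phi `\` Psi)%fset -> dot a b = 0) ->
    Psi = fset0 \/ Psi = Phi
}.

(* Reflections are involutions, so closing under composition suffices. *)
Inductive weyl Phi : (V -> V) -> Prop :=
| weyl_id : weyl Phi id
| weyl_refl a w : a \in Phi -> weyl Phi w -> weyl Phi (reflection a \o w).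

Definition coweight_lattice Phi : set V :=
  [set v | forall a, a \in Phi -> dot v a \in Num.int].

Definition extended_affine_weyl Phi : set (V -> V) :=
  [set g | exists w t, [/\ weyl Phi w, coweight_lattice Phi t
                         & g = fun v => w v + t]].

Definition hyperplane a (k : int) : set V := [set v | dot v a = k%:~R].

Definition wall Phi (H : set V) : Prop :=
  exists a k, a \in Phi /\ H = hyperplane a k.

Definition parallel (H H' : set V) : Prop :=
  exists t : V, H' = [set v + t | v in H].

(* The closed facet carrying p: the intersection of the closed half-spaces
   that are bounded by walls and contain p (as Phi = - Phi, half-spaces of the
   form (., a) >= k are enough). *)
Definition closed_facet Phi (p : V) : set V :=
  [set q | forall a (k : int), a \in Phi ->
     k%:~R <= dot p a -> k%:~R <= dot q a].

Definition coxeter_vertex Phi (v : V) : Prop := closed_facet Phi v = [set v].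

Definition coxeter_special Phi (v : V) : Prop :=
  coxeter_vertex Phi v /\
  forall H, wall Phi H -> exists H', [/\ wall Phi H', parallel H H' & H' v].

End Root_systems.

Section Complexes.
Variable R : realType.

(* A simplex is the finite set of its vertices.  A Euclidean simplex is
   determined by its edge lengths, so a piecewise Euclidean structure on a
   simplicial complex is recorded as a function [len], which is meaningful only
   on pairs of vertices of a common simplex. *)
Record complex (T : choiceType) := Complex {
  simplex : set {fset T};
  len : T -> T -> R
}.

Definition affinely_independent (T : choiceType) (N : nat) (s : {fset T})
    (p : T -> 'rV[R]_N) : Prop :=
  forall c : T -> R, \sum_(x <- s) c x = 0 ->
    \sum_(x <- s) c x *: p x = 0 -> forall x, x \in s -> c x = 0.

(* The vertex set is the whole of T. *)
Record piecewise_euclidean (T : choiceType) (K : complex T) : Prop := {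
  pe_nonempty : ~ simplex K fset0;
  pe_vertex : forall x, simplex K [fset x];
  pe_face : forall s t, simplex K s -> (t `<=` s)%fset -> t != fset0 -> simplex K t;
  pe_euclidean : forall s, simplex K s ->
    exists N (p : T -> 'rV[R]_N), affinely_independent s p /\
      forall x y, x \in s -> y \in s -> len K x y = edist (p x) (p y)
}.

Definition subcomplex (T : choiceType) (K : complex T) (S : set {fset T}) :=
  (forall s, S s -> simplex K s) /\
  (forall s t, S s -> (t `<=` s)%fset -> t != fset0 -> S t).

Definition restrict_complex (T : choiceType) (K : complex T) (S : set {fset T}) :
  complex T := Complex S (len K).

(* The values of f outside the vertices of K are irrelevant. *)
Record simplicial_isometry (T T' : choiceType) (K : complex T)
    (K' : complex T') (f : T -> T') : Prop := {
  si_simplex : forall s, simplex K s -> simplex K' (f @` s)%fset;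
  si_inj : forall x y, simplex K [fset x] -> simplex K [fset y] ->
    f x = f y -> x = y;
  si_surj : forall s', simplex K' s' -> exists2 s, simplex K s & s' = (f @` s)%fset;
  si_len : forall s x y, simplex K s -> x \in s -> y \in s ->
    len K' (f x) (f y) = len K x y
}.

Definition edge (T : choiceType) (K : complex T) (x y : T) : Prop :=
  x != y /\ simplex K [fset x; y].

Section Geometric_realization.
Variables (T : choiceType) (K : complex T).

(* Points are given by barycentric coordinates. *)
Definition in_simplex (s : {fset T}) (b : T -> R) : Prop :=
  [/\ forall x, 0 <= b x, forall x, x \notin s -> b x = 0
    & \sum_(x <- s) b x = 1].

Definition vertex_point (x : T) : T -> R := fun y => (y == x)%:R.

(* If p places the vertices of s in a Euclidean space with the prescribed edge
   lengths, and w = b - c (so that the w x sum to 0), then polarization gives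
   |sum_x w x p x|^2 = - 1/2 sum_(x, y) w x w y (len x y)^2. *)
Definition simplex_dist (s : {fset T}) (b c : T -> R) : R :=
  Num.sqrt (- (\sum_(x <- s) \sum_(y <- s)
    (b x - c x) * (b y - c y) * len K x y ^+ 2) / 2).

(* A string from b to c: consecutive points lie in a common simplex, which is
   recorded together with the endpoint of the step. *)
Fixpoint is_string (b : T -> R) (l : seq ({fset T} * (T -> R))) (c : T -> R) :
    Prop :=
  if l is (s, b') :: l' then
    [/\ simplex K s, in_simplex s b, in_simplex s b' & is_string b' l' c]
  else b = c.

Fixpoint string_length (b : T -> R) (l : seq ({fset T} * (T -> R))) : R :=
  if l is (s, b') :: l' then simplex_dist s b b' + string_length b' l' else 0.

(* The length metric; meaningful when b and c are joined by a string. *)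
Definition dist (b c : T -> R) : R :=
  inf [set string_length b l | l in [set l | is_string b l c]].

Definition line_segment (x y : T) (L : R) (g : R -> T -> R) : Prop :=
  [/\ 0 <= L, g 0 = vertex_point x, g L = vertex_point y,
      forall t, 0 <= t <= L -> exists2 s, simplex K s & in_simplex s (g t)
    & forall t t', 0 <= t <= L -> 0 <= t' <= L ->
        dist (g t) (g t') = `|t - t'| ].

Definition in_1skeleton (b : T -> R) : Prop :=
  exists s, [/\ simplex K s, (#|` s| <= 2)%N & in_simplex s b].

End Geometric_realization.
End Complexes.

Section Coxeter_complexes.
Variables (R : realType) (n : nat) (Phi : {fset 'rV[R]_n}).
Local Notation V := 'rV[R]_n.
Implicit Types (u v x y : V).

(* The complex Sigma_Phi: its simplices are the closed facets, each given by
   the set of vertices that it contains. *)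
Definition coxeter_complex : complex R V := Complex
  [set s | exists p, forall v,
     v \in s <-> coxeter_vertex Phi v /\ closed_facet Phi p v]
  (@edist R n).

Definition segment x y : set V :=
  [set x + t *: (y - x) | t in [set t : R | 0 <= t <= 1]].

Definition coxeter_1skeleton : set V :=
  [set z | exists u v, simplex coxeter_complex [fset u; v] /\ segment u v z].

Definition special_segment x y : Prop :=
  [/\ coxeter_special Phi x, coxeter_special Phi y
    & segment x y `<=` coxeter_1skeleton].

Definition directed_edge_on u v x y : Prop :=
  edge coxeter_complex u v /\
  exists a b : R, [/\ 0 <= a, a < b, b <= 1,
    u = x + a *: (y - x) & v = x + b *: (y - x)].

Definition coxeter_quasi_special u v : Prop :=
  edge coxeter_complex u v /\
  exists x y, special_segment x y /\ segment u v `<=` segment x y.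

(* tau stands for its restriction to the quasi-special edges [u, v] of
   Sigma_Phi; its other values are unconstrained. *)
Record coxeter_ordering (tau : V -> V -> nat) : Prop := {
  co_range : forall u v, coxeter_quasi_special u v -> (1 <= tau u v <= n)%N;
  co_bij : forall C x, simplex coxeter_complex C -> #|` C| = n.+1 ->
    x \in C -> coxeter_special Phi x ->
    set_bij [set` (C `\ x)%fset] [set k | (1 <= k <= n)%N] (tau x);
  co_invariant : forall g u v, extended_affine_weyl Phi g ->
    coxeter_quasi_special u v -> tau (g u) (g v) = tau u v;
  co_segment : forall x y u v u' v', special_segment x y ->
    directed_edge_on u v x y -> directed_edge_on u' v' x y ->
    tau u v = tau u' v'
}.

End Coxeter_complexes.

Section Buildings.
Variables (R : realType) (n : nat) (Phi : {fset 'rV[R]_n}).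
Variables (T : choiceType) (K : complex R T) (A : set (set {fset T})).

(* A chart of a subcomplex S identifies it with Sigma_Phi; the notions attached
   to the Coxeter complex are transported to apartments along charts. *)
Definition chart (S : set {fset T}) (f : 'rV[R]_n -> T) : Prop :=
  simplicial_isometry (coxeter_complex Phi) (restrict_complex K S) f.

Definition fixes_intersection (S S' : set {fset T}) (f : T -> T) : Prop :=
  forall s x, S s -> S' s -> x \in s -> f x = x.

(* K is a Euclidean building with family of apartments A, the Euclidean Coxeter
   complex of axiom (B0) being isometric to Sigma_Phi. *)
Record euclidean_building : Prop := {
  eb_complex : piecewise_euclidean K;
  eb_apartment : forall S, A S -> subcomplex K S;
  eb_union : forall s, simplex K s -> exists2 S, A S & S s;
  eb_B0 : forall S, A S -> exists f, chart S f;
  eb_B1 : forall s t, simplex K s -> simplex K t ->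
    exists S, [/\ A S, S s & S t];
  eb_B2 : forall S S' C, A S -> A S' -> S C -> S' C -> #|` C| = n.+1 ->
    exists f, simplicial_isometry (restrict_complex K S) (restrict_complex K S') f /\
      fixes_intersection S S' f
}.

Definition special_vertex (x : T) : Prop :=
  exists S f v, [/\ A S, chart S f, coxeter_special Phi v & x = f v].

(* The line segment [x, y] is a geodesic of the length metric of K. *)
Definition quasi_special (u v : T) : Prop :=
  edge K u v /\
  exists x y L g,
    [/\ special_vertex x, special_vertex y, line_segment K x y L g,
        forall t, 0 <= t <= L -> in_1skeleton K (g t)
      & forall b, in_simplex [fset u; v] b -> exists2 t, 0 <= t <= L & g t = b].

(* A function from the set of quasi-special edges to {1, ..., n} is represented
   by its extension by 0 to all pairs, so that equality of such functions is
   plain equality. *)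
Record building_ordering (tau : T -> T -> nat) : Prop := {
  bo_range : forall u v, quasi_special u v -> (1 <= tau u v <= n)%N;
  bo_support : forall u v, ~ quasi_special u v -> tau u v = 0%N;
  bo_apartment : forall S, A S -> exists2 f, chart S f &
    coxeter_ordering Phi (fun u v => tau (f u) (f v))
}.

End Buildings.

(* Main.v *)
Require Import Defs.
From HB Require Import structures.
From mathcomp Require Import all_boot all_order all_algebra finmap.
From mathcomp Require Import boolp classical_sets functions cardinality reals.
From mathcomp Require Import lra zify.

Set Implicit Arguments.
Unset Strict Implicit.
Unset Printing Implicit Defensive.

Import Order.TTheory GRing.Theory Num.Theory.

Local Open Scope classical_set_scope.
Local Open Scope fset_scope.
Local Open Scope ring_scope.

(** In the Coxeter complex the special vertices are the coweights, and a
    quasi-special edge is labelled by the orbit of its direction under the Weyl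
    group. That such a labelling exists and is determined by its values at one
    special vertex of one alcove rests on the closed alcove being a strict
    fundamental domain for the affine Weyl group (exchange condition), and on
    the special edges being quasi-special: vertices are solutions of linear
    systems with integral coefficients, so that a multiple of each edge of an
    alcove issuing from a special vertex ends at a coweight.

    A folding, i.e. a simplicial self-map that is isometric on each simplex,
    agrees on each alcove with one fixed symmetry composed with an element of
    the extended affine Weyl group. A symmetry turns orderings into orderings,
    so every folding pulls orderings back to orderings.

    In the building, (B1) and (B2) give a retraction r onto the apartment of any
    chart, centred at any of its alcoves, and its restriction to every other
    apartment is a folding. Hence the orderings of the building are exactly the
    pullbacks along r of the orderings of the Coxeter complex, and all the
    claims reduce to the latter. For this one needs that quasi-special edges of
    the building are the quasi-special edges of apartments, i.e. that a geodesic
    between two points of an apartment stays in it: retractions do not increase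
    distances, and a retraction centred at an alcove through a point z has z as
    the only preimage of z.

    Affine independence of the simplices of the Coxeter complex is not proved
    from irreducibility of the root system: it is inherited from the building
    through a chart. *)

(** A simplicial isometry is only a map of vertices, and the building axioms do not mention roots.
    The obstacle is thus to show that an isometry between two alcoves comes from an automorphism of
    [Phi] followed by a translation by a coweight. Such an isometry conjugates the panel reflections
    of one alcove to those of the other, hence wall reflections to wall reflections; the images of
    two parallel walls then recover the roots up to factors that are integral in both directions.

    The resulting symmetry may be a diagram automorphism, outside the extended affine Weyl group, so
    invariance of an ordering does not suffice to compare charts. What helps is that symmetries
    normalize this group.

    Foldings are followed along galleries: behind a panel the next vertex keeps its distances to
    that panel, so its image is either the old vertex again or its mirror image. Accordingly the
    word describing the image stays as it is or receives the same letter as the source word. All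
    words are in the panel reflections of one fixed alcove. *)

Lemma card_fsetD1 (T : choiceType) (C : {fset T}) x m :
  x \in C -> #|` C| = m.+1 -> #|` C `\ x| = m.
Proof. by move=> xC; rewrite (cardfsD1 x) xC => -[]. Qed.

(** * Euclidean geometry of row vectors, frames and reflections *)

Section Euclidean_geometry.
Variables (R : realType) (n : nat).
Local Notation V := 'rV[R]_n.
Implicit Types (u v w x y z a b : V) (C : {fset V}).

Lemma dotE u v : dot u v = \sum_i u 0 i * v 0 i.
Proof. by rewrite /dot mxE; apply: eq_bigr => i _; rewrite mxE. Qed.

Lemma dotC u v : dot u v = dot v u.
Proof. by rewrite !dotE; apply: eq_bigr => i _; rewrite mulrC. Qed.

Lemma dotDl u v w : dot (u + v) w = dot u w + dot v w.
Proof. by rewrite /dot mulmxDl mxE. Qed.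

Lemma dotZl (c : R) u v : dot (c *: u) v = c * dot u v.
Proof. by rewrite /dot -scalemxAl mxE. Qed.

Lemma dotDr u v w : dot w (u + v) = dot w u + dot w v.
Proof. by rewrite dotC dotDl !(dotC w). Qed.

Lemma dotZr (c : R) u v : dot u (c *: v) = c * dot u v.
Proof. by rewrite dotC dotZl dotC. Qed.

Lemma dotNl u v : dot (- u) v = - dot u v.
Proof. by rewrite -scaleN1r dotZl mulN1r. Qed.

Lemma dotNr u v : dot u (- v) = - dot u v.
Proof. by rewrite dotC dotNl dotC. Qed.

Lemma dotBl u v w : dot (u - v) w = dot u w - dot v w.
Proof. by rewrite dotDl dotNl. Qed.

Lemma dotBr u v w : dot w (u - v) = dot w u - dot w v.
Proof. by rewrite dotDr dotNr. Qed.

Lemma dot0l v : dot 0 v = 0.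
Proof. by rewrite -(scale0r 0) dotZl mul0r. Qed.

Lemma dot0r v : dot v 0 = 0.
Proof. by rewrite dotC dot0l. Qed.

Definition dotl := (dotDl, dotDr, dotNl, dotNr, dotZl, dotZr).

Lemma dot_suml (I : Type) (s : seq I) (F : I -> V) v :
  dot (\sum_(i <- s) F i) v = \sum_(i <- s) dot (F i) v.
Proof.
by elim: s => [|i s IH]; rewrite ?big_nil ?dot0l // !big_cons dotDl IH.
Qed.

Lemma dot_sumr (I : Type) (s : seq I) (F : I -> V) v :
  dot v (\sum_(i <- s) F i) = \sum_(i <- s) dot v (F i).
Proof. by rewrite dotC dot_suml; apply: eq_bigr => i _; rewrite dotC. Qed.

Lemma dot_ge0 v : 0 <= dot v v.
Proof. by rewrite dotE sumr_ge0 // => i _; rewrite -expr2 sqr_ge0. Qed.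

Lemma dot_eq0 v : (dot v v == 0) = (v == 0).
Proof.
apply/eqP/eqP => [|->]; last by rewrite dot0l.
rewrite dotE => /psumr_eq0P h; apply/rowP => i; rewrite mxE.
by apply/eqP; rewrite -sqrf_eq0 expr2 h // => j _; rewrite -expr2 sqr_ge0.
Qed.

Lemma dot_gt0 v : v != 0 -> 0 < dot v v.
Proof. by move=> v0; rewrite lt_neqAle dot_ge0 eq_sym dot_eq0 v0. Qed.

Lemma dot_mulmx (M : 'M[R]_n) u v : dot (u *m M) v = dot u (v *m M^T).
Proof. by rewrite /dot trmx_mul trmxK mulmxA. Qed.

Lemma eq_dotr u v : (forall w, dot w u = dot w v) -> u = v.
Proof.
move=> h; apply/eqP; rewrite -subr_eq0 -dot_eq0 dotBr h.
by rewrite subrr.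
Qed.

Lemma edist_eq u v u' v' : edist u v = edist u' v' ->
  dot (u - v) (u - v) = dot (u' - v') (u' - v').
Proof.
move=> h; have : edist u v ^+ 2 = edist u' v' ^+ 2 by rewrite h.
by rewrite !sqr_sqrtr // dot_ge0.
Qed.

Lemma edistC u v : edist u v = edist v u.
Proof. by rewrite /edist -opprB dotNl dotNr opprK. Qed.

Lemma edistxx u : edist u u = 0.
Proof. by rewrite /edist subrr dot0l sqrtr0. Qed.

Lemma edist_ge0 u v : 0 <= edist u v.
Proof. exact: sqrtr_ge0. Qed.

Lemma edist_eq0 u v : edist u v = 0 -> u = v.
Proof.
move=> h; apply/eqP; rewrite -subr_eq0 -dot_eq0.
by rewrite -(sqr_sqrtr (dot_ge0 _)) -/(edist u v) h expr0n.
Qed.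

Lemma sqr_edist u v : edist u v ^+ 2 = dot (u - v) (u - v).
Proof. by rewrite sqr_sqrtr // dot_ge0. Qed.

Lemma cauchy_schwarz u v : dot u v ^+ 2 <= dot u u * dot v v.
Proof.
have [->|v0] := eqVneq v 0; first by rewrite !dot0r expr0n mulr0.
have vv := dot_gt0 v0.
have := dot_ge0 (dot v v *: u - dot u v *: v); rewrite !dotl (dotC v u).
set x := dot u u; set y := dot u v; set z := dot v v => h.
have : 0 <= z * (x * z - y ^+ 2) by lra.
by rewrite pmulr_rge0 // subr_ge0.
Qed.

Lemma edist_triangle u v w : edist u w <= edist u v + edist v w.
Proof.
rewrite -(@ler_pXn2r _ 2) // ?nnegrE ?addr_ge0 ?edist_ge0 //.
rewrite sqrrD !sqr_edist.
have -> : u - w = (u - v) + (v - w) by rewrite addrA subrK.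
move: (u - v) (v - w) (sqr_edist u v) (sqr_edist v w) (edist_ge0 u v) (edist_ge0 v w).
move=> p q; move: (edist u v) (edist v w) => s t hs ht s0 t0.
rewrite !dotl (dotC q p).
have : dot p q <= s * t.
  rewrite -[s * t]ger0_norm ?mulr_ge0 // (le_trans (ler_norm _)) //.
  by rewrite -ler_sqr ?nnegrE // !real_normK ?num_real // exprMn hs ht cauchy_schwarz.
lra.
Qed.

(** Stewart's identity: with [s = t / L], the squared distance from [z] to the claimed point is [(1
    - s) * |z - x|^2 + s * |y - z|^2 - s * (1 - s) * L^2], and the two bounds make this at most
    0. *)
Lemma edist_between x y z (t : R) : 0 <= t <= edist x y -> 0 < edist x y ->
  edist x z <= t -> edist z y <= edist x y - t ->
  z = x + (t / edist x y) *: (y - x).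
Proof.
move=> /andP[t0 tL] L0 h1 h2; set L := edist x y in tL L0 h2 *.
have e1 : dot (z - x) (z - x) <= t ^+ 2.
  by rewrite -sqr_edist edistC ler_pXn2r // ?nnegrE ?edist_ge0.
have e2 : dot (y - z) (y - z) <= (L - t) ^+ 2.
  by rewrite -sqr_edist edistC ler_pXn2r // ?nnegrE ?edist_ge0 // subr_ge0.
have e3 : dot (y - x) (y - x) = L ^+ 2 by rewrite -sqr_edist edistC.
apply/eqP; rewrite addrC -subr_eq -subr_eq0 -dot_eq0 eq_le dot_ge0 andbT.
set s := t / L; have sL : s * L = t by rewrite /s divfK // gt_eqF.
move: e2; have -> : y - z = (y - x) - (z - x) by rewrite opprB addrA subrK.
move: (z - x) (y - x) e1 e3 => a D e1 e3; rewrite !dotl (dotC D a) => e2.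
have s1 : 0 <= s <= 1 by rewrite /s divr_ge0 ?(ltW L0) //= ler_pdivrMr // mul1r.
rewrite e3; rewrite e3 in e2.
move: (dot a a) (dot a D) e1 e2 => A B e1 e2.
have : s * (L ^+ 2 + A - 2 * B) <= s * (L - t) ^+ 2.
  by rewrite ler_wpM2l //; lra.
have : (1 - s) * A <= (1 - s) * t ^+ 2 by rewrite ler_wpM2l // subr_ge0; lra.
rewrite -sL; clear; lra.
Qed.

(** As the coefficients sum to 0, the terms in [dot (p x) (p x)] cancel. The norm thus depends on
    mutual distances alone and can be read off in an abstract complex, as [simplex_dist] does. *)
Lemma polarization (I : Type) (s : seq I) (c : I -> R) (p : I -> V) :
  \sum_(x <- s) c x = 0 ->
  dot (\sum_(x <- s) c x *: p x) (\sum_(x <- s) c x *: p x) =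
  - (\sum_(x <- s) \sum_(y <- s) c x * c y * edist (p x) (p y) ^+ 2) / 2.
Proof.
move=> c0.
have -> : \sum_(x <- s) \sum_(y <- s) c x * c y * edist (p x) (p y) ^+ 2 =
   \sum_(x <- s) \sum_(y <- s) (c x * dot (p x) (p x) * c y) +
   \sum_(x <- s) \sum_(y <- s) (c x * (c y * dot (p y) (p y))) -
   2 * \sum_(x <- s) \sum_(y <- s) c x * (c y * dot (p x) (p y)).
  rewrite mulr_sumr -big_split -sumrB; apply: eq_bigr => x _ /=.
  rewrite mulr_sumr -big_split -sumrB; apply: eq_bigr => y _ /=.
  rewrite sqr_edist !dotl (dotC (p y) (p x)); lra.
rewrite [X in X + _ - _]big1 => [|x _]; last by rewrite -mulr_sumr c0 mulr0.
rewrite [X in _ + X - _](_ : _ = (\sum_(x <- s) c x) * \sum_(y <- s) c y * dot (p y) (p y)); last first.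
  by rewrite mulr_suml; apply: eq_bigr => x _; rewrite mulr_sumr.
rewrite add0r c0 mul0r sub0r opprK mulrC mulKf ?pnatr_eq0 //.
rewrite dot_suml; apply: eq_bigr => x _.
rewrite dotZl dot_sumr mulr_sumr; apply: eq_bigr => y _.
by rewrite dotZr.
Qed.

Definition edges_mx m x0 (X : seq V) : 'M[R]_(m, n) :=
  \matrix_(i < m) (nth 0 X i - x0).

(** Translates between affine relations on [C] and linear relations among the edges issuing from
    [x0], so that matrix algebra applies to simplices. *)
Lemma edges_mx_coef C x0 m (u : 'rV[R]_m) :
  x0 \in C -> #|` C| = m.+1 ->
  exists c : V -> R, [/\ \sum_(x <- C) c x = 0,
    \sum_(x <- C) c x *: x = u *m edges_mx m x0 (C `\ x0)
    & forall i : 'I_m, c (nth 0 (C `\ x0) i) = u 0 i].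
Proof.
move=> x0C cC; set X : seq V := C `\ x0.
have sX : size X = m by exact: card_fsetD1 cC.
have uX : uniq X by exact: fset_uniq.
pose c x := if x == x0 then - \sum_i u 0 i else \sum_(i < m | nth 0 X i == x) u 0 i.
have cX (i : 'I_m) : c (nth 0 X i) = u 0 i.
  rewrite /c ifF; last first.
    have : nth 0 X i \in X by rewrite mem_nth ?sX.
    by rewrite in_fsetD1 => /andP[/negbTE].
  rewrite (eq_bigl (pred1 i)) ?big_pred1_eq // => j.
  by rewrite nth_uniq ?sX.
exists c; split=> //.
  rewrite (big_fsetD1 x0) //= -/X (big_nth 0) sX big_mkord.
  by under eq_bigr => i _ do rewrite cX; rewrite /c eqxx addNr.
rewrite (big_fsetD1 x0) //= -/X (big_nth 0) sX big_mkord.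
under eq_bigr => i _ do rewrite cX.
rewrite mulmx_sum_row /c eqxx scaleNr scaler_suml addrC -sumrB.
by apply: eq_bigr => i _; rewrite rowK scalerBr.
Qed.

Lemma edges_mx_free C x0 m : affinely_independent C id ->
  x0 \in C -> #|` C| = m.+1 -> row_free (edges_mx m x0 (C `\ x0)).
Proof.
move=> ai x0C cC; apply: inj_row_free => u u0.
have [c [c1 c2 c3]] := edges_mx_coef u x0C cC.
have ci := ai c c1 (etrans c2 u0).
apply/rowP => i; rewrite mxE -c3 ci //.
have : nth 0 (C `\ x0) i \in C `\ x0.
  by rewrite mem_nth // [X in (_ < X)%N](card_fsetD1 x0C cC).
by rewrite in_fsetD1 => /andP[].
Qed.

Lemma frame_coord C v : affinely_independent C id -> #|` C| = n.+1 ->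
  exists2 c : V -> R, \sum_(x <- C) c x = 1 & \sum_(x <- C) c x *: x = v.
Proof.
move=> ai cC; have [x0 x0C] : exists x, x \in C.
  by apply/fset0Pn; rewrite -cardfs_gt0 cC.
have Bu := edges_mx_free ai x0C cC; rewrite row_free_unit in Bu.
have [c [c1 c2 _]] := edges_mx_coef ((v - x0) *m invmx (edges_mx n x0 (C `\ x0))) x0C cC.
exists (fun x => c x + (x == x0)%:R).
  by rewrite big_split /= c1 add0r (big_fsetD1 x0) //= eqxx big1_fset ?addr0 // => x; rewrite in_fsetD1 => /andP[/negbTE->].
under eq_bigr do rewrite scalerDl.
rewrite big_split /= c2 mulmxKV // (big_fsetD1 x0) //= eqxx scale1r big1_fset ?addr0 ?subrK //.
by move=> x; rewrite in_fsetD1 => /andP[/negbTE-> _ _]; rewrite scale0r.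
Qed.

Lemma frame_dot_const C a (k : R) : affinely_independent C id -> #|` C| = n.+1 ->
  (forall x, x \in C -> dot x a = k) -> a = 0.
Proof.
move=> ai cC h.
have hk v : dot v a = k.
  have [c c1 <-] := frame_coord v ai cC.
  rewrite dot_suml (eq_big_seq (fun x => c x * k)) => [|x xC]; last by rewrite dotZl h.
  by rewrite -mulr_suml c1 mul1r.
by apply/eqP; rewrite -dot_eq0 hk -(hk 0) dot0l.
Qed.

(** Independence of the edges bounds the number of vertices by [n.+1]. With fewer vertices, a
    nonzero vector orthogonal to all edges would give a form that is constant on [C]. *)
Lemma frame_card C : affinely_independent C id -> C != fset0 ->
  (forall a (k : R), (forall x, x \in C -> dot x a = k) -> a = 0) -> #|` C| = n.+1.
Proof.
move=> ai /fset0Pn[x0 x0C] h.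
have cC : #|` C| = #|` C `\ x0|.+1 by rewrite (cardfsD1 x0) x0C.
have := edges_mx_free ai x0C cC; move: (#|` C `\ x0|) cC => m cC Bf.
rewrite cC; congr _.+1; apply/eqP; rewrite eqn_leq; apply/andP; split.
  by rewrite -(eqP Bf) rank_leq_col.
rewrite leqNgt; apply/negP => mn.
have : kermx (edges_mx m x0 (C `\ x0))^T != 0.
  by rewrite -mxrank_eq0 mxrank_ker mxrank_tr (eqP Bf) subn_eq0 -ltnNge.
case/rowV0Pn => a /sub_kermxP aK; apply/negP/negPn/eqP.
apply: (h a (dot x0 a)) => x xC; have [->//|xx0] := eqVneq x x0.
have xX : x \in C `\ x0 by rewrite in_fsetD1 xx0.
have sX : size (C `\ x0 : seq V) = m by exact: card_fsetD1 cC.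
have im : (index x (C `\ x0) < m)%N by rewrite -[Y in (_ < Y)%N]sX index_mem.
apply/eqP; rewrite -subr_eq0 -dotBl dotC.
have := congr1 (fun A : 'rV_m => A 0 (Ordinal im)) aK; rewrite !mxE => e.
rewrite dotE; apply/eqP; rewrite -[RHS]e; apply: eq_bigr => i _.
by rewrite !mxE /= nth_index.
Qed.

(** The affine forms [dot _ a - k] and [dot _ b - l] both vanish on the facet opposite [x], so in
    barycentric coordinates each is determined by its value at [x]; [r] is the ratio of these
    values. *)
Lemma hyper_prop C x a b (k l : R) : affinely_independent C id -> #|` C| = n.+1 ->
  x \in C -> (forall y, y \in C -> y != x -> dot y a = k) -> dot x a != k ->
  (forall y, y \in C -> y != x -> dot y b = l) ->
  exists2 r : R, b = r *: a & l = r * k.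
Proof.
move=> ai cC xC ha xa hb; pose r := (dot x b - l) / (dot x a - k).
have hv v : dot v b - l = r * (dot v a - k).
  have [c c1 <-] := frame_coord v ai cC.
  have -> : l = \sum_(y <- C) c y * l by rewrite -mulr_suml c1 mul1r.
  have -> : k = \sum_(y <- C) c y * k by rewrite -mulr_suml c1 mul1r.
  rewrite !dot_suml -!sumrB mulr_sumr; apply: eq_big_seq => y yC.
  rewrite !dotZl -!mulrBr mulrCA; congr (_ * _).
  have [->|yx] := eqVneq y x; last by rewrite ha // hb // !subrr mulr0.
  by rewrite /r divfK // subr_eq0.
exists r; last by have := hv 0; rewrite !dot0l; lra.
apply: eq_dotr => v; rewrite dotZr.
by have := hv 0; have := hv v; rewrite !dot0l; lra.
Qed.

(** The reflection in the hyperplane [dot v a = k]. The level is real, since conjugating a wall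
    reflection by an arbitrary isometry can produce any level. *)
Definition aref a (k : R) v : V := v - (2 * (dot v a - k) / dot a a) *: a.

Lemma aref_scale a (k r : R) v : r != 0 -> aref (r *: a) (r * k) v = aref a k v.
Proof.
move=> r0; rewrite /aref !dotl scalerA; congr (_ - _ *: _).
have [->|a0] := eqVneq a 0; first by rewrite !dot0l !mulr0 invr0 !mulr0 mul0r.
rewrite -mulrBr !invfM; set q := dot v a - k.
rewrite [_ * r]mulrC; have e : r * r^-1 = 1 by rewrite divff.
transitivity (2 * q * ((r * r^-1) * (r * r^-1)) / dot a a); first lra.
by rewrite e mulr1 mulr1.
Qed.

Lemma dot_arefl a (k : R) v b : dot (aref a k v) b =
  dot v b - (2 * (dot v a - k) / dot a a) * dot a b.
Proof. by rewrite /aref !dotl. Qed.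

Lemma aref_dot a (k : R) v : a != 0 -> dot (aref a k v) a - k = - (dot v a - k).
Proof.
move=> a0; rewrite dot_arefl divfK; last by rewrite gt_eqF // dot_gt0.
lra.
Qed.

Lemma arefK a (k : R) : a != 0 -> involutive (aref a k).
Proof.
move=> a0 v; rewrite {1}/aref aref_dot // {1}/aref.
by rewrite mulrN mulNr scaleNr opprK subrK.
Qed.

Lemma aref_id a (k : R) v : dot v a = k -> aref a k v = v.
Proof. by move=> e; rewrite /aref e subrr mulr0 mul0r scale0r subr0. Qed.

(** Equal distances to all panel vertices force [z - x] to be normal to the panel. On that normal
    line, a sphere centred at a panel vertex contains only [x] and its mirror image. *)
Lemma two_points C x z a (k : R) : affinely_independent C id -> #|` C| = n.+1 ->
  (0 < n)%N -> x \in C -> (forall y, y \in C -> y != x -> dot y a = k) -> dot x a != k ->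
  (forall y, y \in C -> y != x -> edist z y = edist x y) ->
  z = x \/ z = aref a k x.
Proof.
move=> ai cC n0 xC ha xa hz.
have [y0] : exists y, y \in C `\ x.
  by apply/fset0Pn; rewrite -cardfs_gt0 (card_fsetD1 xC cC).
rewrite in_fsetD1 => /andP[y0x y0C].
have a0 : a != 0 by apply: contraNneq xa => a0; rewrite -(ha y0) // a0 !dot0r.
have hp y : y \in C -> y != x -> dot y (z - x) = dot y0 (z - x).
  move=> yC yx; have := edist_eq (hz y yC yx); have := edist_eq (hz y0 y0C y0x).
  rewrite !dotl (dotC y z) (dotC y x) (dotC y0 z) (dotC y0 x); lra.
have [r er el] := hyper_prop ai cC xC ha xa hp.
have ez : z = x + r *: a by rewrite -er addrC subrK.
have := edist_eq (hz y0 y0C y0x); rewrite {}ez addrAC.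
have e0 := ha _ y0C y0x.
have : dot (x - y0) a = dot x a - k by rewrite dotBl e0.
move: (x - y0) => p ep.
rewrite !dotl (dotC a p) => h.
have : r * (2 * dot p a + r * dot a a) = 0 by lra.
move/eqP; rewrite mulf_eq0 => /orP[/eqP->|/eqP h']; first by left; rewrite scale0r addr0.
right; rewrite /aref -scaleNr; congr (_ + _ *: _).
apply: (@mulIf _ (dot a a)); first by rewrite gt_eqF // dot_gt0.
rewrite mulNr divfK ?gt_eqF ?dot_gt0 //; rewrite ep in h'; lra.
Qed.

Lemma edges_gram x y z : dot (x - z) (y - z) =
  (edist x z ^+ 2 + edist y z ^+ 2 - edist x y ^+ 2) / 2.
Proof.
rewrite !sqr_edist !dotl (dotC y x) (dotC z x) (dotC z y); lra.
Qed.

(** Inner products of edges are functions of distances, so the edge matrices [B] and [B'] have the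
    same Gram matrix and [invmx B *m B'] is orthogonal. *)
Lemma frame_isometry C (h : V -> V) : affinely_independent C id -> #|` C| = n.+1 ->
  (forall x y, x \in C -> y \in C -> edist (h x) (h y) = edist x y) ->
  exists M t, M *m M^T = 1%:M /\ forall x, x \in C -> h x = x *m M + t.
Proof.
move=> ai cC hh; have [x0 x0C] : exists x, x \in C.
  by apply/fset0Pn; rewrite -cardfs_gt0 cC.
have := edges_mx_free ai x0C cC; rewrite row_free_unit.
set X : seq V := C `\ x0; set B := edges_mx _ _ _ => Bu.
have sX : size X = n by exact: card_fsetD1 cC.
have XC (i : 'I_n) : nth 0 X i \in C.
  have : nth 0 X i \in C `\ x0 by rewrite mem_nth ?sX.
  by rewrite in_fsetD1 => /andP[].
pose B' : 'M_n := \matrix_(i < n) (h (nth 0 X i) - h x0).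
have BB : B' *m B'^T = B *m B^T.
  apply/matrixP => i j; rewrite !mxE.
  transitivity (dot (h (nth 0 X i) - h x0) (h (nth 0 X j) - h x0)).
    by rewrite dotE; apply: eq_bigr => l _; rewrite !mxE.
  transitivity (dot (nth 0 X i - x0) (nth 0 X j - x0)).
    by rewrite !edges_gram !hh.
  by rewrite dotE; apply: eq_bigr => l _; rewrite !mxE.
exists (invmx B *m B'), (h x0 - x0 *m (invmx B *m B')); split.
  rewrite trmx_mul !mulmxA -(mulmxA (invmx B)) BB mulmxA mulVmx // mul1mx.
  by rewrite trmx_inv mulmxV // unitmx_tr.
move=> x xC; rewrite addrCA -mulmxBl.
have [->|xx0] := eqVneq x x0; first by rewrite subrr mul0mx addr0.
have xX : x \in X by rewrite in_fsetD1 xx0.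
have im : (index x X < n)%N by rewrite -[Y in (_ < Y)%N]sX index_mem.
have -> : x - x0 = row (Ordinal im) B by rewrite rowK /= nth_index.
by rewrite -row_mul mulmxA mulmxV // mul1mx rowK /= nth_index // addrC subrK.
Qed.

End Euclidean_geometry.

(** * Small perturbations of real numbers relative to the integers *)

Lemma not_int_between (R : realType) (x : R) (k : int) :
  k%:~R < x -> x < (k + 1)%:~R -> x \isn't a Num.int.
Proof.
move=> h1 h2; apply/negP => /intrP[m xm].
by move: h1 h2; rewrite xm !ltr_int; lia.
Qed.

Lemma near_all (T : eqType) (R : realType) (s : seq T) (P : T -> R -> Prop) :
  (forall a, a \in s -> exists2 e, 0 < e & forall t, 0 <= t <= e -> P a t) ->
  exists2 e, 0 < e & forall a t, a \in s -> 0 <= t <= e -> P a t.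
Proof.
elim: s => [|a s IH] h; first by exists 1.
have [e e0 he] : exists2 e, 0 < e & forall a t, a \in s -> 0 <= t <= e -> P a t.
  by apply: IH => b bs; apply: h; rewrite inE bs orbT.
have [e' e'0 he'] := h a (mem_head _ _).
exists (Num.min e e'); first by rewrite lt_min e0.
move=> b t; rewrite inE le_min => /orP[/eqP->|bs] /and3P[t0 t1 t2].
  by apply: he'; rewrite t0.
by apply: he; rewrite ?t0.
Qed.

Section Perturbation.
Variable R : realType.
Implicit Types x y t e : R.

Lemma near_ge_int x y : exists2 e, 0 < e & forall t, 0 <= t <= e ->
  forall k : int, k%:~R <= x + t * y -> k%:~R <= x.
Proof.
have [y0|y0] := leP y 0.
  exists 1 => // t /andP[t0 _] k h.
  by have := mulr_ge0_le0 t0 y0; move: h; lra.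
have m0 : 0 < (Num.floor x + 1)%:~R - x by rewrite subr_gt0 floorD1_gt.
(* The factor 2 keeps [x + t * y] strictly below the next integer, even at the end of the
   interval. *)
exists (((Num.floor x + 1)%:~R - x) / (2 * y)) => [|t /andP[t0]].
  by rewrite divr_gt0 // mulr_gt0.
rewrite ler_pdivlMr ?mulr_gt0 // => te k h.
rewrite -floor_ge_int.
have : k%:~R < (Num.floor x + 1)%:~R :> R by lra.
by rewrite ltr_int ltzD1.
Qed.

Lemma near_le_int x y : x \isn't a Num.int ->
  exists2 e, 0 < e & forall t, 0 <= t <= e ->
  forall k : int, k%:~R <= x -> k%:~R <= x + t * y.
Proof.
move=> xi; have [y0|y0] := leP 0 y.
  exists 1 => // t /andP[t0 _] k h.
  by have := mulr_ge0 t0 y0; move: h; lra.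
have m0 : 0 < x - (Num.floor x)%:~R.
  by rewrite subr_gt0 lt_neqAle floor_le -intrEfloor xi.
exists ((x - (Num.floor x)%:~R) / - y) => [|t /andP[t0]].
  by rewrite divr_gt0 // oppr_gt0.
rewrite ler_pdivlMr ?oppr_gt0 // => te k; rewrite -floor_ge_int => h.
have : k%:~R <= (Num.floor x)%:~R :> R by rewrite ler_int.
lra.
Qed.

Lemma near_neq0 x y : x != 0 ->
  exists2 e, 0 < e & forall t, 0 <= t <= e -> x + t * y != 0.
Proof.
move=> x0; have d0 : 0 < `|y| + 1 by rewrite ltr_wpDl.
exists (`|x| / (2 * (`|y| + 1))) => [|t /andP[t0]].
  by rewrite divr_gt0 ?normr_gt0 // mulr_gt0.
rewrite ler_pdivlMr ?mulr_gt0 // => h; apply/eqP => e.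
have : `|x| = t * `|y|.
  by rewrite -[t in RHS]ger0_norm // -normrM -normrN; congr (`|_|); lra.
have xp : 0 < `|x| by rewrite normr_gt0.
by move=> xe; have : 0 <= t * `|y|; [rewrite mulr_ge0 | lra].
Qed.

Lemma near_not_int x y : y != 0 ->
  exists2 e, 0 < e & forall t, 0 <= t <= e -> 0 < t -> x + t * y \isn't a Num.int.
Proof.
wlog y0 : x y / 0 < y => [hw|].
  rewrite neq_lt => /orP[y0|y0]; last by apply: hw; rewrite ?gt_eqF.
  have [||e e0 he] := hw (- x) (- y); rewrite ?oppr_gt0 ?oppr_eq0 ?lt_eqF //.
  exists e => // t h t0; have := he t h t0.
  by rewrite mulrN -opprD rpredN.
have m0 : 0 < (Num.floor x + 1)%:~R - x by rewrite subr_gt0 floorD1_gt.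
exists (((Num.floor x + 1)%:~R - x) / (2 * y)) => [|t /andP[_]].
  by rewrite divr_gt0 // mulr_gt0.
rewrite ler_pdivlMr ?mulr_gt0 // => te t0; have := mulr_gt0 t0 y0 => ty.
have := floor_le x => fx.
apply: (@not_int_between _ _ (Num.floor x)); lra.
Qed.

End Perturbation.

Lemma seq_argmin (T : eqType) (R : realType) (s : seq T) (f : T -> R) :
  s != [::] -> exists2 a, a \in s & forall b, b \in s -> f a <= f b.
Proof.
elim: s => // a [|b s] IH _; first by exists a; rewrite ?mem_head // => b; rewrite inE => /eqP->.
have [c cs hc] := IH isT; have [h|h] := leP (f a) (f c).
  exists a; first exact: mem_head.
  by move=> d; rewrite inE => /orP[/eqP->//|/hc]; exact: le_trans.
exists c; first by rewrite inE cs orbT.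
by move=> d; rewrite inE => /orP[/eqP->|/hc//]; exact: ltW.
Qed.

(** * Facets, vertices and alcoves of the Coxeter complex *)

Section Facets.
Variables (R : realType) (n : nat) (Phi : {fset 'rV[R]_n}).
Hypothesis hPhi : root_system Phi.
Local Notation V := 'rV[R]_n.
Local Notation cf := (closed_facet Phi).
Implicit Types (u v w x y z p q d a b : V) (C s : {fset V}) (k : int).

Lemma root_ne0 a : a \in Phi -> a != 0.
Proof. by apply: contraTneq => ->; case: hPhi. Qed.

Lemma root_opp a : a \in Phi -> - a \in Phi.
Proof.
move=> aP; have := root_refl hPhi aP aP; rewrite /reflection mulfK.
  by rewrite scaler_nat mulr2n opprD addrA subrr sub0r.
by rewrite gt_eqF // dot_gt0 // root_ne0.
Qed.

Lemma dim_gt0 : (0 < n)%N.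
Proof.
have /fset0Pn[a /root_ne0] := root_nonempty hPhi.
case: (posnP n) => // n0; suff -> : a = 0 by rewrite eqxx.
by apply/rowP => i; have := ltn_ord i; rewrite {2}n0.
Qed.

Lemma root_dot_inj u v : (forall a, a \in Phi -> dot u a = dot v a) -> u = v.
Proof.
move=> h; apply/eqP; rewrite -subr_eq0 -dot_eq0.
have : u - v \in <<Phi>>%VS by rewrite (root_span hPhi) memvf.
move: (u - v) (fun a aP => etrans (dotBl u v a) (etrans (congr1 (fun r => r - dot v a) (h a aP)) (subrr _))) => d hd.
rewrite (_ : (Phi : seq V) = in_tuple Phi) // => /coord_span e.
rewrite {2}e dot_sumr big1 // => i _; rewrite dotZr hd ?mulr0 //.
exact: mem_nth.
Qed.

Lemma root_prop a b (c : R) : a \in Phi -> b \in Phi -> b = c *: a -> b = a \/ b = - a.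
Proof.
move=> aP + e; rewrite {}e => bP; case: (root_reduced hPhi aP bP) => ->.
  by left; rewrite scale1r.
by right; rewrite scaleN1r.
Qed.

Lemma cf_refl p : cf p p. Proof. by []. Qed.

Lemma cf_trans p q r : cf p q -> cf q r -> cf p r.
Proof. by move=> h1 h2 a k aP h; apply: h2 => //; apply: h1. Qed.

Lemma cf_le p q a k : a \in Phi -> cf p q -> dot p a <= k%:~R -> dot q a <= k%:~R.
Proof.
move=> aP h pk; have := h (- a) (- k) (root_opp aP).
by rewrite !dotNr intrN !lerN2; apply.
Qed.

Lemma cf_int p q a k : a \in Phi -> cf p q -> dot p a = k%:~R -> dot q a = k%:~R.
Proof.
move=> aP h e; apply/eqP; rewrite eq_le (cf_le aP h) ?e //=.
by apply: h => //; rewrite e.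
Qed.

Lemma cf_comb p s (c : V -> R) : in_simplex s c ->
  (forall x, x \in s -> cf p x) -> cf p (\sum_(x <- s) c x *: x).
Proof.
move=> [c0 _ c1] h a k aP pk; rewrite dot_suml.
have -> : k%:~R = \sum_(x <- s) c x * k%:~R by rewrite -mulr_suml c1 mul1r.
rewrite big_seq [X in _ <= X]big_seq; apply: ler_sum => x xs.
by rewrite dotZl ler_wpM2l //; apply: h.
Qed.

(** Local finiteness of the walls: a short step away from [p] crosses no wall, so it only reaches
    facets whose closure contains [p]. *)
Lemma near_cf p d : exists2 e, 0 < e & forall t, 0 <= t <= e -> cf (p + t *: d) p.
Proof.
have [e e0 he] := @near_all _ _ Phi (fun a t => forall k, k%:~R <= dot p a + t * dot d a ->
  k%:~R <= dot p a) (fun a _ => near_ge_int (dot p a) (dot d a)).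
exists e => // t ht a k aP; rewrite dotDl dotZl; exact: he.
Qed.

(** The walls through [p] are parallel to [d], and all the others are at a positive distance. *)
Lemma near_cf_from p d :
  (forall a, a \in Phi -> dot p a \is a Num.int -> dot d a = 0) ->
  exists2 e, 0 < e & forall t, 0 <= t <= e -> cf p (p + t *: d).
Proof.
move=> h.
have [|e e0 he] := @near_all _ _ Phi (fun a t => forall k, k%:~R <= dot p a ->
  k%:~R <= dot p a + t * dot d a).
  move=> a aP; have [i|i] := boolP (dot p a \is a Num.int); last exact: near_le_int.
  by exists 1 => // t _ k; rewrite h // mulr0 addr0.
by exists e => // t ht a k aP; rewrite dotDl dotZl; exact: he.
Qed.

(** The point is in the interior of an alcove. *)
Definition generic p := forall a, a \in Phi -> dot p a \isn't a Num.int.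

Lemma regular_direction : exists d, forall a, a \in Phi -> dot d a != 0.
Proof.
suff H (s : seq V) : (forall a, a \in s -> a != 0) -> exists d, forall a, a \in s -> dot d a != 0.
  by apply: H => a; exact: root_ne0.
elim: s => [|a s IH] h; first by exists 0.
have [d hd] : exists d, forall a, a \in s -> dot d a != 0.
  by apply: IH => b bs; apply: h; rewrite inE bs orbT.
have [e e0 he] := near_all (fun b bs => near_neq0 (dot a b) (hd b bs)).
have a0 : 0 < dot a a by rewrite dot_gt0 // h // mem_head.
(* At most one [t] makes [d + t *: a] orthogonal to [a], so one of [e] and [e / 2] works. *)
pose t := if dot d a + e * dot a a == 0 then e / 2 else e.
have t0 : 0 < t by rewrite /t; case: ifP => _ //; rewrite divr_gt0.
have te : t <= e by rewrite /t; case: ifP => _ //; lra.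
exists (d + t *: a) => b; rewrite dotDl dotZl inE => /orP[/eqP->|bs]; last first.
  by apply: he => //; rewrite ltW.
rewrite /t; case: ifP => [/eqP h0|/negbT//].
by have := mulr_gt0 e0 a0 => ea; apply/eqP; lra.
Qed.

Lemma generic_near p : exists2 q, generic q & cf q p.
Proof.
have [d hd] := regular_direction; have [e e0 he] := near_cf p d.
have [e' e'0 he'] := near_all (fun b bs => near_not_int (dot p b) (hd b bs)).
have m0 : 0 < Num.min e e' by rewrite lt_min e0.
exists (p + Num.min e e' *: d).
  move=> a aP; rewrite dotDl dotZl; apply: he' => //.
  by rewrite (ltW m0) ge_min lexx orbT.
by apply: he; rewrite (ltW m0) ge_min lexx.
Qed.

(** Finiteness: a vertex of the facet is determined by the set of roots at which it attains the
    lower bound [Num.floor (dot p a)]. Upper bounds are lower bounds for [- a]. Hence the vertices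
    inject into the subsets of [Phi]. *)
Lemma vertices_of_facet p :
  exists s : {fset V}, forall v, v \in s <-> coxeter_vertex Phi v /\ cf p v.
Proof.
pose A v := coxeter_vertex Phi v /\ cf p v.
pose code v := [fset a in Phi | dot v a == (Num.floor (dot p a))%:~R].
have code_inj v w : A v -> A w -> code v = code w -> w = v.
  move=> [vv pv] [_ pw] e.
  suff : cf v w by rewrite vv.
  move=> a k aP kv.
  have fw : (Num.floor (dot p a))%:~R <= dot w a by apply: pw => //; rewrite floor_le.
  have [kf|fk] := leP k (Num.floor (dot p a)).
    by apply: le_trans fw; rewrite ler_int.
  have [i|i] := boolP (dot p a \is a Num.int).
    move: kv; rewrite (cf_int aP pv (esym (floorK i))) ler_int; lia.
  have fN : Num.floor (dot p (- a)) = - (Num.floor (dot p a)) - 1.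
    apply: floor_def; rewrite subrK dotNr intrB intrN.
    have := floor_le (dot p a); have := floorD1_gt (dot p a); rewrite intrD => h1 h2.
    have : dot p a != (Num.floor (dot p a))%:~R by rewrite eq_sym -intrEfloor.
    by rewrite neq_lt; case/orP; lra.
  have vle : dot v a <= (Num.floor (dot p a) + 1)%:~R.
    by apply: (cf_le aP pv); rewrite ltW // floorD1_gt.
  have fk' : k = Num.floor (dot p a) + 1.
    by have := le_trans kv vle; rewrite ler_int; lia.
  have : - a \in code v.
    rewrite !inE root_opp //= fN dotNr intrB intrN -opprD eqr_opp eq_le.
    by rewrite intrD in vle; rewrite vle -[1]/(1%:~R) -intrD -fk' kv.
  rewrite e !inE root_opp //= fN dotNr intrB intrN -opprD eqr_opp => /eqP->.
  by rewrite fk' intrD.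
(* One vertex is chosen for each code; a subset that is not a code yields the default [0], whence
   the filter in the witness. *)
pose s0 := [fset xget 0 [set v | A v /\ code v = c] | c in fpowerset Phi].
exists [fset v in s0 | `[< A v >]] => v; rewrite !inE /=; split=> [/andP[_ /asboolP]//|Av].
apply/andP; split; last exact/asboolP.
apply/imfsetP; exists (code v) => /=.
  by rewrite fpowersetE; apply/fsubsetP => a; rewrite !inE => /andP[].
case: xgetP => [w _ [Aw ew]|/(_ v)]; last by case.
exact: code_inj Aw Av ew.
Qed.

Definition vset p : {fset V} := projT1 (cid (vertices_of_facet p)).

Lemma in_vset p v : v \in vset p <-> coxeter_vertex Phi v /\ cf p v.
Proof. exact: (projT2 (cid (vertices_of_facet p))). Qed.

Local Notation Sigma := (coxeter_complex Phi).

Lemma simplexP s : simplex Sigma s <-> exists p, s = vset p.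
Proof.
split=> [[p hp]|[p ->]]; exists p; last exact: in_vset.
apply/fsetP => v; apply/idP/idP => [/(hp v).1|/(in_vset p v).1]; first by move/in_vset.
by move/hp.
Qed.

Lemma simplex_vset p : simplex Sigma (vset p).
Proof. by apply/simplexP; exists p. Qed.

Lemma vset_sub p q : cf p q -> {subset vset q <= vset p}.
Proof. by move=> h v /in_vset[vv qv]; apply/in_vset; split=> //; apply: cf_trans qv. Qed.

(** [f a] is the time at which the ray from [p] along [d] meets the next wall normal to [a], and the
    first of these times works. Some root has [0 < dot d a] because the roots span and come in
    opposite pairs. *)
Lemma facet_exit p d : d != 0 ->
  (forall a, a \in Phi -> dot p a \is a Num.int -> dot d a = 0) ->
  exists t, [/\ 0 < t, cf p (p + t *: d) & exists a, [/\ a \in Phi,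
    dot p a \isn't a Num.int & dot (p + t *: d) a \is a Num.int]].
Proof.
move=> d0 hd; pose s := [seq a <- Phi | 0 < dot d a].
have s0 : s != [::].
  apply/eqP => s0; move/eqP: d0; apply; apply: root_dot_inj => a aP; rewrite dot0l.
  have ns b : b \in Phi -> dot d b <= 0.
    move=> bP; rewrite leNgt; apply/negP => h.
    by have : b \in s; [rewrite mem_filter h | rewrite s0].
  by apply/eqP; rewrite eq_le ns //= -oppr_le0 -dotNr ns ?root_opp.
pose f a := ((Num.floor (dot p a) + 1)%:~R - dot p a) / dot d a.
have [a0] := seq_argmin f s0; rewrite mem_filter => /andP[da0 a0P] ha0.
have f0 : 0 < f a0 by rewrite divr_gt0 // subr_gt0 floorD1_gt.
exists (f a0); split=> //.
  move=> a k aP kp; rewrite dotDl dotZl.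
  have [i|i] := boolP (dot p a \is a Num.int); first by rewrite hd // mulr0 addr0.
  have [da|da] := leP 0 (dot d a).
    by have := mulr_ge0 (ltW f0) da; lra.
  have : - a \in s by rewrite mem_filter dotNr oppr_gt0 da root_opp.
  move/ha0; rewrite {2}/f !dotNr ler_pdivlMr ?oppr_gt0 //.
  have : - dot p a < (- k)%:~R.
    rewrite intrN ltrN2 lt_neqAle kp andbT; apply: contraNneq i => <-.
    exact: intr_int.
  rewrite -floor_lt_int => h.
  have : (Num.floor (- dot p a) + 1)%:~R <= (- k)%:~R :> R by rewrite ler_int lezD1.
  rewrite [(- k)%:~R]intrN; lra.
exists a0; split=> //.
  by apply: contraTN da0 => /(hd _ a0P) ->; rewrite ltxx.
by rewrite dotDl dotZl divfK ?gt_eqF // addrC subrK intr_int.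
Qed.

Lemma in_simplex_incl (T : choiceType) (s s' : {fset T}) (c : T -> R) :
  {subset s <= s'} -> in_simplex s c -> in_simplex s' c.
Proof.
move=> /fsubsetP ss [c0 cs c1]; split=> //.
  by move=> x xs; apply: cs; apply: contra xs; apply/fsubsetP.
rewrite -c1; apply/esym/big_fset_incl => // x _ /cs->//.
Qed.

Lemma comb_incl (T : choiceType) (s s' : {fset T}) (c : T -> R) (f : T -> V) :
  {subset s <= s'} -> in_simplex s c ->
  \sum_(x <- s') c x *: f x = \sum_(x <- s) c x *: f x.
Proof.
move=> /fsubsetP ss [_ cs _]; apply/esym/big_fset_incl => // x _ /cs->.
by rewrite scale0r.
Qed.

(** Induction on the number of roots not integral at [p]. If [p] is not a vertex, its closed facet
    contains a line segment through [p]; both ends, where the line leaves the facet, are integral at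
    more roots, and [p] lies between them. *)
Lemma facet_conv p : exists c, in_simplex (vset p) c /\ \sum_(x <- vset p) c x *: x = p.
Proof.
have [m] := ubnP #|` [fset a in Phi | dot p a \isn't a Num.int]|.
elim: m p => // m IH p; rewrite ltnS => pm.
have [vp|nv] := pselect (coxeter_vertex Phi p).
  have pp : p \in vset p by apply/in_vset; split.
  exists (fun x => (x == p)%:R); split; last first.
    rewrite (big_fsetD1 p) //= eqxx scale1r big1_fset ?addr0 // => x.
    by rewrite in_fsetD1 => /andP[/negbTE-> _ _]; rewrite scale0r.
  split=> [x|x|]; first exact: ler0n.
    by case: eqP => // ->; rewrite pp.
  rewrite (big_fsetD1 p) //= eqxx big1_fset ?addr0 // => x.
  by rewrite in_fsetD1 => /andP[/negbTE-> _ _].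
have [q qp pq] : exists2 q, q != p & cf p q.
  apply: contrapT => h; apply: nv; apply/seteqP; split=> [q pq|q ->//].
  by apply: contrapT => /eqP qp; apply: h; exists q.
have hd a : a \in Phi -> dot p a \is a Num.int -> dot (q - p) a = 0.
  move=> aP /floorK e; rewrite dotBl -[X in _ - X]e.
  by rewrite (cf_int aP pq (esym e)) subrr.
have go d : d != 0 -> (forall a, a \in Phi -> dot p a \is a Num.int -> dot d a = 0) ->
    exists t c, [/\ 0 < t, in_simplex (vset p) c & \sum_(x <- vset p) c x *: x = p + t *: d].
  move=> d0 /(facet_exit d0)[t [t0 pt [a [aP na ia]]]].
  have [|c [c1 c2]] := IH (p + t *: d).
    apply: leq_trans pm; apply: fproper_ltn_card; rewrite fproperE; apply/andP; split.
      apply/fsubsetP => b; rewrite !inE => /andP[bP nb]; rewrite bP /=; apply: contra nb => /floorK e.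
      by rewrite (cf_int bP pt (esym e)) intr_int.
    by apply/fsubsetPn; exists a; rewrite !inE aP //= ia.
  exists t, c; split=> //; first exact: in_simplex_incl (vset_sub pt) c1.
  by rewrite -c2; apply: comb_incl (vset_sub pt) c1.
have d0 : q - p != 0 by rewrite subr_eq0.
have [t1 [c1 [t10 [c1p c1s c11] c12]]] := go _ d0 hd.
have [||t2 [c2 [t20 [c2p c2s c21] c22]]] := go (- (q - p)).
- by rewrite oppr_eq0.
- by move=> a aP ia; rewrite dotNl hd // oppr0.
have t120 : 0 < t1 + t2 by rewrite addr_gt0.
(* The exit points are at times [t1] and [- t2], and [l] is the weight for which their combination
   is [p]. *)
have [l [l0 l10 l12]] : exists l, [/\ 0 <= l, 0 <= 1 - l & l * t1 = (1 - l) * t2].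
  have l1 : 1 - t2 / (t1 + t2) = t1 / (t1 + t2).
    by apply: (@mulIf _ (t1 + t2)); rewrite ?gt_eqF // mulrBl !divfK ?gt_eqF //; lra.
  exists (t2 / (t1 + t2)); rewrite l1; split; rewrite ?divr_ge0 ?(ltW t10, ltW t20, ltW t120) //.
  lra.
exists (fun x => l * c1 x + (1 - l) * c2 x); split.
  split=> [x|x xs|]; first by rewrite addr_ge0 // mulr_ge0.
    by rewrite c1s // c2s // !mulr0 addr0.
  by rewrite big_split /= -!mulr_sumr c11 c21 !mulr1 addrC subrK.
under eq_bigr => x _ do rewrite scalerDl -!scalerA.
rewrite big_split /= -!scaler_sumr c12 c22.
rewrite (scalerDr l) (scalerDr (1 - l)) addrACA -scalerDl [l + _]addrC subrK scale1r.
by rewrite !scalerN !scalerA l12 subrr addr0.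
Qed.

(** A choice of barycentric coordinates, zero off [vset p]; affine independence makes it the only
    one ([bary_uniq]). *)
Definition bary p : V -> R := projT1 (cid (facet_conv p)).

Lemma bary_in p : in_simplex (vset p) (bary p).
Proof. exact: (projT2 (cid (facet_conv p))).1. Qed.

Lemma bary_comb p : \sum_(x <- vset p) bary p x *: x = p.
Proof. exact: (projT2 (cid (facet_conv p))).2. Qed.

Hypothesis ai : forall s, simplex Sigma s -> affinely_independent s id.

Lemma bary_uniq s (c : V -> R) : simplex Sigma s -> in_simplex s c ->
  c = bary (\sum_(x <- s) c x *: x).
Proof.
move=> sS cs; have [w sw] := (simplexP s).1 sS.
set q := \sum_(x <- s) _.
have wq : cf w q by apply: cf_comb cs _ => x; rewrite sw => /in_vset[].
have qs : {subset vset q <= s} by rewrite sw; exact: vset_sub.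
have bs := in_simplex_incl qs (bary_in q).
have bq : \sum_(x <- s) bary q x *: x = q.
  by rewrite -[RHS]bary_comb; apply: comb_incl (bary_in q).
have h := @ai s sS (fun x => c x - bary q x).
apply: funext => x; have [xs|xs] := boolP (x \in s).
  apply/eqP; rewrite -subr_eq0; apply/eqP/h => //.
    by rewrite sumrB; case: cs bs => _ _ -> [_ _ ->]; rewrite subrr.
  under eq_bigr => y _ do rewrite scalerBl.
  by rewrite sumrB bq subrr.
by case: cs bs => _ c0 _ [_ b0 _]; rewrite c0 // b0.
Qed.

Lemma vset_neq0 p : vset p != fset0.
Proof.
apply/eqP => h; case: (bary_in p) => _ _; rewrite h big_nil => /esym/eqP.
by rewrite oner_eq0.
Qed.

(** [p] is interior to its facet: the point [z], slightly beyond [p] as seen from [x], is still in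
    it. Uniqueness of coordinates gives [(1 + e) * bary p x = bary z x + e], which is positive. *)
Lemma bary_gt0 p x : x \in vset p -> 0 < bary p x.
Proof.
move=> xp; have [vx px] := (in_vset p x).1 xp.
have [|e e0 he] := @near_cf_from p (p - x).
  by move=> a aP /floorK i; rewrite dotBl -[X in X - _]i (cf_int aP px (esym i)) subrr.
have pz : cf p (p + e *: (p - x)) by apply: he; rewrite lexx ltW.
pose z := p + e *: (p - x).
have bz := in_simplex_incl (vset_sub pz) (bary_in z).
have [b0 bs b1] := bz; have [p0 ps p1] := bary_in p.
have h y := @ai _ (simplex_vset p) (fun y => bary z y + e * (y == x)%:R - (1 + e) * bary p y).
have sx : \sum_(y <- vset p) (y == x)%:R = 1 :> R.
  rewrite (big_fsetD1 x) //= eqxx big1_fset ?addr0 // => y.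
  by rewrite in_fsetD1 => /andP[/negbTE->].
have sxv : \sum_(y <- vset p) (y == x)%:R *: y = x.
  rewrite (big_fsetD1 x) //= eqxx scale1r big1_fset ?addr0 // => y.
  by rewrite in_fsetD1 => /andP[/negbTE->]; rewrite scale0r.
have : bary z x + e * (x == x)%:R - (1 + e) * bary p x = 0.
  apply: h xp => //.
    by rewrite sumrB big_split /= -!mulr_sumr b1 p1 sx; lra.
  under eq_bigr => y _ do rewrite scalerBl scalerDl -!scalerA.
  rewrite sumrB big_split /= -!scaler_sumr sxv bary_comb.
  rewrite (comb_incl id (vset_sub pz) (bary_in z)) bary_comb /z.
  by rewrite scalerBr scalerDl scale1r addrA subrK subrr.
rewrite eqxx mulr1; have := b0 x; have := p0 x; rewrite le_eqVlt => /orP[/eqP<-|//].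
rewrite mulr0 subr0 => h1 h2; have : 0 < bary z x + e by rewrite ltr_wpDl.
by rewrite h2 ltxx.
Qed.

Lemma in_vset_bary p x : (x \in vset p) = (bary p x != 0).
Proof.
apply/idP/idP => [/bary_gt0|]; first by move/gt_eqF/negbT.
by apply: contraR => xp; case: (bary_in p) => _ h _; rewrite h.
Qed.

Lemma vset_comb s (c : V -> R) : simplex Sigma s -> in_simplex s c ->
  vset (\sum_(x <- s) c x *: x) = [fset x in s | c x != 0].
Proof.
move=> sS cs; apply/fsetP => x; rewrite in_vset_bary -(bary_uniq sS cs) !inE.
have [//|xs] /= := boolP (x \in s).
by case: cs => _ h _; rewrite h // eqxx.
Qed.

(** The barycentre; the guard makes the weight function vanish off [s], as [in_simplex] demands. *)
Definition avg s : V := \sum_(x <- s) (if x \in s then (#|` s|%:R)^-1 else 0 : R) *: x.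

Lemma avg_in_simplex s : s != fset0 ->
  in_simplex s (fun x => if x \in s then (#|` s|%:R)^-1 else 0 : R).
Proof.
move=> s0; split=> [x|x /negbTE->//|].
  by case: ifP => // _; rewrite invr_ge0.
rewrite big_seq_cond (eq_bigr (fun=> (#|` s|%:R)^-1)); last by move=> x; rewrite andbT => ->.
rewrite -big_seq_cond big_const_seq count_predT iter_addr_0 -[_ *+ _]mulr_natr mulVf //.
by rewrite pnatr_eq0 -lt0n cardfs_gt0.
Qed.

(** All coordinates of the barycentre of [t] are nonzero on [t]. Every nonempty face of a simplex is
    thus carried by a point, hence is itself a simplex. *)
Lemma vset_avg s t : simplex Sigma s -> t != fset0 -> {subset t <= s} -> vset (avg t) = t.
Proof.
move=> sS t0 ts; rewrite /avg -(comb_incl id ts (avg_in_simplex t0)) vset_comb //.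
  apply/fsetP => x; rewrite !inE; case: ifP => [xt|_]; last by rewrite eqxx andbF.
  by rewrite ts // invr_eq0 pnatr_eq0 -lt0n cardfs_gt0.
exact: in_simplex_incl ts (avg_in_simplex t0).
Qed.

Lemma simplex_face s t : simplex Sigma s -> t != fset0 -> {subset t <= s} -> simplex Sigma t.
Proof. by move=> sS t0 ts; rewrite -(vset_avg sS t0 ts); exact: simplex_vset. Qed.

Lemma vset_vertex v : coxeter_vertex Phi v -> vset v = [fset v].
Proof.
move=> vv; apply/fsetP => x; rewrite inE; apply/idP/eqP => [/in_vset[_]|->].
  by rewrite vv.
by apply/in_vset; split.
Qed.

Lemma simplex_vertex v : coxeter_vertex Phi v -> simplex Sigma [fset v].
Proof. by move/vset_vertex <-; exact: simplex_vset. Qed.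

Lemma vertex_of_simplex s v : simplex Sigma s -> v \in s -> coxeter_vertex Phi v.
Proof. by case/simplexP => p -> /in_vset[]. Qed.

Lemma cf_vset p q : (forall x, x \in vset q -> cf p x) -> cf p q.
Proof. by move=> h; rewrite -[q]bary_comb; apply: cf_comb h; exact: bary_in. Qed.

(** A form that is constant on the vertices is constant on the facet. As no wall passes through [q],
    the facet contains a step from [q] along the normal of the form, so the form is zero and
    [frame_card] applies. *)
Lemma generic_card q : generic q -> #|` vset q| = n.+1.
Proof.
move=> gq; apply: frame_card (ai (simplex_vset q)) (vset_neq0 q) _ => a k h.
have hc p : cf q p -> dot p a = k.
  move=> qp; rewrite -[p]bary_comb dot_suml.
  rewrite (eq_big_seq (fun x => bary p x * k)) => [|x xp]; last first.
    by rewrite dotZl h //; exact: vset_sub xp.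
  by rewrite -mulr_suml; case: (bary_in p) => _ _ ->; rewrite mul1r.
have [|e e0 he] := @near_cf_from q a; first by move=> b /gq/negbTE->.
have := hc _ (he e _); rewrite lexx ltW // => /(_ isT).
rewrite dotDl dotZl (hc q (@cf_refl q)) => /eqP; rewrite -subr_eq0 addrC addKr.
by rewrite mulf_eq0 gt_eqF //= dot_eq0 => /eqP.
Qed.

Definition alcove C := simplex Sigma C /\ #|` C| = n.+1.

Lemma alcove_vset q : generic q -> alcove (vset q).
Proof. by move=> gq; split; [exact: simplex_vset|exact: generic_card]. Qed.

Lemma alcove_ai C : alcove C -> affinely_independent C id.
Proof. by case=> /ai. Qed.

Lemma alcove_neq0 C : alcove C -> C != fset0.
Proof. by case=> _ cC; rewrite -cardfs_gt0 cC. Qed.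

Lemma vset_avg_alcove C : alcove C -> vset (avg C) = C.
Proof. by move=> aC; apply: (vset_avg aC.1) => //; exact: alcove_neq0. Qed.

Lemma alcove_generic C : alcove C -> generic (avg C).
Proof.
move=> aC a aP; apply/negP => /floorK i.
have : a = 0.
  apply: (frame_dot_const (alcove_ai aC) aC.2) => x; rewrite -[in x \in _](vset_avg_alcove aC).
  by move=> /in_vset[_ h]; apply: cf_int (esym i).
by move/eqP/negPn; rewrite root_ne0.
Qed.

Lemma simplex_sub_alcove s : simplex Sigma s -> exists2 C, alcove C & {subset s <= C}.
Proof.
case/simplexP => p ->; have [q gq qp] := generic_near p.
by exists (vset q); [exact: alcove_vset|exact: vset_sub].
Qed.

Lemma panel_card C x : alcove C -> x \in C -> #|` C `\ x| = n.
Proof. by move=> [_ cC] xC; exact: card_fsetD1 cC. Qed.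

Lemma panel_neq0 C x : alcove C -> x \in C -> C `\ x != fset0.
Proof. by move=> aC xC; rewrite -cardfs_gt0 panel_card // dim_gt0. Qed.

Lemma panel_sub C x : {subset C `\ x <= C}.
Proof. by move=> y; rewrite in_fsetD1 => /andP[]. Qed.

Lemma vset_avg_panel C x : alcove C -> x \in C -> vset (avg (C `\ x)) = C `\ x.
Proof. by move=> aC xC; apply: (vset_avg aC.1); [exact: panel_neq0|exact: panel_sub]. Qed.

(** The barycentre of the panel is not generic, since a generic point is carried by [n.+1] vertices.
    So it lies on a wall, which then contains the panel but not [x]; the sign of the root is chosen
    last. *)
Lemma panel_wall C x : alcove C -> x \in C -> exists a k, [/\ a \in Phi,
  forall y, y \in C -> y != x -> dot y a = k%:~R & k%:~R < dot x a].
Proof.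
move=> aC xC; pose m := avg (C `\ x).
have [a [k [aP mk]]] : exists a k, a \in Phi /\ dot m a = k%:~R.
  apply: contrapT => h; have gm : generic m.
    by move=> a aP; apply/negP => /floorK i; apply: h; exists a, (Num.floor (dot m a)).
  have := generic_card gm; rewrite vset_avg_panel // panel_card // => /eqP.
  by rewrite -[X in X == _]addn0 -addn1 eqn_add2l.
have hy y : y \in C -> y != x -> dot y a = k%:~R.
  move=> yC yx; have : y \in vset m by rewrite vset_avg_panel // in_fsetD1 yx.
  by case/in_vset => _ h; apply: cf_int mk.
have : dot x a != k%:~R.
  apply/eqP => xa; have : a = 0.
    apply: (frame_dot_const (alcove_ai aC) aC.2) => y yC.
    by have [->|] := eqVneq y x; [exact: xa|exact: hy].
  by move/eqP/negPn; rewrite root_ne0.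
rewrite neq_lt => /orP[h|h]; last by exists a, k.
exists (- a), (- k); split; first exact: root_opp.
  by move=> y yC yx; rewrite dotNr hy // intrN.
by rewrite dotNr intrN ltrN2.
Qed.

End Facets.

(** * Symmetries of the Coxeter complex and reflections in panels *)

Section Symmetries.
Variables (R : realType) (n : nat) (Phi : {fset 'rV[R]_n}).
Hypothesis hPhi : root_system Phi.
Local Notation V := 'rV[R]_n.
Local Notation cf := (closed_facet Phi).
Local Notation Sigma := (coxeter_complex Phi).
Local Notation vset := (vset hPhi).
Implicit Types (u v w x y z p q d a b t : V) (C s : {fset V}) (k m : int).

(** [M] acts on row vectors from the right and may be any orthogonal automorphism of [Phi],
    including one outside the Weyl group. *)
Record symm_data (M : 'M[R]_n) t : Prop := SymmData {
  sd_orth : M *m M^T = 1%:M;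
  sd_root : forall a, a \in Phi -> a *m M \in Phi;
  sd_coweight : forall a, a \in Phi -> dot t a \is a Num.int
}.

Definition symmetry (F : V -> V) :=
  exists M t, symm_data M t /\ forall v, F v = v *m M + t.

Lemma orthC (M : 'M[R]_n) : M *m M^T = 1%:M -> M^T *m M = 1%:M.
Proof. exact: mulmx1C. Qed.

Lemma dot_orth (M : 'M[R]_n) u v : M *m M^T = 1%:M -> dot (u *m M) (v *m M) = dot u v.
Proof. by move=> MM; rewrite dot_mulmx -mulmxA MM mulmx1. Qed.

(** [M] maps the finite set [Phi] injectively into itself, hence onto itself. *)
Lemma symm_data_inv M t : symm_data M t -> symm_data M^T (- t *m M^T).
Proof.
case=> MM Mr Mt; split; first by rewrite trmxK orthC.
  have inj : injective (fun a : V => a *m M).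
    by move=> a b /(congr1 (fun c => c *m M^T)); rewrite -!mulmxA MM !mulmx1.
  have : [fset a *m M | a in Phi] == Phi.
    rewrite eqEfcard card_imfset //= leqnn andbT; apply/fsubsetP => b /imfsetP[a /= aP ->].
    exact: Mr.
  move=> /eqP e a; rewrite -{1}e => /imfsetP[b /= bP ->].
  by rewrite -mulmxA MM mulmx1.
by move=> a aP; rewrite dot_mulmx trmxK dotNl rpredN Mt // Mr.
Qed.

Lemma symmetry_id : symmetry id.
Proof.
exists 1%:M, 0; split=> [|v]; last by rewrite mulmx1 addr0.
by split=> [|a aP|a aP]; rewrite ?trmx1 ?mulmx1 ?dot0l ?rpred0.
Qed.

Lemma symmetry_comp F G : symmetry F -> symmetry G -> symmetry (F \o G).
Proof.
move=> [M [t [hM hF]]] [N [t' [hN hG]]].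
exists (N *m M), (t' *m M + t); split=> [|v]; last first.
  by rewrite /= hG hF mulmxDl mulmxA addrA.
have iM := symm_data_inv hM.
case: hM hN => MM Mr Mt [NN Nr Nt]; split.
- by rewrite trmx_mul mulmxA -(mulmxA N) MM mulmx1.
- by move=> a aP; rewrite mulmxA; apply/Mr/Nr.
by move=> a aP; rewrite dotDl dot_mulmx rpredD ?Mt // Nt // (sd_root iM).
Qed.

Lemma symmetry_inv F : symmetry F -> exists G, [/\ symmetry G, cancel F G & cancel G F].
Proof.
move=> [M [t [hM hF]]]; exists (fun v => v *m M^T + - t *m M^T); split.
- by exists M^T, (- t *m M^T); split=> //; exact: symm_data_inv.
- by move=> v; rewrite hF -mulmxDl addrK -mulmxA (sd_orth hM) mulmx1.
- by move=> v; rewrite hF -mulmxDl -mulmxA (orthC (sd_orth hM)) mulmx1 subrK.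
Qed.

Lemma symmetry_inj F : symmetry F -> injective F.
Proof. by case/symmetry_inv => G [_ /can_inj]. Qed.

Lemma symmetry_edist F u v : symmetry F -> edist (F u) (F v) = edist u v.
Proof.
case=> M [t [hM hF]]; rewrite /edist !hF opprD addrACA subrr addr0 -mulmxBl.
by rewrite dot_orth // (sd_orth hM).
Qed.

Lemma symmetry_segment F u v (r : R) : symmetry F ->
  F (u + r *: (v - u)) = F u + r *: (F v - F u).
Proof.
case=> M [t [hM hF]]; rewrite !hF mulmxDl -scalemxAl mulmxBl.
by rewrite addrAC [- (u *m M + t)]opprD addrACA subrr addr0.
Qed.

Lemma symmetry_wall F a : symmetry F -> a \in Phi -> exists b m, [/\ b \in Phi,
  forall v, dot (F v) a = dot v b + m%:~R &
  forall (k : R) v, aref a k (F v) = F (aref b (k - m%:~R) v)].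
Proof.
move=> [M [t [hM hF]]] aP; exists (a *m M^T), (Num.floor (dot t a)).
have e v : dot (F v) a = dot v (a *m M^T) + (Num.floor (dot t a))%:~R.
  by rewrite hF dotDl dot_mulmx floorK // (sd_coweight hM).
split=> //; first exact: (sd_root (symm_data_inv hM)).
move=> k v; rewrite /aref e dot_orth ?trmxK ?orthC ?(sd_orth hM) //.
rewrite !hF mulmxBl -scalemxAl -mulmxA orthC ?(sd_orth hM) // mulmx1 addrAC.
by rewrite opprB addrA.
Qed.

Lemma symmetry_cf F p q : symmetry F -> cf p q -> cf (F p) (F q).
Proof.
move=> sF pq a k aP; have [b [m [bP e _]]] := symmetry_wall sF aP.
by rewrite !e -!lerBlDr -intrB; exact: pq.
Qed.

Lemma symmetry_vertex F v : symmetry F -> coxeter_vertex Phi v -> coxeter_vertex Phi (F v).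
Proof.
move=> sF vv; have [G [sG FK GK]] := symmetry_inv sF.
apply/seteqP; split=> [q /(symmetry_cf sG)|q ->]; last exact: cf_refl.
by rewrite FK => h; have : G q = v by [rewrite vv in h|]; move<-; rewrite /= GK.
Qed.

Lemma symmetry_vset F p : symmetry F -> vset (F p) = [fset F x | x in vset p].
Proof.
move=> sF; have [G [sG FK GK]] := symmetry_inv sF.
apply/fsetP => x; apply/idP/imfsetP => [/in_vset[vx px]|[y /= /in_vset[vy py] ->]].
  exists (G x); rewrite ?GK //=; apply/in_vset; split; first exact: symmetry_vertex.
  by rewrite -[p]FK; exact: symmetry_cf.
by apply/in_vset; split; [exact: symmetry_vertex|exact: symmetry_cf].
Qed.

Lemma symmetry_generic F p : symmetry F -> generic Phi p -> generic Phi (F p).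
Proof.
move=> sF gp a aP; have [b [m [bP e _]]] := symmetry_wall sF aP.
by rewrite e rpredDr ?intr_int // gp.
Qed.

Lemma symmetry_simplex F s : symmetry F -> simplex Sigma s -> simplex Sigma [fset F x | x in s].
Proof. by move=> sF /(simplexP hPhi)[p ->]; rewrite -symmetry_vset //; exact: simplex_vset. Qed.

Lemma symmetry_alcove F C : symmetry F -> alcove Phi C -> alcove Phi [fset F x | x in C].
Proof.
move=> sF [sC cC]; split; first exact: symmetry_simplex.
by rewrite card_imfset //; exact: symmetry_inj.
Qed.

(** A wall parallel to [hyperplane a 0] has a normal proportional to [a], hence equal to [a] or
    [- a] by reducedness. Conversely, if all roots are integral at [v], the facet of [v] has fixed
    values on a spanning set. *)
Lemma specialP v : coxeter_special Phi v <-> forall a, a \in Phi -> dot v a \is a Num.int.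
Proof.
split=> [[vv h] a aP|h].
  have [H' [[b [k [bP ->]]] [t ht] hv]] := h (hyperplane a 0) (ex_intro _ a (ex_intro _ 0 (conj aP erefl))).
  have tH w : dot w a = 0 -> dot (w + t) b = k%:~R.
    by move=> wa; have : hyperplane b k (w + t) by rewrite ht; exists w.
  have aa : dot a a != 0 by rewrite dot_eq0 (root_ne0 hPhi).
  pose c := dot b a / dot a a; have wa : dot (b - c *: a) a = 0.
    by rewrite dotBl dotZl divfK // subrr.
  have eb : b = c *: a.
    apply/eqP; rewrite -subr_eq0 -dot_eq0 dotBr dotZr wa mulr0 subr0.
    have := tH _ wa; have := tH 0 (dot0l _); rewrite add0r dotDl => -> /eqP.
    by rewrite -subr_eq0 addrK.
  have [e|e] := root_prop hPhi aP bP eb; first by rewrite -e hv intr_int.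
  by rewrite -[a]opprK -e dotNr rpredN hv intr_int.
split.
  apply/seteqP; split=> [q vq|q ->]; last exact: cf_refl.
  apply: root_dot_inj hPhi _ _ _ => a aP; have e := floorK (h a aP).
  by rewrite (cf_int hPhi aP vq (esym e)) e.
move=> _ [a [k [aP ->]]].
have aa : dot a a != 0 by rewrite dot_eq0 (root_ne0 hPhi).
have e := floorK (h a aP).
exists (hyperplane a (Num.floor (dot v a))); split; [by exists a, (Num.floor (dot v a))| |by rewrite /hyperplane /= e].
exists (((Num.floor (dot v a))%:~R - k%:~R) / dot a a *: a); apply/seteqP; split=> w.
  rewrite /hyperplane /= e => wa.
  exists (w - (dot v a - k%:~R) / dot a a *: a); last by rewrite subrK.
  by rewrite dotBl dotZl divfK // wa opprB addrC subrK.
by rewrite /hyperplane /= e => -[u ua <-]; rewrite dotDl dotZl divfK // ua addrC subrK.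
Qed.

Lemma symmetry_special F v : symmetry F -> coxeter_special Phi v -> coxeter_special Phi (F v).
Proof.
move=> sF /specialP h; apply/specialP => a aP.
have [b [m [bP e _]]] := symmetry_wall sF aP.
by rewrite e rpredD ?intr_int // h.
Qed.

Definition wref (h : V * int) : V -> V := aref h.1 h.2%:~R.

Lemma eq_mx_vec (M N : 'M[R]_n) : (forall v, v *m M = v *m N) -> M = N.
Proof. by move=> h; apply/row_matrixP => i; rewrite !rowE. Qed.

Lemma reflection_mx a : a \in Phi -> exists2 M, symm_data M 0 & forall v, v *m M = reflection a v.
Proof.
move=> aP; have aa : dot a a != 0 by rewrite dot_eq0 (root_ne0 hPhi).
pose M : 'M[R]_n := 1%:M - (2 / dot a a) *: (a^T *m a).
have hM v : v *m M = reflection a v.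
  rewrite /M /reflection mulmxBr mulmx1 -scalemxAr mulmxA [v *m a^T]mx11_scalar.
  by rewrite mul_scalar_mx scalerA mulrAC.
exists M => //; split.
- have -> : M^T = M by rewrite /M linearB linearZ /= trmx1 trmx_mul trmxK.
  apply: eq_mx_vec => v; rewrite mulmxA !hM mulmx1.
  have e u : reflection a u = aref a 0 u by rewrite /aref subr0.
  by rewrite !e arefK // (root_ne0 hPhi).
- by move=> b bP; rewrite hM; exact: (root_refl hPhi).
by move=> b bP; rewrite dot0l rpred0.
Qed.

Lemma wrefE h v : wref h v = reflection h.1 v + (2 * h.2%:~R / dot h.1 h.1) *: h.1.
Proof.
rewrite /wref /aref /reflection -addrA -scaleNr -scaleNr -scalerDl; congr (_ + _ *: _).
lra.
Qed.

(** The vector is [k] times the coroot of [a]. It is the translation part of the reflection in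
    [(a, k)], which therefore lies in the extended affine Weyl group. *)
Lemma coroot_coweight a k b : a \in Phi -> b \in Phi ->
  dot ((2 * k%:~R / dot a a) *: a) b \is a Num.int.
Proof.
move=> aP bP; rewrite dotZl dotC.
have -> : 2 * k%:~R / dot a a * dot b a = k%:~R * (2 * dot b a / dot a a) by lra.
by rewrite rpredM ?intr_int // (root_crystallographic hPhi).
Qed.

Lemma symmetry_wref h : h.1 \in Phi -> symmetry (wref h).
Proof.
move=> hP; have [M [MM Mr Mt] hM] := reflection_mx hP.
exists M, ((2 * h.2%:~R / dot h.1 h.1) *: h.1); split=> [|v]; last by rewrite wrefE hM.
by split=> // b bP; exact: coroot_coweight.
Qed.

Lemma wrefK h : h.1 \in Phi -> involutive (wref h).
Proof. by move=> hP; apply: arefK; exact: (root_ne0 hPhi). Qed.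

Lemma weyl_mx (w : V -> V) : weyl Phi w -> exists2 M, symm_data M 0 & forall v, w v = v *m M.
Proof.
elim=> [|a {}w aP _ [M hM wM]].
  exists 1%:M => [|v]; last by rewrite mulmx1.
  by split=> [|a aP|a aP]; rewrite ?trmx1 ?mulmx1 ?dot0l ?rpred0.
have [N hN rN] := reflection_mx aP; exists (M *m N) => [|v]; last by rewrite /= wM -rN mulmxA.
case: hM hN => MM Mr Mt [NN Nr Nt]; split=> //.
  by rewrite trmx_mul mulmxA -(mulmxA M) NN mulmx1.
by move=> b bP; rewrite mulmxA; apply/Nr/Mr.
Qed.

Lemma weyl_comp (w w' : V -> V) : weyl Phi w -> weyl Phi w' -> weyl Phi (w \o w').
Proof. by move=> hw hw'; elim: hw => [|a {}w aP _ IH] //; exact: weyl_refl aP IH. Qed.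

Local Notation eaw := (extended_affine_weyl Phi).

Lemma eaw_symmetry g : eaw g -> symmetry g.
Proof.
move=> [w [t [hw ht ->]]]; have [M [MM Mr _] wM] := weyl_mx hw.
by exists M, t; split=> [|v]; [split|rewrite wM].
Qed.

Lemma eaw_comp g g' : eaw g -> eaw g' -> eaw (g \o g').
Proof.
move=> [w [t [hw ht ->]]] [w' [t' [hw' ht' ->]]]; have [M hM wM] := weyl_mx hw.
exists (w \o w'), (w t' + t); split; first exact: weyl_comp.
  move=> a aP; rewrite dotDl rpredD ?ht // wM dot_mulmx; apply: ht'.
  exact: (sd_root (symm_data_inv hM)).
by apply: funext => v; rewrite /= !wM mulmxDl addrA.
Qed.

Lemma eaw_id : eaw id.
Proof.
exists id, 0; split; [exact: weyl_id|by move=> a _; rewrite dot0l rpred0|].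
by apply: funext => v; rewrite addr0.
Qed.

Lemma eaw_wref h : h.1 \in Phi -> eaw (wref h).
Proof.
move=> hP; exists (reflection h.1 \o id), ((2 * h.2%:~R / dot h.1 h.1) *: h.1); split.
- by apply: weyl_refl => //; exact: weyl_id.
- by move=> b bP; exact: coroot_coweight.
by apply: funext => v; rewrite wrefE.
Qed.

Lemma eaw_transl t : coweight_lattice Phi t -> eaw (fun v => v + t).
Proof. by move=> ht; exists id, t; split=> //; exact: weyl_id. Qed.

(** [h] encodes a root and a level, the wall of the panel opposite [x], oriented so that [C] is on
    its positive side. *)
Definition panel C (h : V * int) x := [/\ h.1 \in Phi, x \in C,
  forall y, y \in C -> y != x -> dot y h.1 = h.2%:~R & h.2%:~R < dot x h.1].

(** All letters refer to the same alcove [C], like Coxeter generators. Appending a letter on the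
    right replaces the image of [C] by its neighbour across a panel, so a word is also a gallery
    starting at [C]. *)
Definition word C (l : seq (V * int)) := forall h, h \in l -> exists x, panel C h x.

Definition ev (l : seq (V * int)) v : V := foldr wref v l.

Lemma ev_cat l l' v : ev (l ++ l') v = ev l (ev l' v).
Proof. by rewrite /ev foldr_cat. Qed.

Lemma ev_rcons l h v : ev (rcons l h) v = ev l (wref h v).
Proof. by rewrite -cats1 ev_cat. Qed.

Lemma word_cons C h l : word C (h :: l) <-> (exists x, panel C h x) /\ word C l.
Proof.
split=> [hw|[hh hl] g]; last by rewrite inE => /orP[/eqP->//|/hl].
split; first by apply: hw; exact: mem_head.
by move=> g gl; apply: hw; rewrite inE gl orbT.
Qed.

Lemma word_cat C l l' : word C l -> word C l' -> word C (l ++ l').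
Proof. by move=> hl hl' h; rewrite mem_cat => /orP[/hl|/hl']. Qed.

Lemma word_rcons C h l : word C (rcons l h) <-> word C l /\ (exists x, panel C h x).
Proof.
split=> [hw|[hl hh] g]; last by rewrite mem_rcons inE => /orP[/eqP->//|/hl].
split; last by apply: hw; rewrite mem_rcons mem_head.
by move=> g gl; apply: hw; rewrite mem_rcons inE gl orbT.
Qed.

Lemma word_rev C l : word C l -> word C (rev l).
Proof. by move=> hl h; rewrite mem_rev => /hl. Qed.

Lemma ev_eaw C l : word C l -> eaw (ev l).
Proof.
elim: l => [|h l IH]; first by move=> _; exact: eaw_id.
case/word_cons => -[x [hP _ _ _]] /IH; exact: (eaw_comp (eaw_wref hP)).
Qed.

Lemma ev_symmetry C l : word C l -> symmetry (ev l).
Proof. by move/ev_eaw/eaw_symmetry. Qed.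

Lemma ev_revK C l v : word C l -> ev (rev l) (ev l v) = v.
Proof.
elim: l v => // h l IH v /word_cons[[x [hP _ _ _]] hl].
by rewrite rev_cons ev_rcons /= wrefK // IH.
Qed.

Lemma ev_Krev C l v : word C l -> ev l (ev (rev l) v) = v.
Proof. by move=> hl; rewrite -{1}[l]revK (ev_revK _ (word_rev hl)). Qed.

Lemma avg_dot s a (k : R) : s != fset0 -> (forall y, y \in s -> dot y a = k) -> dot (avg s) a = k.
Proof.
move=> s0 h; have [_ _ e] := avg_in_simplex s0; rewrite /avg dot_suml.
transitivity (\sum_(y <- s) (if y \in s then (#|` s|%:R)^-1 else 0) * k); last first.
  by rewrite -mulr_suml e mul1r.
by apply: eq_big_seq => y ys; rewrite dotZl h.
Qed.

Hypothesis ai : forall s, simplex Sigma s -> affinely_independent s id.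

Section At_generic.
Variable q : V.
Hypothesis gq : generic Phi q.
Local Notation C := (vset q).

Let aC : alcove Phi C := alcove_vset hPhi ai gq.

Lemma generic_neq p a k : generic Phi p -> a \in Phi -> dot p a != k%:~R.
Proof. by move=> gp aP; apply: contraNneq (gp a aP) => ->; exact: intr_int. Qed.

Lemma panel_generic h x : panel C h x -> h.2%:~R < dot q h.1.
Proof.
move=> [hP xC _ xh]; rewrite ltNge; apply/negP => qh.
have [_ qx] := (in_vset hPhi q x).1 xC.
by have := cf_le hPhi hP qx qh; rewrite leNgt xh.
Qed.

Lemma panel_ge h x y : panel C h x -> y \in C -> h.2%:~R <= dot y h.1.
Proof.
move=> [hP xC hy xh] yC; have [->|yx] := eqVneq y x; first exact: ltW.
by rewrite hy.
Qed.

(** For the panel opposite [x], the excess of [p] over the wall is the barycentric coordinate of [p]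
    at [x] times a positive factor. The panel inequalities thus make all the coordinates
    nonnegative. *)
Lemma cf_panels p : (forall h x, panel C h x -> h.2%:~R <= dot p h.1) -> cf q p.
Proof.
move=> hp; have [c c1 cp] := frame_coord p (alcove_ai ai aC) aC.2.
have c0 x : x \in C -> 0 <= c x.
  move=> xC; have [a [k [aP hy xa]]] := panel_wall hPhi ai aC xC.
  have := hp (a, k) x (And4 aP xC hy xa) => /=.
  have -> : dot p a = k%:~R + c x * (dot x a - k%:~R).
    rewrite -cp dot_suml.
    have -> : k%:~R = \sum_(y <- C) c y * k%:~R by rewrite -mulr_suml c1 mul1r.
    rewrite -[LHS](subrK (\sum_(y <- C) c y * k%:~R)) addrC -sumrB; congr (_ + _).
    rewrite (big_fsetD1 x) //= big1_fset ?addr0; first by rewrite dotZl -mulrBr -mulr_suml c1 mul1r.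
    by move=> y; rewrite in_fsetD1 => /andP[yx yC] _; rewrite dotZl hy // subrr.
  by rewrite lerDl pmulr_lge0 // subr_gt0.
pose c' x := if x \in C then c x else 0.
have -> : p = \sum_(x <- C) c' x *: x.
  by rewrite -cp; apply: eq_big_seq => x xC; rewrite /c' xC.
apply: cf_comb => [|x /in_vset[]//].
split=> [x|x /negbTE xC|]; first by rewrite /c'; case: ifP => // /c0.
  by rewrite /c' xC.
by rewrite -[RHS]c1; apply: eq_big_seq => x xC; rewrite /c' xC.
Qed.

Lemma cf_panel_avg h x : panel C h x ->
  [/\ cf q (avg (C `\ x)), wref h (avg (C `\ x)) = avg (C `\ x) &
      cf (wref h q) (avg (C `\ x))].
Proof.
move=> [hP xC hy xh]; set m := avg _.
have qm : cf q m.
  suff H y : y \in vset m -> cf q y by exact: cf_vset H.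
  by rewrite (vset_avg_panel hPhi ai aC xC) in_fsetD1 => /andP[_] /in_vset[].
have hm : wref h m = m.
  apply: aref_id; apply: avg_dot; first exact: panel_neq0 aC xC.
  by move=> y; rewrite in_fsetD1 => /andP[yx yC]; exact: hy.
by split=> //; rewrite -hm; apply: symmetry_cf => //; exact: symmetry_wref.
Qed.

Lemma panel_hyper h x b k : panel C h x -> b \in Phi -> dot (avg (C `\ x)) b = k%:~R ->
  exists r : R, [/\ r != 0, b = r *: h.1 & k%:~R = r * h.2%:~R].
Proof.
move=> [hP xC hy xh] bP mb.
have [||r eb ek] := hyper_prop (b := b) (l := k%:~R) (alcove_ai ai aC) aC.2 xC hy.
- by rewrite gt_eqF.
- move=> y yC yx; have : y \in vset (avg (C `\ x)).
    by rewrite (vset_avg_panel hPhi ai aC xC) in_fsetD1 yx.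
  by case/in_vset => _ my; exact: (cf_int hPhi bP my mb).
exists r; split=> //; apply: contraTneq (root_ne0 hPhi bP) => r0.
by rewrite eb r0 scale0r eqxx.
Qed.

(* If the wall (a, k) separates the images under F of C and of its neighbour
   across the panel, it contains the image of that panel, hence is its wall. *)
Lemma cross_step F h x a k : panel C h x -> symmetry F -> a \in Phi ->
  (dot (F q) a - k%:~R) * (dot (F (wref h q)) a - k%:~R) < 0 ->
  forall v, aref a k%:~R (F v) = F (wref h v).
Proof.
move=> ph sF aP; have [b [m [bP e er]]] := symmetry_wall sF aP.
have e' v : dot (F v) a - k%:~R = dot v b - (k - m)%:~R.
  by rewrite e intrB opprB addrA addrAC.
rewrite !e' => cross v; rewrite er -intrB.
have [qm _ qm'] := cf_panel_avg ph.
have mb : dot (avg (C `\ x)) b = (k - m)%:~R.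
  apply/eqP; rewrite eq_le; move: cross;
  have [qb|qb|qb] := ltrgtP (dot q b) (k - m)%:~R; last first.
  - by rewrite qb subrr mul0r ltxx.
  - rewrite pmulr_rlt0 ?subr_gt0 // subr_lt0 => qb'.
    by rewrite (cf_le hPhi bP qm' (ltW qb')) (qm _ _ bP (ltW qb)).
  - rewrite nmulr_rlt0 ?subr_lt0 // subr_gt0 => qb'.
    by rewrite (cf_le hPhi bP qm (ltW qb)) (qm' _ _ bP (ltW qb')).
have [r [r0 eb ek]] := panel_hyper ph bP mb.
by rewrite eb ek aref_scale.
Qed.

End At_generic.
End Symmetries.

(** * Galleries, the exchange condition and the fundamental domain *)

Section Galleries.
Variables (R : realType) (n : nat) (Phi : {fset 'rV[R]_n}).
Hypothesis hPhi : root_system Phi.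
Local Notation V := 'rV[R]_n.
Local Notation cf := (closed_facet Phi).
Local Notation Sigma := (coxeter_complex Phi).
Local Notation vset := (vset hPhi).
Local Notation eaw := (extended_affine_weyl Phi).
Implicit Types (u v w x y z p q d a b t : V) (C s : {fset V}) (k m : int).
Hypothesis ai : forall s, simplex Sigma s -> affinely_independent s id.

(** Conjugation by [F] turns the reflection in a panel of the current alcove into a letter for [C]:
    this is how a gallery is prolonged by a word. *)
Lemma panel_preimage F C h x : symmetry Phi F -> x \in C ->
  panel Phi [fset F y | y in C] h (F x) ->
  exists h0, panel Phi C h0 x /\ forall v, wref h (F v) = F (wref h0 v).
Proof.
move=> sF xC [hP _ hy xh]; have [b [m [bP e er]]] := symmetry_wall sF hP.
exists (b, h.2 - m); split; last by move=> v; rewrite /wref /= er intrB.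
split=> //= [y yC yx|]; last by rewrite intrB ltrBlDr -e.
rewrite intrB -(hy (F y)) ?e ?addrK //; first by apply/imfsetP; exists y.
by rewrite (inj_eq (symmetry_inj sF)).
Qed.

Lemma wref_dot h v : h.1 \in Phi -> dot (wref h v) h.1 - h.2%:~R = - (dot v h.1 - h.2%:~R).
Proof. by move=> hP; apply: aref_dot; exact: (root_ne0 hPhi hP). Qed.

Lemma floor_facet p q b : b \in Phi -> cf p q -> dot q b \isn't a Num.int ->
  Num.floor (dot p b) = Num.floor (dot q b).
Proof.
move=> bP pq ni; apply/esym/floor_def; rewrite (pq _ _ bP (floor_le _)) /=.
have := cf_le hPhi bP pq (ltW (floorD1_gt _)); rewrite le_eqVlt => /orP[/eqP e|//].
by move: ni; rewrite e intr_int.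
Qed.

(** For generic points this is twice the number of walls that separate them, each wall being counted
    for a root and for its opposite. *)
Definition floor_gap p q :=
  (\sum_(b <- Phi) `|Num.floor (dot p b) - Num.floor (dot q b)|)%N.

Lemma floor_lt_of (r : R) k : k%:~R < r -> r < (k + 1)%:~R -> Num.floor r = k.
Proof. by move=> h1 h2; apply: floor_def; rewrite ltW. Qed.

(** A root not proportional to [h.1] is not integral at the barycentre [m0] of the panel, so its
    floor is the same on both sides. For [h.1] and [- h.1] the floor moves by one towards [p]. *)
Lemma floor_gap_wref q p h x : generic Phi q -> generic Phi p -> panel Phi (vset q) h x ->
  dot p h.1 < h.2%:~R -> (floor_gap (wref h q) p < floor_gap q p)%N.
Proof.
move=> gq gp ph pa; have [hP xC hy xh] := ph.
have gq' := symmetry_generic (symmetry_wref hPhi hP) gq.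
have qa := panel_generic ph.
have [qm _ qm'] := cf_panel_avg ai gq ph; set m0 := avg _ in qm qm'.
have m0h : dot m0 h.1 = h.2%:~R.
  apply: avg_dot; first exact: (panel_neq0 hPhi (alcove_vset hPhi ai gq) xC).
  by move=> y; rewrite in_fsetD1 => /andP[yx yC]; exact: hy.
have q'a : dot (wref h q) h.1 < h.2%:~R.
  by rewrite -subr_lt0 wref_dot // oppr_lt0 subr_gt0.
have upper r : cf r m0 -> generic Phi r -> h.2%:~R < dot r h.1 -> Num.floor (dot r h.1) = h.2.
  move=> rm gr rh; apply: floor_lt_of => //; rewrite ltNge; apply/negP => hr.
  by have := rm _ _ hP hr; rewrite m0h ler_int; lia.
have lower r : cf r m0 -> generic Phi r -> dot r h.1 < h.2%:~R -> Num.floor (dot r h.1) = h.2 - 1.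
  move=> rm gr rh; apply: floor_lt_of; rewrite ?subrK // ltNge; apply/negP => hr.
  by have := cf_le hPhi hP rm hr; rewrite m0h ler_int; lia.
have floorN (r : R) : r \isn't a Num.int -> Num.floor (- r) = - Num.floor r - 1.
  move=> ni; apply: floor_lt_of.
    by have := floorD1_gt r; rewrite intrB intrN intrD; lra.
  by rewrite subrK intrN ltrN2 lt_neqAle floor_le -intrEfloor ni.
have pf : Num.floor (dot p h.1) <= h.2 - 1.
  by have := pa; rewrite -floor_lt_int -[X in _ < X](subrK 1) ltzD1.
have eq1 := upper _ qm gq qa; have eq2 := lower _ qm' gq' q'a.
have step b : b \in Phi -> (`|(Num.floor (dot (wref h q) b) - Num.floor (dot p b))%R| <=
    `|(Num.floor (dot q b) - Num.floor (dot p b))%R|)%N.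
  move=> bP; have [/floorK i|ni] := boolP (dot m0 b \is a Num.int); last first.
    by rewrite (floor_facet bP qm ni) (floor_facet bP qm' ni).
  have [r [_ eb _]] := panel_hyper ai gq ph bP (esym i).
  have [->|->] := root_prop hPhi hP bP eb; first by rewrite eq1 eq2; lia.
  by rewrite !dotNr !floorN ?(gq, gq', gp) // eq1 eq2; lia.
rewrite /floor_gap (big_fsetD1 _ hP) /= [X in (_ < X)%N](big_fsetD1 _ hP) /=.
rewrite -addSn leq_add //; first by rewrite eq1 eq2; lia.
rewrite big_seq [X in (_ <= X)%N]big_seq; apply: leq_sum => b.
by rewrite in_fsetD1 => /andP[_]; exact: step.
Qed.

Section From_generic.
Variable q : V.
Hypothesis gq : generic Phi q.
Local Notation C := (vset q).

(** As long as [p] is outside the current alcove, some panel separates it from that alcove, and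
    crossing this panel lowers [floor_gap]. *)
Lemma gallery p : generic Phi p -> exists2 l, word Phi C l & cf (ev l q) p.
Proof.
move=> gp; suff H (m : nat) (l : seq (V * int)) : word Phi C l -> (floor_gap (ev l q) p < m)%N ->
    exists2 l, word Phi C l & cf (ev l q) p.
  by apply: (H (floor_gap q p).+1 [::]) => //= h.
elim: m l => // m IH l hl; rewrite ltnS => gap.
have sF := ev_symmetry hPhi hl; have gq' := symmetry_generic sF gq.
have [done|nd] := pselect (cf (ev l q) p); first by exists l.
have [h [x [ph pa]]] : exists h x, panel Phi (vset (ev l q)) h x /\ dot p h.1 < h.2%:~R.
  apply: contrapT => H; apply: nd; apply: (cf_panels ai gq') => h x ph.
  by rewrite leNgt; apply/negP => pa; apply: H; exists h, x.
have := ph; rewrite (symmetry_vset _ _ sF) => ph'.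
have [_ /imfsetP[x0 /= x0C ex] _ _] := ph'; rewrite ex in ph'.
have [h0 [ph0 eh0]] := panel_preimage sF x0C ph'.
apply: (IH (rcons l h0)); first by apply/word_rcons; split=> //; exists x0.
rewrite ev_rcons -eh0; apply: leq_trans gap.
exact: floor_gap_wref ph pa.
Qed.

(** The wall is crossed at some step of the gallery and, by [cross_step], it is the wall of the
    panel crossed there; [l'] is the prefix before that step. *)
Lemma crossing l a k : word Phi C l -> a \in Phi ->
  (dot q a - k%:~R) * (dot (ev l q) a - k%:~R) < 0 ->
  exists l' h x, [/\ word Phi C l', panel Phi C h x &
    forall v, aref a k%:~R (ev l' v) = ev l' (wref h v)].
Proof.
move=> + aP; elim/last_ind: l => [_|l h IH].
  by rewrite -expr2 ltNge sqr_ge0.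
case/word_rcons => hl [x ph]; rewrite ev_rcons => cross.
have sF := ev_symmetry hPhi hl; have gq' := symmetry_generic sF gq.
have [/(IH hl)//|] := boolP ((dot q a - k%:~R) * (dot (ev l q) a - k%:~R) < 0).
rewrite -leNgt => same; exists l, h, x; split=> //.
apply: (cross_step ai gq ph sF aP).
have q0 : dot q a - k%:~R != 0 by rewrite subr_eq0; exact: generic_neq aP.
have q1 : dot (ev l q) a - k%:~R != 0 by rewrite subr_eq0; exact: generic_neq aP.
move: q0; rewrite neq_lt => /orP[q0|q0].
  move: same cross; rewrite nmulr_rge0 // nmulr_rlt0 // le_eqVlt (negbTE q1) /=.
  by move=> h1 h2; rewrite nmulr_rlt0.
move: same cross; rewrite pmulr_rge0 // pmulr_rlt0 // le_eqVlt eq_sym (negbTE q1) /=.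
by move=> h1 h2; rewrite pmulr_rlt0.
Qed.

Lemma wall_is_panel a k : a \in Phi -> exists l h x, [/\ word Phi C l, panel Phi C h x &
    forall v, aref a k%:~R (ev l v) = ev l (wref h v)].
Proof.
move=> aP; have aa : dot a a != 0 by rewrite dot_eq0 (root_ne0 hPhi).
(* Weak inequalities pass to closed facets, so an alcove touching level [k + 1] or [k - 1] is
   strictly beyond the wall of level [k]. *)
have pt (j : int) : exists2 p, generic Phi p & cf p ((j%:~R / dot a a) *: a).
  exact: generic_near.
have := generic_neq k gq aP; rewrite neq_lt => /orP[qk|qk].
- have [p gp pj] := pt (k + 1); have [l hl lp] := gallery gp.
  apply: (crossing hl aP); rewrite nmulr_rlt0 ?subr_lt0 // subr_gt0 ltNge.
  apply/negP => h; have := cf_le hPhi aP pj (cf_le hPhi aP lp h).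
  by rewrite dotZl divfK // ler_int; lia.
have [p gp pj] := pt (k - 1); have [l hl lp] := gallery gp.
apply: (crossing hl aP); rewrite pmulr_rlt0 ?subr_gt0 // subr_lt0 ltNge.
apply/negP => h; have := pj _ _ aP (lp _ _ aP h).
by rewrite dotZl divfK // ler_int; lia.
Qed.

Lemma wall_word a k : a \in Phi -> exists2 l, word Phi C l & forall v, aref a k%:~R v = ev l v.
Proof.
move=> aP; have [l [h [x [hl ph e]]]] := wall_is_panel k aP.
exists (l ++ h :: rev l).
  by apply: word_cat => //; apply/word_cons; split; [exists x|exact: word_rev].
by move=> v; rewrite ev_cat /= -e (ev_Krev hPhi _ hl).
Qed.

(** The gallery of [l] crosses the wall of [h] at some step. There [cross_step] identifies
    multiplication by [wref h] on the left with deletion of the letter of that step. *)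
Lemma exchange l h x : word Phi C l -> panel Phi C h x -> dot (ev l q) h.1 < h.2%:~R ->
  exists l', [/\ word Phi C l', (size l' < size l)%N & forall v, wref h (ev l v) = ev l' v].
Proof.
move=> + ph; have [hP _ _ _] := ph; have qh := panel_generic ph.
elim/last_ind: l => [_|l h0 IH]; first by rewrite ltNge (ltW qh).
case/word_rcons => hl [x0 ph0]; rewrite ev_rcons => lt.
have [/(IH hl)[l' [hl' sl' e]]|] := boolP (dot (ev l q) h.1 < h.2%:~R).
  exists (rcons l' h0); split; first by apply/word_rcons; split=> //; exists x0.
    by rewrite !size_rcons ltnS.
  by move=> v; rewrite !ev_rcons e.
rewrite -leNgt le_eqVlt eq_sym (negbTE (generic_neq _ (symmetry_generic (ev_symmetry hPhi hl) gq) hP)) /=.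
move=> gt; exists l; split=> //; first by rewrite size_rcons.
have [h0P _ _ _] := ph0 => v.
rewrite ev_rcons [wref h _](cross_step ai gq ph0 (ev_symmetry hPhi hl) hP) ?(wrefK hPhi h0P) //.
by rewrite pmulr_rlt0 ?subr_gt0 // subr_lt0.
Qed.

(* The orbit of a point of the alcove meets the alcove only once: a word that
   brings the point back is shortened by the exchange condition, or its first
   letter fixes the image. *)
Lemma alcove_fundamental l y : word Phi C l -> y \in C -> ev l y \in C -> ev l y = y.
Proof.
have [m] := ubnP (size l); elim: m l => // m IH [//|h l]; rewrite ltnS => sl hw yC lyC.
have [[x ph] hl] := (word_cons _ _ _ _).1 hw; have [hP _ _ _] := ph.
have gq' := symmetry_generic (ev_symmetry hPhi hw) gq.
have := generic_neq h.2 gq' hP; rewrite neq_lt => /orP[lt|gt].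
  have qy : cf q y by case/in_vset: yC.
  have fixed : dot (ev (h :: l) y) h.1 = h.2%:~R.
    apply/eqP; rewrite eq_le (panel_ge ph lyC) andbT.
    exact: (cf_le hPhi hP (symmetry_cf (ev_symmetry hPhi hw) qy) (ltW lt)).
  have e : ev l y = ev (h :: l) y.
    by rewrite -[RHS](aref_id fixed) -/(wref h _) /= (wrefK hPhi hP).
  by rewrite -e; apply: IH => //; rewrite e.
have [|l' [hl' sl' e]] := exchange hl ph.
  rewrite -subr_lt0 -oppr_gt0 -wref_dot // subr_gt0.
  exact: gt.
have e' : ev (h :: l) y = ev l' y by exact: e.
rewrite e' in lyC *; apply: IH => //; exact: ltn_trans sl' sl.
Qed.

End From_generic.

Lemma alcove_avg C : alcove Phi C -> exists2 q, generic Phi q & C = vset q.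
Proof.
move=> aC; exists (avg C); first exact: (alcove_generic hPhi ai aC).
by rewrite (vset_avg_alcove hPhi ai aC).
Qed.

Lemma alcove_gallery C C' : alcove Phi C -> alcove Phi C' ->
  exists2 l, word Phi C l & C' = [fset ev l x | x in C].
Proof.
move=> /alcove_avg[q gq ->] /alcove_avg[p gp ->].
have [l hl lp] := gallery gq gp; exists l => //.
have sl := ev_symmetry hPhi hl; rewrite -(symmetry_vset _ _ sl).
apply/eqP; rewrite eqEfcard; apply/andP; split; first exact/fsubsetP/vset_sub.
by rewrite !generic_card //; exact: symmetry_generic.
Qed.

(** The difference of two special vertices is a coweight, so [x'] can be translated to [x]. A word
    then joins the two alcoves; the vertex of [C] that it sends to [x] is [x] itself by
    [alcove_fundamental]. *)
Lemma eaw_transitive C C' x x' : alcove Phi C -> alcove Phi C' -> x \in C -> x' \in C' ->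
  coxeter_special Phi x -> coxeter_special Phi x' ->
  exists g, [/\ eaw g, g x = x' & C' = [fset g y | y in C]].
Proof.
move=> aC aC' xC xC' /(specialP hPhi) sx /(specialP hPhi) sx'.
have lat : coweight_lattice Phi (x' - x).
  by move=> a aP; rewrite dotBl rpredB ?sx ?sx'.
have lat' : coweight_lattice Phi (x - x').
  by move=> a aP; rewrite dotBl rpredB ?sx ?sx'.
have tr := eaw_transl lat; have tr' := eaw_transl lat'.
have aD := symmetry_alcove hPhi (eaw_symmetry hPhi tr') aC'.
have [l hl eD] := alcove_gallery aC aD.
have xD : x \in [fset y + (x - x') | y in C'].
  by apply/imfsetP; exists x' => //=; rewrite addrC subrK.
have lx : ev l x = x.
  move: (xD); rewrite eD => /imfsetP[y /= yC xy].
  have [q gq eC] := alcove_avg aC.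
  have e : ev l y = y by rewrite eC in hl yC xC; apply: (alcove_fundamental gq hl yC); rewrite -xy.
  by rewrite {1}xy -/(ev l _) e -xy.
exists ((fun v => v + (x' - x)) \o ev l); split.
- exact: eaw_comp tr (ev_eaw hPhi hl).
- by rewrite /= lx addrC subrK.
apply/fsetP => y; apply/idP/imfsetP => [yC'|[z /= zC ->]].
  have : y + (x - x') \in [fset y + (x - x') | y in C'] by apply/imfsetP; exists y.
  rewrite eD => /imfsetP[z /= zC ez]; exists z => //=.
  by rewrite -ez -(opprB x) addrK.
have : ev l z \in [fset y + (x - x') | y in C'] by rewrite eD; apply/imfsetP; exists z.
move=> /imfsetP[w /= wC' ->].
by rewrite -(opprB x) addrK.
Qed.

End Galleries.

(** * Isometries between alcoves and foldings *)

Section Folding.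
Variables (R : realType) (n : nat) (Phi : {fset 'rV[R]_n}).
Hypothesis hPhi : root_system Phi.
Local Notation V := 'rV[R]_n.
Local Notation cf := (closed_facet Phi).
Local Notation Sigma := (coxeter_complex Phi).
Local Notation vset := (vset hPhi).
Local Notation eaw := (extended_affine_weyl Phi).
Implicit Types (u v w x y z p q d a b t : V) (C s : {fset V}) (k m : int).

Lemma aref_orth (M : 'M[R]_n) t a (r : R) v : M *m M^T = 1%:M ->
  aref a r (v *m M + t) = aref (a *m M^T) (r - dot t a) v *m M + t.
Proof.
move=> MM; rewrite /aref dotDl dot_mulmx dot_orth ?trmxK ?orthC //.
rewrite mulmxBl -scalemxAl -mulmxA orthC // mulmx1 addrAC.
by rewrite opprB addrA.
Qed.

Section Wall_preserving_isometries.
Variables (M : 'M[R]_n) (t : V).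
Hypothesis MM : M *m M^T = 1%:M.
Hypothesis walls : forall a k, a \in Phi -> exists b m, b \in Phi /\
  forall v, aref a k%:~R v *m M + t = aref b m%:~R (v *m M + t).

Lemma wall_image_normal a k : a \in Phi -> exists b m (c : R),
  [/\ b \in Phi, c != 0, a *m M = c *: b & m%:~R = k%:~R / c + dot t b].
Proof.
move=> aP; have [b [m [bP e]]] := walls k aP.
have aa : dot a a != 0 by rewrite dot_eq0 (root_ne0 hPhi).
have bb : dot b b != 0 by rewrite dot_eq0 (root_ne0 hPhi).
have h v : (2 * (dot v a - k%:~R) / dot a a) *: (a *m M) =
    (2 * (dot (v *m M + t) b - m%:~R) / dot b b) *: b.
  have := e v; rewrite /aref mulmxBl addrAC -scalemxAl.
  by move/addrI/oppr_inj.
(* [v0] is one level off the wall and gives the normal of the image; [v1] is on the wall and gives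
   its level. *)
pose v0 := ((k%:~R + 1) / dot a a) *: a; pose v1 := (k%:~R / dot a a) *: a.
have e0 := h v0; have e1 := h v1.
have d0 : dot v0 a - k%:~R = 1 by rewrite dotZl divfK // addrC addKr.
have d1 : dot v1 a - k%:~R = 0 by rewrite dotZl divfK // subrr.
move: e0 e1; rewrite d0 d1 mulr1 !(mulr0, mul0r) scale0r => e0 /esym/eqP.
rewrite scaler_eq0 -dot_eq0 (negbTE bb) orbF mulf_eq0 invr_eq0 (negbTE bb) orbF.
rewrite mulf_eq0 pnatr_eq0 /= subr_eq0 => /eqP e1.
pose c := dot a a / 2 * (2 * (dot (v0 *m M + t) b - m%:~R) / dot b b).
have ec : a *m M = c *: b.
  rewrite /c -scalerA -e0 scalerA.
  have -> : dot a a / 2 * (2 / dot a a) = 1.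
    have -> : dot a a / 2 * (2 / dot a a) = (dot a a / dot a a) * (2 / 2) by lra.
    by rewrite !divff ?mulr1 // pnatr_eq0.
  by rewrite scale1r.
have aM : dot (a *m M) (a *m M) = dot a a by exact: dot_orth.
have c0 : c != 0.
  by apply: contraNneq aa => c0; rewrite -aM ec c0 scale0r dot0l.
exists b, m, c; split=> //; rewrite -e1 dotDl -scalemxAl dotZl; congr (_ + _).
have <- : c * (c * dot b b) = dot a a by rewrite -aM ec !dotl.
by rewrite ec dotZl invfM [k%:~R * _]mulrA divfK // mulf_neq0.
Qed.

(** The walls [(a, 0)] and [(a, 1)] go to parallel walls of integral levels whose difference is
    [c^-1] up to sign, and the first of these levels is [dot t b]. *)
Lemma wall_image_root a : a \in Phi -> exists b (c : R),
  [/\ b \in Phi, a *m M = c *: b, c != 0, c^-1 \is a Num.int & dot t b \is a Num.int].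
Proof.
move=> aP; have [b [m [c [bP c0 eb em]]]] := wall_image_normal 0 aP.
have [b1 [m1 [c1 [b1P c10 eb1 em1]]]] := wall_image_normal 1 aP.
rewrite mul0r add0r in em.
exists b, c; split=> //; last by rewrite -em intr_int.
have eb' : b1 = (c1^-1 * c) *: b by rewrite -scalerA -eb eb1 scalerA mulVf // scale1r.
have b_inj (r r' : R) : r *: b = r' *: b -> r = r'.
  move/eqP; rewrite -subr_eq0 -scalerBl scaler_eq0 (negbTE (root_ne0 hPhi bP)) orbF.
  by rewrite subr_eq0 => /eqP.
have : c1 *: b1 = c *: b by rewrite -eb -eb1.
have [e|e] := root_prop hPhi bP b1P eb'; rewrite e => /esym.
  move/b_inj => ec; move: em1; rewrite e -em -ec mul1r => em1.
  by have -> : c^-1 = (m1 - m)%:~R; [rewrite intrB; lra | exact: intr_int].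
rewrite scalerN -scaleNr => /b_inj ec; move: em1; rewrite e dotNr -em mul1r => em1.
have ic : c1^-1 = - c^-1 by rewrite ec invrN opprK.
by have -> : c^-1 = - (m1 + m)%:~R; [rewrite intrD; lra | rewrite rpredN intr_int].
Qed.

End Wall_preserving_isometries.

(** The inverse isometry supplies a second factor [c'] with integral inverse, and reducedness gives
    [c * c' = 1] or [c * c' = -1]. So [c] and [c^-1] are both integers. *)
Lemma wall_image_in_roots (M : 'M[R]_n) t t' : M *m M^T = 1%:M ->
  (forall a k, a \in Phi -> exists b m, b \in Phi /\
    forall v, aref a k%:~R v *m M + t = aref b m%:~R (v *m M + t)) ->
  (forall a k, a \in Phi -> exists b m, b \in Phi /\
    forall v, aref a k%:~R v *m M^T + t' = aref b m%:~R (v *m M^T + t')) ->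
  forall a, a \in Phi -> a *m M \in Phi.
Proof.
move=> MM h h' a aP.
have [b [c [bP eb c0 ci _]]] := wall_image_root MM h aP.
have MM' : M^T *m M^T^T = 1%:M by rewrite trmxK orthC.
have [a' [c' [a'P ea' c'0 ci' _]]] := wall_image_root MM' h' bP.
have ea : a = (c * c') *: a'.
  by rewrite -scalerA -ea' scalemxAl -eb -mulmxA MM mulmx1.
have cc : c * c' = 1 \/ c * c' = -1.
  by apply: (root_reduced hPhi a'P); rewrite -ea.
have cint : c \is a Num.int.
  have -> : c = (c * c') * c'^-1 by rewrite mulfK.
  by case: cc => ->; rewrite ?mul1r ?mulN1r ?rpredN.
have : c = 1 \/ c = -1.
  move: ci c0 cint => /intrP[i ei] c0 /intrP[j ej].
  have : (i * j)%:~R = 1%:~R :> R by rewrite intrM -ei -ej mulVf.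
  move/eqP; rewrite eqr_int ej => /eqP ij.
  have : (`|i| * `|j|)%N == 1%N by rewrite -abszM ij.
  rewrite muln_eq1 => /andP[_ /eqP j1].
  have [->|->] : j = 1 \/ j = -1 by lia.
    by left.
  by right; rewrite intrN.
by case=> ec; rewrite eb ec ?scale1r ?scaleN1r //; exact: root_opp.
Qed.

Lemma wall_preserving_symm_data (M : 'M[R]_n) t t' : M *m M^T = 1%:M ->
  (forall a k, a \in Phi -> exists b m, b \in Phi /\
    forall v, aref a k%:~R v *m M + t = aref b m%:~R (v *m M + t)) ->
  (forall a k, a \in Phi -> exists b m, b \in Phi /\
    forall v, aref a k%:~R v *m M^T + t' = aref b m%:~R (v *m M^T + t')) ->
  symm_data Phi M t.
Proof.
move=> MM h h'; split=> //; first exact: wall_image_in_roots h h'.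
move=> b bP; have MM' : M^T *m M^T^T = 1%:M by rewrite trmxK orthC.
have bM : b *m M^T \in Phi.
  by apply: (wall_image_in_roots MM' h' (t' := t)) => //; rewrite trmxK.
have [b' [c [b'P eb' _ _ ti]]] := wall_image_root MM h bM.
rewrite -mulmxA orthC // mulmx1 in eb'.
by have [->|->] := root_prop hPhi b'P bP eb'; rewrite ?dotNr ?rpredN.
Qed.

Hypothesis ai : forall s, simplex Sigma s -> affinely_independent s id.

Lemma symmetry_wall_image F a k : symmetry Phi F -> a \in Phi -> exists b m, b \in Phi /\
  forall v, F (aref a k%:~R v) = aref b m%:~R (F v).
Proof.
move=> /symmetry_inv[G [sG FK GK]] aP.
have [b [m [bP _ e]]] := symmetry_wall sG aP.
exists b, (k - m); split=> // v; rewrite intrB.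
by rewrite -{1}[v]FK e GK.
Qed.

Section Alcove_isometry.
Variables (M : 'M[R]_n) (t : V) (C : {fset V}).
Let F v := v *m M + t.
Hypothesis MM : M *m M^T = 1%:M.
Hypothesis aC : alcove Phi C.
Hypothesis aC' : alcove Phi [fset F x | x in C].

Let F_inj : injective F.
Proof.
move=> u v /addIr/(congr1 (fun w => w *m M^T)).
by rewrite -!mulmxA MM !mulmx1.
Qed.

Lemma isometry_panel h x : panel Phi C h x -> exists2 h', panel Phi [fset F y | y in C] h' (F x) &
  forall v, F (wref h v) = wref h' (F v).
Proof.
move=> [hP xC hy xh]; have FxC : F x \in [fset F y | y in C] by apply/imfsetP; exists x.
have [a [k [aP ha xa]]] := panel_wall hPhi ai aC' FxC.
exists (a, k) => //= v; rewrite /wref /= /F aref_orth //.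
have aM0 : a *m M^T != 0.
  rewrite -dot_eq0 dot_orth ?trmxK ?orthC // dot_eq0; exact: (root_ne0 hPhi).
have [||r er ek] := hyper_prop (b := a *m M^T) (l := k%:~R - dot t a) (alcove_ai ai aC) aC.2 xC hy.
- by rewrite gt_eqF.
- move=> y yC yx; rewrite -(ha (F y)) ?(inj_eq F_inj) //; last by apply/imfsetP; exists y.
  by rewrite dotDl addrK dot_mulmx.
rewrite er ek aref_scale //; apply: contraNneq aM0 => r0.
by rewrite er r0 scale0r.
Qed.

Lemma isometry_word l : word Phi C l -> exists2 l', word Phi [fset F y | y in C] l' &
  forall v, F (ev l v) = ev l' (F v).
Proof.
elim: l => [|h l IH]; first by move=> _; exists [::].
case/word_cons => -[x /isometry_panel[h' ph' e']] /IH[l' hl' e].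
exists (h' :: l'); first by apply/word_cons; split=> //; exists (F x).
by move=> v; rewrite /= e' -/(ev l v) e.
Qed.

(** Every wall is the image of a panel wall of [C] under a word. As [F] takes panels of [C] to
    panels of its image, it conjugates words to words, and so wall reflections to wall
    reflections. *)
Lemma isometry_wall a k : a \in Phi -> exists b m, b \in Phi /\
  forall v, F (aref a k%:~R v) = aref b m%:~R (F v).
Proof.
move=> aP; have [q gq eC] := alcove_avg hPhi ai aC.
have [l [h [x [hl ph e]]]] := wall_is_panel hPhi ai gq k aP; rewrite -eC in hl ph.
have [h' ph' eh] := isometry_panel ph; have [l' hl' el] := isometry_word hl.
have [h'P _ _ _] := ph'.
have [b [m [bP eb]]] := symmetry_wall_image h'.2 (ev_symmetry hPhi hl') h'P.
exists b, m; split=> // v; rewrite -{1}[v](ev_Krev hPhi _ hl) e el eh eb -el.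
by rewrite (ev_Krev hPhi _ hl).
Qed.

End Alcove_isometry.

(** The affine isometry given by [frame_isometry] and its inverse both map an alcove onto an alcove,
    so both preserve the walls. *)
Lemma alcove_isometry_extends C C' (h : V -> V) : alcove Phi C -> alcove Phi C' ->
  C' = [fset h x | x in C] ->
  (forall x y, x \in C -> y \in C -> edist (h x) (h y) = edist x y) ->
  exists2 F, symmetry Phi F & forall x, x \in C -> h x = F x.
Proof.
move=> aC aC' eC' hh; have [M [t [MM hM]]] := frame_isometry (alcove_ai ai aC) aC.2 hh.
exists (fun v => v *m M + t) => //; exists M, t; split=> //.
have eF : C' = [fset x *m M + t | x in C].
  rewrite eC'; apply/fsetP => z; apply/imfsetP/imfsetP => -[x /= xC ->]; exists x => //.
    exact: hM.
  by rewrite hM.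
have MM' : M^T *m M^T^T = 1%:M by rewrite trmxK orthC.
have eG : C = [fset y *m M^T + - t *m M^T | y in C'].
  have K x : (x *m M + t) *m M^T + - t *m M^T = x by rewrite -mulmxDl addrK -mulmxA MM mulmx1.
  rewrite eF; apply/fsetP => z; apply/idP/imfsetP => [zC|[_ /= /imfsetP[x /= xC ->] ->]].
    by exists (z *m M + t); rewrite /= ?K //; apply/imfsetP; exists z.
  by rewrite K.
apply: (wall_preserving_symm_data MM (t' := - t *m M^T)).
  have aF : alcove Phi [fset x *m M + t | x in C] by rewrite -eF.
  exact: isometry_wall MM aC aF.
have aG : alcove Phi [fset y *m M^T + - t *m M^T | y in C'] by rewrite -eG.
exact: isometry_wall MM' aC' aG.
Qed.

Definition folding (T : choiceType) (K : complex R T) (r : T -> V) :=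
  (forall s : {fset T}, simplex K s -> simplex Sigma [fset r x | x in s]) /\
  (forall (s : {fset T}) (x y : T), simplex K s -> x \in s -> y \in s -> edist (r x) (r y) = len K x y).

Section Foldings_of_the_Coxeter_complex.
Variable r : V -> V.
Hypothesis fr : folding Sigma r.

Lemma folding_inj_in s : simplex Sigma s -> {in s &, injective r}.
Proof.
move=> sS x y xs ys e; apply: edist_eq0.
by have := fr.2 s x y sS xs ys; rewrite /= e edistxx.
Qed.

Lemma folding_on_alcove C : alcove Phi C ->
  exists2 F, symmetry Phi F & forall x, x \in C -> r x = F x.
Proof.
move=> aC; have [sC cC] := aC; apply: (alcove_isometry_extends aC (C' := [fset r x | x in C])) => //.
  split; first exact: fr.1.
  by rewrite card_in_imfset //=; exact: folding_inj_in.
by move=> x y xC yC; exact: fr.2 sC xC yC.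
Qed.

Section From_alcove.
Variables (C : {fset V}) (F : V -> V).
Hypothesis aC : alcove Phi C.
Hypothesis sF : symmetry Phi F.
Hypothesis rF : forall x, x \in C -> r x = F x.

(** Pulled back by [F \o ev l'], the image of the vertex behind the panel has the same distances to
    the panel of [C] as [x], and [two_points] leaves two positions: folded back onto [x], or
    mirrored. *)
Lemma folding_step l l' h x : word Phi C l -> word Phi C l' -> panel Phi C h x ->
  (forall y, y \in C -> r (ev l y) = F (ev l' y)) ->
  (forall y, y \in C -> y != x -> r (ev l (wref h y)) = F (ev l' y)) /\
  (r (ev l (wref h x)) = F (ev l' x) \/ r (ev l (wref h x)) = F (ev l' (wref h x))).
Proof.
move=> hl hl' ph e; have [hP xC hy xh] := ph.
have hid y : y \in C -> y != x -> wref h y = y.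
  by move=> yC yx; apply: aref_id; exact: hy.
split=> [y yC yx|]; first by rewrite hid // e.
have sG := symmetry_comp sF (ev_symmetry hPhi hl').
have [G' [sG' GK G'K]] := symmetry_inv sG.
have sl := symmetry_comp (ev_symmetry hPhi hl) (symmetry_wref hPhi hP).
have := two_points (alcove_ai ai aC) aC.2 (dim_gt0 hPhi) xC hy (z := G' (r (ev l (wref h x)))).
case=> [|y yC yx|e1|e1]; first by rewrite gt_eqF.
- rewrite -(symmetry_edist _ _ sG) G'K /= -e //.
  transitivity (edist (r (ev l (wref h x))) (r (ev l (wref h y)))).
    by rewrite (hid y).
  have ss := symmetry_simplex hPhi sl aC.1.
  rewrite (fr.2 _ _ _ ss) ?(symmetry_edist _ _ sl) //.
  + exact: (symmetry_edist x y sl).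
  + by apply/imfsetP; exists x.
  by apply/imfsetP; exists y.
- by left; have := G'K (r (ev l (wref h x))); rewrite e1 /= => <-.
by right; have := G'K (r (ev l (wref h x))); rewrite e1 /= => <-.
Qed.

(** A fold leaves the image word unchanged; a genuine crossing appends the letter of the source word
    to it. *)
Lemma folding_word l : word Phi C l ->
  exists2 l', word Phi C l' & forall y, y \in C -> r (ev l y) = F (ev l' y).
Proof.
elim/last_ind: l => [_|l h IH]; first by exists [::].
case/word_rcons => hl [x ph]; have [l' hl' e] := IH hl.
have [e1 e2] := folding_step hl hl' ph e; have [hP _ hy _] := ph.
case: e2 => e2; [exists l'|exists (rcons l' h)] => //.
- by move=> y yC; rewrite ev_rcons; have [->|yx] := eqVneq y x; [exact: e2|exact: e1].
- by apply/word_rcons; split=> //; exists x.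
move=> y yC; rewrite !ev_rcons; have [->//|yx] := eqVneq y x.
by rewrite e1 // [wref h y]aref_id // hy.
Qed.

Lemma folding_simplex s : simplex Sigma s ->
  exists2 g, eaw g & forall x, x \in s -> r x = F (g x).
Proof.
case/(simplex_sub_alcove hPhi ai) => D aD sD.
have [l hl eD] := alcove_gallery hPhi ai aC aD; have [l' hl' e] := folding_word hl.
exists (ev l' \o ev (rev l)); first exact: eaw_comp (ev_eaw hPhi hl') (ev_eaw hPhi (word_rev hl)).
move=> x /sD; rewrite eD => /imfsetP[y /= yC ->].
by rewrite e // (ev_revK hPhi _ hl).
Qed.

(** Injectivity rules out the fold at every step, so the image word is the source word itself. *)
Lemma folding_bij : (forall x y, coxeter_vertex Phi x -> coxeter_vertex Phi y -> r x = r y -> x = y) ->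
  forall v, coxeter_vertex Phi v -> r v = F v.
Proof.
move=> rinj v vv; have [D aD sD] := simplex_sub_alcove hPhi ai (simplex_vertex hPhi vv).
have [l hl eD] := alcove_gallery hPhi ai aC aD.
have : v \in D by apply: sD; rewrite inE.
rewrite eD => /imfsetP[y /= yC ->] {eD}.
elim/last_ind: l hl y yC => [_ y /rF//|l h IH /word_rcons[hl [x ph]] y yC].
have [e1 e2] := folding_step hl hl ph (IH hl); have [hP xC hy xh] := ph.
rewrite ev_rcons; have [->|yx] := eqVneq y x; last by rewrite e1 // [wref h y]aref_id // hy.
case: e2 => // e2; exfalso.
have vC z : z \in C -> coxeter_vertex Phi z by exact: vertex_of_simplex aC.1.
have sl := ev_symmetry hPhi hl; have sh := symmetry_wref hPhi hP.
have : ev l (wref h x) = ev l x.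
  apply: rinj; last by rewrite e2 IH.
    exact: symmetry_vertex sl (symmetry_vertex sh (vC x xC)).
  exact: symmetry_vertex sl (vC x xC).
move/(symmetry_inj sl) => e; have := wref_dot hPhi x hP; rewrite e.
move=> e'; have : dot x h.1 - h.2%:~R = 0 by lra.
by move/eqP; rewrite subr_eq0 gt_eqF.
Qed.

End From_alcove.
End Foldings_of_the_Coxeter_complex.
End Folding.

(** * Orderings of the Coxeter complex *)

Lemma set_bij_fsetP (T : choiceType) (s : {fset T}) (m : nat) (f : T -> nat) :
  set_bij [set` s] [set k | (1 <= k <= m)%N] f <->
  [/\ forall y, y \in s -> (1 <= f y <= m)%N, {in s &, injective f} &
      forall k, (1 <= k <= m)%N -> exists2 y, y \in s & f y = k].
Proof.
split=> [[h1 h2 h3]|[h1 h2 h3]]; split.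
- by move=> y ys; apply: h1.
- by move=> x y xs ys; apply: h2; rewrite inE.
- by move=> k hk; have [y ys e] := h3 k hk; exists y.
- by move=> y ys; apply: h1.
- by move=> x y; rewrite !inE => xs ys; exact: h2.
by move=> k hk; have [y ys e] := h3 k hk; exists y.
Qed.

Lemma imfset_fset2 (T T' : choiceType) (f : T -> T') u v :
  [fset f x | x in [fset u; v]] = [fset f u; f v].
Proof.
apply/fsetP => y; rewrite !inE; apply/imfsetP/orP => [[x /=]|].
  by rewrite !inE => /orP[] /eqP-> ->; rewrite eqxx; [left|right].
by case=> /eqP->; [exists u|exists v]; rewrite //= !inE eqxx ?orbT.
Qed.

Lemma big_fset2 (T : choiceType) (V : zmodType) (F : T -> V) u v : u != v ->
  \sum_(x <- [fset u; v]) F x = F u + F v.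
Proof.
move=> uv; rewrite (big_fsetD1 u) ?inE ?eqxx //=; congr (_ + _).
rewrite (_ : _ `\ _ = [fset v]) ?big_seq_fset1 //.
apply/fsetP => x; rewrite !inE; have [->|] := eqVneq x u; first by rewrite (negbTE uv).
by [].
Qed.

Section Coxeter_orderings.
Variables (R : realType) (n : nat) (Phi : {fset 'rV[R]_n}).
Hypothesis hPhi : root_system Phi.
Local Notation V := 'rV[R]_n.
Local Notation cf := (closed_facet Phi).
Local Notation Sigma := (coxeter_complex Phi).
Local Notation vset := (vset hPhi).
Local Notation eaw := (extended_affine_weyl Phi).
Local Notation cqs := (coxeter_quasi_special Phi).
Implicit Types (u v x y z p q d a b t : V) (C s : {fset V}) (k m : int).

Lemma segment_sym x y : (segment x y `<=` segment y x)%classic.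
Proof.
move=> _ [r /= /andP[r0 r1] <-]; exists (1 - r).
  by rewrite /= subr_ge0 r1 lerBlDr lerDl r0.
apply/rowP => i; rewrite !mxE; lra.
Qed.

Lemma segment_left x y : segment x y x.
Proof. by exists 0; rewrite /= ?lexx ?ler01 // scale0r addr0. Qed.

Lemma segment_right x y : segment x y y.
Proof. by exists 1; rewrite /= ?lexx ?ler01 // scale1r addrC subrK. Qed.

Lemma symmetry_segment_in F x y z : symmetry Phi F -> segment x y z -> segment (F x) (F y) (F z).
Proof. by move=> sF [r hr <-]; exists r => //; rewrite (symmetry_segment _ _ _ sF). Qed.

Lemma symmetry_edge F u v : symmetry Phi F -> edge Sigma u v -> edge Sigma (F u) (F v).
Proof.
move=> sF [uv s]; split; first by rewrite (inj_eq (symmetry_inj sF)).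
by rewrite -imfset_fset2; exact: symmetry_simplex.
Qed.

Lemma symmetry_special_segment F x y : symmetry Phi F ->
  special_segment Phi x y -> special_segment Phi (F x) (F y).
Proof.
move=> sF [sx sy h]; split; [exact: symmetry_special|exact: symmetry_special|].
move=> z [r hr <-]; rewrite -(symmetry_segment _ _ _ sF).
have [|u [v [suv uvz]]] := h (x + r *: (y - x)); first by exists r.
exists (F u), (F v); split; last exact: symmetry_segment_in.
by rewrite -imfset_fset2; exact: symmetry_simplex.
Qed.

Lemma symmetry_cqs F u v : symmetry Phi F -> cqs u v -> cqs (F u) (F v).
Proof.
move=> sF [euv [x [y [sxy h]]]]; split; first exact: symmetry_edge.
exists (F x), (F y); split; first exact: symmetry_special_segment.
move=> z [r hr <-]; rewrite -(symmetry_segment _ _ _ sF).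
by apply: symmetry_segment_in sF _; apply: h; exists r.
Qed.

Lemma symmetry_cqsE F u v : symmetry Phi F -> cqs (F u) (F v) <-> cqs u v.
Proof.
move=> sF; split; last exact: symmetry_cqs.
by have [G [sG FK _]] := symmetry_inv sF => /(symmetry_cqs sG); rewrite !FK.
Qed.

Lemma symmetry_specialE F v : symmetry Phi F -> coxeter_special Phi (F v) <-> coxeter_special Phi v.
Proof.
move=> sF; split; last exact: symmetry_special.
by have [G [sG FK _]] := symmetry_inv sF => /(symmetry_special hPhi sG); rewrite FK.
Qed.

Lemma weyl_conj M w : symm_data Phi M 0 -> weyl Phi w ->
  exists2 w', weyl Phi w' & forall v, w v *m M = w' (v *m M).
Proof.
move=> hM; elim=> [|a {}w aP _ [w' hw' e]]; first by exists id => //; exact: weyl_id.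
exists (reflection (a *m M) \o w').
  by apply: weyl_refl => //; exact: (sd_root hM).
move=> v; rewrite /= -e /reflection !(dot_orth _ _ (sd_orth hM)).
by rewrite mulmxBl -scalemxAl.
Qed.

(** Symmetries normalize the extended affine Weyl group, so composing an ordering with one keeps its
    invariance. *)
Lemma eaw_conj F g : symmetry Phi F -> eaw g ->
  exists2 g', eaw g' & forall v, F (g v) = g' (F v).
Proof.
move=> [M [t [hM hF]]] [w [t' [hw ht' ->]]].
have hM0 : symm_data Phi M 0.
  by case: hM => h1 h2 _; split=> // a aP; rewrite dot0l rpred0.
have [w' hw' e] := weyl_conj hM0 hw; have [M' hM' wM'] := weyl_mx hPhi hw'.
exists (fun v => w' v + (t' *m M + t - w' t)).
  exists w', (t' *m M + t - w' t); split=> // a aP.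
  rewrite !dotl rpredB ?rpredD ?(sd_coweight hM) //.
    rewrite dot_mulmx; apply: ht'; exact: (sd_root (symm_data_inv hM)).
  rewrite wM' dot_mulmx; apply: (sd_coweight hM).
  exact: (sd_root (symm_data_inv hM')).
move=> v; rewrite !hF mulmxDl e !wM' mulmxDl.
by apply/rowP => i; rewrite !mxE; lra.
Qed.

Lemma ordering_symmetry tau F : symmetry Phi F -> coxeter_ordering Phi tau ->
  coxeter_ordering Phi (fun u v => tau (F u) (F v)).
Proof.
move=> sF [h1 h2 h3 h4]; have Finj := symmetry_inj sF; split.
- by move=> u v /(symmetry_cqs sF); exact: h1.
- move=> C x sC cC xC sx; apply/set_bij_fsetP.
  have mem y : y \in C `\ x -> F y \in [fset F z | z in C] `\ F x.
    rewrite !in_fsetD1 (inj_eq Finj) => /andP[-> yC]; apply/imfsetP; by exists y.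
  have [|||g1 g2 g3] := (set_bij_fsetP _ _ _).1 (h2 [fset F y | y in C] (F x) (symmetry_simplex hPhi sF sC) _ _ _).
  + by rewrite card_imfset.
  + by apply/imfsetP; exists x.
  + exact: symmetry_special.
  split.
  + by move=> y yC; exact: g1 (mem y yC).
  + by move=> y z /mem yC /mem zC e; apply: Finj; exact: g2.
  move=> k hk; have [z /fsetD1P[zx /imfsetP[y /= yC ey]] e] := g3 k hk.
  rewrite ey (inj_eq Finj) in zx.
  by exists y; [rewrite in_fsetD1 zx|rewrite -ey].
- move=> g u v hg huv; have [g' hg' e] := eaw_conj sF hg.
  by rewrite !e; apply: h3 => //; exact: symmetry_cqs.
move=> x y u v u' v' sxy.
have go p q : directed_edge_on Phi p q x y -> directed_edge_on Phi (F p) (F q) (F x) (F y).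
  move=> [e [a [b [a0 ab b1 ep eq]]]]; split; first exact: symmetry_edge.
  by exists a, b; rewrite -!(symmetry_segment _ _ _ sF) -ep -eq.
by move=> /go d1 /go d2; exact: h4 (symmetry_special_segment sF sxy) d1 d2.
Qed.

Lemma det_int l (G : 'M[R]_l) : (forall i j, G i j \is a Num.int) -> \det G \is a Num.int.
Proof.
move=> h; rewrite /determinant rpred_sum // => s _.
by rewrite rpredM ?rpredX ?rpredN1 ?rpred1 // rpred_prod.
Qed.

Lemma adj_int l (G : 'M[R]_l) : (forall i j, G i j \is a Num.int) ->
  forall i j, (\adj G) i j \is a Num.int.
Proof.
move=> h i j; rewrite mxE /cofactor rpredM ?rpredX ?rpredN1 //.
by apply: det_int => a b; rewrite !mxE.
Qed.

(** The roots integral at a vertex span, as otherwise the vertex could move inside its facet. For a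
    basis [b] of such roots, [G] is the integral matrix of their pairings with the coroots; by
    Cramer's rule [\det G] times any root is an integral combination of [b]. *)
Lemma vertex_rational v : coxeter_vertex Phi v -> exists2 N : nat, (0 < N)%N &
  forall b, b \in Phi -> N%:R * dot v b \is a Num.int.
Proof.
move=> vv; pose I := [seq a <- Phi | dot v a \is a Num.int].
pose A : 'M[R]_(size I, n) := \matrix_(i < size I) nth 0 I i.
have fA : row_full A.
  rewrite /row_full -mxrank_tr; apply/inj_row_free => u uA.
  have [|e e0 he] := @near_cf_from _ _ Phi v u.
    move=> a aP ai'; have aI : a \in I by rewrite mem_filter ai'.
    have im : (index a I < size I)%N by rewrite index_mem.
    have := congr1 (fun B : 'rV_(size I) => B 0 (Ordinal im)) uA; rewrite !mxE => e.
    rewrite dotE -[RHS]e; apply: eq_bigr => i _.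
    by rewrite !mxE /= nth_index.
  have : cf v (v + e *: u) by apply: he; rewrite lexx ltW.
  rewrite vv /= => /eqP; rewrite -subr_eq0 addrC addKr scaler_eq0 gt_eqF //=.
  by move/eqP.
pose f := fullrankfun fA; pose b i : V := nth 0 I (f i).
have bI i : b i \in I by rewrite mem_nth.
have bP i : b i \in Phi by have := bI i; rewrite mem_filter => /andP[].
have vb i : dot v (b i) \is a Num.int by have := bI i; rewrite mem_filter => /andP[].
pose B : 'M[R]_n := \matrix_i b i.
have Bu : B \in unitmx.
  rewrite -[B](_ : rowsub f A = _) ?fullrowsub_unit //.
  by apply/row_matrixP => i; rewrite row_rowsub !rowK.
pose D : 'M[R]_n := \matrix_j ((2 / dot (b j) (b j)) *: b j).
have bb i : dot (b i) (b i) != 0 by rewrite dot_eq0 (root_ne0 hPhi).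
have Du : D \in unitmx.
  have -> : D = diag_mx (\row_j (2 / dot (b j) (b j))) *m B.
    by apply/row_matrixP => i; rewrite row_mul row_diag_mx -scalemxAl -rowE !rowK mxE.
  rewrite unitmx_mul Bu andbT unitmxE det_diag unitfE; apply/prodf_neq0 => i _.
  by rewrite mxE mulf_neq0 ?invr_eq0 // pnatr_eq0.
pose G := B *m D^T.
have cr c j : c \in Phi -> dot c ((2 / dot (b j) (b j)) *: b j) \is a Num.int.
  by move=> cP; rewrite dotZr mulrAC (root_crystallographic hPhi).
have Gi i j : G i j \is a Num.int.
  have -> : G i j = dot (b i) ((2 / dot (b j) (b j)) *: b j).
    by rewrite mxE dotE; apply: eq_bigr => k _; rewrite !mxE.
  exact: cr.
have di := det_int Gi.
have d0 : \det G != 0.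
  by rewrite -unitfE -unitmxE unitmx_mul Bu unitmx_tr.
have key c : c \in Phi -> \det G * dot v c \is a Num.int.
  move=> cP; pose e := c *m invmx B.
  have ec : c = e *m B by rewrite mulmxKV.
  have ei i : (\det G *: e) 0 i \is a Num.int.
    have -> : \det G *: e = (c *m D^T) *m \adj G.
      transitivity (e *m G *m \adj G); first by rewrite -mulmxA mul_mx_adj mul_mx_scalar.
      by rewrite /G mulmxA -ec.
    rewrite mxE rpred_sum // => j _; rewrite rpredM //.
      have -> : (c *m D^T) 0 j = dot c ((2 / dot (b j) (b j)) *: b j).
        by rewrite mxE dotE; apply: eq_bigr => k _; rewrite !mxE.
      exact: cr.
    exact: adj_int.
  have -> : dot v c = \sum_i e 0 i * dot v (b i).
    rewrite {1}ec mulmx_sum_row dot_sumr; apply: eq_bigr => i _.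
    by rewrite dotZr rowK.
  rewrite mulr_sumr rpred_sum // => i _; rewrite mulrA rpredM //.
  by have := ei i; rewrite mxE.
exists `|Num.floor (\det G)|%N.
  by rewrite absz_gt0; apply: contraNneq d0 => e; rewrite -(floorK di) e.
move=> c cP; rewrite natr_absz intr_norm floorK //.
have [d|d] := ger0P (\det G); first exact: key.
by rewrite mulNr rpredN key.
Qed.

Hypothesis ai : forall s, simplex Sigma s -> affinely_independent s id.

Lemma simplex_pair C x y : alcove Phi C -> x \in C -> y \in C -> simplex Sigma [fset x; y].
Proof.
move=> [sC _] xC yC; apply: (simplex_face hPhi ai sC).
  by apply/fset0Pn; exists x; rewrite !inE eqxx.
by move=> z; rewrite !inE => /orP[]/eqP->.
Qed.

Lemma vset_segment u v z : simplex Sigma [fset u; v] -> segment u v z ->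
  {subset vset z <= [fset u; v]}.
Proof.
move=> /(simplexP hPhi)[w e] [r /= /andP[r0 r1] <-].
have wu : cf w u by apply: (proj2 ((in_vset hPhi w u).1 _)); rewrite -e !inE eqxx.
have wv : cf w v by apply: (proj2 ((in_vset hPhi w v).1 _)); rewrite -e !inE eqxx orbT.
rewrite e; apply: vset_sub => a k aP h.
have := wu a k aP h; have := wv a k aP h; rewrite !dotl.
move: (dot u a) (dot v a) => A B h1 h2.
have := ler_wpM2l r0 h1; have : 0 <= 1 - r by rewrite subr_ge0.
move/ler_wpM2l/(_ _ _ h2); lra.
Qed.

Lemma vertex_on_edge u v z : simplex Sigma [fset u; v] -> segment u v z ->
  coxeter_vertex Phi z -> z = u \/ z = v.
Proof.
move=> suv uvz vz; have := vset_segment suv uvz (x := z).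
by rewrite vset_vertex // !inE eqxx => /(_ isT)/orP[]/eqP->; [left|right].
Qed.

Lemma vset_pair_1skeleton z u1 u2 : vset z = [fset u1; u2] -> coxeter_1skeleton Phi z.
Proof.
move=> ez; exists u1, u2; split; first by rewrite -ez; exact: simplex_vset.
have [_ _] := bary_in hPhi z; have := bary_comb hPhi z; rewrite ez.
have [->|u12] := eqVneq u1 u2.
  rewrite fsetUid !big_seq_fset1 => e eb; have -> : z = u2 by rewrite -[LHS]e eb scale1r.
  exact: segment_left.
rewrite !big_fset2 // => e eb; exists (bary hPhi z u2).
  have [b0 _ _] := bary_in hPhi z.
  by have := b0 u1; have := b0 u2 => /= -> h; lra.
have e' : bary hPhi z u1 = 1 - bary hPhi z u2 by lra.
rewrite -[RHS]e e' scalerBl scale1r scalerBr.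
by rewrite -addrA [- _ + _]addrC.
Qed.

(** The line is contained in the walls of all panels opposite the other vertices of [C], so the
    facet of [z] is too, and its vertices are on the line. Being affinely independent, they are at
    most two. *)
Lemma line_1skeleton C x y (r : R) : alcove Phi C -> x \in C -> y \in C -> y != x ->
  coxeter_1skeleton Phi (x + r *: (y - x)).
Proof.
move=> aC xC yC yx; set z := x + _.
have online u : u \in vset z -> exists s : R, u = x + s *: (y - x).
  move=> uz; have [_ zu] := (in_vset hPhi z u).1 uz.
  have [c c1 cu] := frame_coord u (alcove_ai ai aC) aC.2.
  have c0 w : w \in C -> w != x -> w != y -> c w = 0.
    move=> wC wx wy; have [a [k [aP hk wk]]] := panel_wall hPhi ai aC wC.
    have ez : dot z a = k%:~R.
      by rewrite /z !dotl !hk // 1?eq_sym // subrr mulr0 addr0.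
    have := cf_int hPhi aP zu ez.
    rewrite -cu dot_suml => e.
    have : \sum_(i <- C) c i * (dot i a - k%:~R) = 0.
      transitivity (\sum_(i <- C) dot (c i *: i) a - \sum_(i <- C) c i * k%:~R).
        by rewrite -sumrB; apply: eq_bigr => i _; rewrite mulrBr dotZl.
      by rewrite e -mulr_suml c1 mul1r subrr.
    rewrite (big_fsetD1 w) //= big1_fset ?addr0 => [/eqP|i].
      by rewrite mulf_eq0 [_ - _ == 0]gt_eqF ?subr_gt0 // orbF => /eqP.
    by rewrite in_fsetD1 => /andP[iw iC] _; rewrite hk // subrr mulr0.
  exists (c y).
  have yCx : y \in C `\ x by rewrite in_fsetD1 yx.
  have e1 : c x + c y = 1.
    rewrite -c1 (big_fsetD1 x) //= (big_fsetD1 y) //= big1_fset ?addr0 // => i.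
    by rewrite !in_fsetD1 => /and3P[iy ix iC] _; rewrite c0.
  rewrite -cu (big_fsetD1 x) //= (big_fsetD1 y) //= big1_fset ?addr0 => [|i].
    have -> : c x = 1 - c y by lra.
    by rewrite scalerBl scale1r scalerBr -addrA [- _ + _]addrC.
  by rewrite !in_fsetD1 => /and3P[iy ix iC] _; rewrite c0 // scale0r.
have [u1 u1z] : exists u, u \in vset z by apply/fset0Pn; exact: vset_neq0.
have [[u2 u2z u21]|nu2] := pselect (exists2 u2, u2 \in vset z & u2 != u1); last first.
  have ez : vset z = [fset u1].
    apply/fsetP => u; rewrite inE; apply/idP/eqP => [uz|->//].
    by apply: contrapT => /eqP uu1; apply: nu2; exists u.
  by apply: (@vset_pair_1skeleton z u1 u1); rewrite fsetUid.
have u12 : u1 != u2 by rewrite eq_sym.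
apply: (@vset_pair_1skeleton z u1 u2).
  apply/fsetP => u3; rewrite !inE; apply/idP/orP => [u3z|[]/eqP->//].
  have [s1 e1] := online _ u1z; have [s2 e2] := online _ u2z; have [s3 e3] := online _ u3z.
  have [_|u31] := eqVneq u3 u1; first by left.
  have [_|u32] := eqVneq u3 u2; first by right.
  exfalso.
  have s12 : s1 != s2 by apply: contraNneq u12 => e; rewrite e1 e2 e.
  (* The affine relation between three collinear points with parameters [s1], [s2], [s3]. *)
  pose c u := if u == u1 then s2 - s3 else if u == u2 then s3 - s1 else s1 - s2.
  have sub : {subset u3 |` [fset u1; u2] <= vset z}.
    by move=> u; rewrite !inE => /or3P[]/eqP->.
  have sS := simplex_face hPhi ai (simplex_vset hPhi z) _ sub.
  have nin : u3 \notin [fset u1; u2] by rewrite !inE negb_or u31.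
  have c3 : c u3 = s1 - s2 by rewrite /c (negbTE u31) (negbTE u32).
  have c1 : c u1 = s2 - s3 by rewrite /c eqxx.
  have c2 : c u2 = s3 - s1 by rewrite /c (negbTE u21) eqxx.
  have : c u3 = 0.
    apply: (@ai (u3 |` [fset u1; u2])); last by rewrite !inE eqxx.
    - by apply: sS; apply/fset0Pn; exists u3; rewrite !inE eqxx.
    - by rewrite big_fsetU1 //= big_fset2 // c1 c2 c3; lra.
    rewrite big_fsetU1 //= big_fset2 // c1 c2 c3 e1 e2 e3.
    by apply/rowP => i; rewrite !mxE; lra.
  by rewrite c3 => /eqP; rewrite subr_eq0 (negbTE s12).
Qed.

Lemma special_edge_cqs C x y : alcove Phi C -> coxeter_special Phi x -> x \in C -> y \in C ->
  y != x -> cqs x y.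
Proof.
move=> aC sx xC yC yx; split; first by split; [rewrite eq_sym|exact: simplex_pair aC xC yC].
have [N N0 hN] := vertex_rational (vertex_of_simplex hPhi aC.1 yC).
exists x, (x + N%:R *: (y - x)); split; last first.
  move=> _ [r /= /andP[r0 r1] <-]; exists (r / N%:R) => /=.
    rewrite divr_ge0 ?ler0n //= ler_pdivrMr ?ltr0n // mul1r (le_trans r1) //.
    by rewrite ler1n.
  by rewrite [x + _ - x]addrC addKr scalerA divfK // pnatr_eq0 -lt0n.
split=> //.
  apply/(specialP hPhi) => a aP; have xi := (specialP hPhi x).1 sx a aP.
  by rewrite dotDl dotZl dotBl mulrBr rpredD ?rpredB ?hN // rpredM ?rpred_nat.
move=> _ [r _ <-]; rewrite [x + _ - x]addrC addKr scalerA.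
exact: line_1skeleton aC xC yC yx.
Qed.

Lemma special_segment_sym x y : special_segment Phi x y -> special_segment Phi y x.
Proof. by move=> [sx sy h]; split=> // z /segment_sym; exact: h. Qed.

(** A point of the segment close to [x] lies on an edge, and by local finiteness [x] is an end of
    that edge. The edge cannot run past [y], which is a vertex. *)
Lemma first_edge x y : special_segment Phi x y -> x != y -> exists v (b : R),
  [/\ edge Sigma x v, 0 < b, b <= 1 & v = x + b *: (y - x)].
Proof.
move=> [sx sy h] xy; have [e e0 he] := near_cf Phi x (y - x).
pose t := Num.min e 1; have t0 : 0 < t by rewrite lt_min e0 ltr01.
have zx : cf (x + t *: (y - x)) x by apply: he; rewrite (ltW t0) ge_min lexx.
have [|u [v' [suv uvz]]] := h (x + t *: (y - x)).
  by exists t; rewrite //= (ltW t0) ge_min lexx orbT.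
have vx := sx.1.
have xuv : x \in [fset u; v'].
  by apply: (vset_segment suv uvz); apply/in_vset; split.
have [v [sxv [s /= /andP[s0 s1] es]]] : exists v, simplex Sigma [fset x; v] /\ segment x v (x + t *: (y - x)).
  move: xuv; rewrite !inE => /orP[]/eqP ex; first by exists v'; rewrite ex in suv uvz *.
  exists u; rewrite {1 2}ex fsetUC; split=> //.
  by apply: segment_sym; rewrite ex in uvz *.
have {}es : s *: (v - x) = t *: (y - x) by move/addrI: es.
have yx0 : y - x != 0 by rewrite subr_eq0 eq_sym.
have s0' : 0 < s.
  rewrite lt_neqAle s0 andbT eq_sym; apply: contraNneq yx0 => s00.
  by move/eqP: es; rewrite s00 scale0r eq_sym scaler_eq0 gt_eqF.
have ev' : v - x = (t / s) *: (y - x).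
  by rewrite mulrC -scalerA -es scalerA mulVf ?gt_eqF // scale1r.
have b0 : 0 < t / s by rewrite divr_gt0.
have xv : x != v.
  rewrite eq_sym -subr_eq0 ev' scaler_eq0 negb_or gt_eqF //=.
exists v, (t / s); split=> //; last by rewrite -ev' addrC subrK.
rewrite leNgt; apply/negP => b1.
have yseg : segment x v y.
  exists (t / s)^-1 => /=; first by rewrite invr_ge0 (ltW b0) invf_le1 ?ltW.
  by rewrite ev' scalerA mulVf ?gt_eqF // scale1r addrC subrK.
case: (vertex_on_edge sxv yseg sy.1) => e1; first by rewrite e1 eqxx in xy.
move: ev'; rewrite -e1 -{1}[y - x]scale1r => /eqP; rewrite -subr_eq0 -scalerBl scaler_eq0.
by rewrite (negbTE yx0) orbF subr_eq0 lt_eqF.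
Qed.

Lemma cqs_directed u v : cqs u v -> exists x y, special_segment Phi x y /\ directed_edge_on Phi u v x y.
Proof.
move=> [euv [x [y [sxy h]]]].
have [a /= /andP[a0 a1] eu] := h _ (segment_left u v).
have [b /= /andP[b0 b1] ev'] := h _ (segment_right u v).
have [ab|ba|ab] := ltgtP a b.
- by exists x, y; split=> //; split=> //; exists a, b.
- exists y, x; split; first exact: special_segment_sym.
  split=> //; exists (1 - a), (1 - b); split.
  + by rewrite subr_ge0.
  + by rewrite ltrD2l ltrN2.
  + by rewrite lerBlDr lerDl.
  + by rewrite -eu; apply/rowP => i; rewrite !mxE; lra.
  by rewrite -ev'; apply/rowP => i; rewrite !mxE; lra.
by case: euv; rewrite -eu -ev' ab eqxx.
Qed.

(** Labels are constant along a special segment, so that of [[u, v]] equals that of the first edge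
    of the segment. This reduces quasi-special edges to special edges of alcoves with the same
    direction. *)
Lemma cqs_origin u v : cqs u v -> exists x y C (c : R),
  [/\ coxeter_special Phi x, alcove Phi C, x \in C & y \in C] /\
  [/\ y != x, 0 < c, v - u = c *: (y - x) &
    forall tau, coxeter_ordering Phi tau -> tau u v = tau x y].
Proof.
move=> /cqs_directed[x [z [sxz duv]]].
have [[uv suv] [a [b [a0 ab b1 eu ev']]]] := duv.
have xz : x != z.
  by apply: contraNneq uv => xz; rewrite eu ev' xz subrr !scaler0.
have [y [c [exy c0 c1 ey]]] := first_edge sxz xz.
have [xy sxy] := exy; have [C aC sC] := simplex_sub_alcove hPhi ai sxy.
exists x, y, C, ((b - a) / c); split; split=> //.
- by case: sxz.
- by apply: sC; rewrite !inE eqxx.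
- by apply: sC; rewrite !inE eqxx orbT.
- by rewrite eq_sym.
- by rewrite divr_gt0 // subr_gt0.
- rewrite ey [x + _ - x]addrC addKr scalerA divfK ?gt_eqF // eu ev'.
  by rewrite opprD addrACA subrr add0r -scalerBl.
move=> tau htau; apply: (co_segment htau sxz duv); split=> //.
by exists 0, c; rewrite scale0r addr0.
Qed.

Lemma ordering_unique tau tau' C x : coxeter_ordering Phi tau -> coxeter_ordering Phi tau' ->
  alcove Phi C -> x \in C -> coxeter_special Phi x ->
  (forall y, y \in C -> y != x -> tau x y = tau' x y) ->
  forall u v, cqs u v -> tau u v = tau' u v.
Proof.
move=> h h' aC xC sx e u v /cqs_origin[x' [y [C' [c [[sx' aC' x'C yC] [yx _ _ o]]]]]].
rewrite !o // {o}; have [g [hg gx eC']] := eaw_transitive hPhi ai aC aC' xC x'C sx sx'.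
move: yC; rewrite eC' => /imfsetP[y0 /= y0C ey].
have y0x : y0 != x by apply: contraNneq yx => e0; rewrite ey e0 gx.
have q := special_edge_cqs aC sx xC y0C y0x.
by rewrite -gx ey !(co_invariant _ hg q) // e.
Qed.

Section Existence.
Variables (C : {fset V}) (x : V) (sigma : V -> nat).
Hypothesis aC : alcove Phi C.
Hypothesis xC : x \in C.
Hypothesis sx : coxeter_special Phi x.
Hypothesis sigma_bij : set_bij [set` C `\ x] [set k | (1 <= k <= n)%N] sigma.

(** The stabilizer of [x] acts by words as well, because the wall of each direction through the
    special vertex [x] has an integral level. This makes [alcove_fundamental] available for
    directions at [x]. *)
Lemma weyl_word w : weyl Phi w -> exists2 l, word Phi C l & forall v, ev l v = w (v - x) + x.
Proof.
have [q gq eC] := alcove_avg hPhi ai aC.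
elim=> [|a {}w aP _ [l hl e]]; first by exists [::] => // v; rewrite subrK.
have [l' hl' e'] := wall_word hPhi ai gq (Num.floor (dot x a)) aP.
exists (l' ++ l); first by apply: word_cat; rewrite // eC.
move=> v; rewrite ev_cat -e' e floorK; last exact: (specialP hPhi x).1.
by rewrite /aref /= /reflection !dotl addrK addrAC.
Qed.

Lemma weyl_inv w : weyl Phi w -> exists2 w', weyl Phi w' & cancel w w'.
Proof.
elim=> [|a {}w aP _ [w' hw' K]]; first by exists id => //; exact: weyl_id.
exists (w' \o (reflection a \o id)).
  by apply: weyl_comp => //; apply: weyl_refl => //; exact: weyl_id.
move=> v /=; have e p : reflection a p = aref a 0 p by rewrite /aref subr0.
by rewrite !e arefK ?K // (root_ne0 hPhi).
Qed.

(** The vector of [[u, v]] is in the Weyl orbit of the open ray from [x] to [y]; the factor [c]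
    accounts for edges of different lengths on one segment. *)
Definition direction u v y := y \in C `\ x /\ exists (c : R) w,
  [/\ 0 < c, weyl Phi w & v - u = c *: w (y - x)].

(** After comparing [c] with [c'], one of the two vertices lies on the edge from [x] to an image of
    the other. As a vertex other than [x] it is the end of that edge, and the fundamental domain
    property makes the two equal. *)
Lemma direction_uniq u v y y' : direction u v y -> direction u v y' -> y = y'.
Proof.
have [q gq eC] := alcove_avg hPhi ai aC.
have main w y1 y2 (r : R) : weyl Phi w -> y1 \in C `\ x -> y2 \in C `\ x -> 0 < r -> r <= 1 ->
    y2 - x = r *: w (y1 - x) -> y1 = y2.
  move=> hw /fsetD1P[y1x y1C] /fsetD1P[y2x y2C] r0 r1 e.
  have [l hl el] := weyl_word hw.
  have sl := ev_symmetry hPhi hl.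
  have lx : ev l x = x.
    have [M _ wM] := weyl_mx hPhi hw.
    by rewrite el subrr wM mul0mx add0r.
  have ey2 : y2 = x + r *: (ev l y1 - x).
    by rewrite el addrK -e addrC subrK.
  have seg : segment x (ev l y1) y2 by exists r; rewrite //= (ltW r0).
  have spx : simplex Sigma [fset x; ev l y1].
    rewrite -{1}lx -imfset_fset2; apply: symmetry_simplex => //; exact: simplex_pair aC xC y1C.
  case: (vertex_on_edge spx seg (vertex_of_simplex hPhi aC.1 y2C)) => e2.
    by rewrite e2 eqxx in y2x.
  rewrite e2; apply/esym; rewrite eC in hl y1C y2C.
  by apply: (alcove_fundamental ai gq hl y1C); rewrite -e2.
move=> [yC [c [w [c0 hw e]]]] [y'C [c' [w' [c'0 hw' e']]]].
have lin w0 : weyl Phi w0 -> forall (r : R) p, w0 (r *: p) = r *: w0 p.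
  by move=> /(weyl_mx hPhi)[M _ wM] r p; rewrite !wM scalemxAl.
have [v1 hv1 K1] := weyl_inv hw; have [v2 hv2 K2] := weyl_inv hw'.
have ee : c *: w (y - x) = c' *: w' (y' - x) by rewrite -e -e'.
have [cc|cc] := leP c c'.
  apply: (main (v2 \o w) y y' (c / c')) => //.
  - exact: weyl_comp.
  - by rewrite divr_gt0.
  - by rewrite ler_pdivrMr // mul1r.
  have := congr1 v2 ee; rewrite !(lin _ hv2) K2 => e2.
  by rewrite /= mulrC -scalerA e2 scalerA mulVf ?gt_eqF // scale1r.
apply/esym; apply: (main (v1 \o w') y' y (c' / c)) => //.
- exact: weyl_comp.
- by rewrite divr_gt0.
- by rewrite ler_pdivrMr // mul1r ltW.
have := congr1 v1 ee; rewrite !(lin _ hv1) K1 => e2.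
by rewrite /= mulrC -scalerA -e2 scalerA mulVf ?gt_eqF // scale1r.
Qed.

Lemma direction_exists u v : cqs u v -> exists y, direction u v y.
Proof.
move=> /cqs_origin[x' [y' [C' [c [[sx' aC' x'C y'C] [yx c0 e _]]]]]].
have [g [hg gx eC']] := eaw_transitive hPhi ai aC aC' xC x'C sx sx'.
move: y'C; rewrite eC' => /imfsetP[y /= yC ey].
have yx' : y != x by apply: contraNneq yx => e0; rewrite ey e0 gx.
exists y; split; first by rewrite in_fsetD1 yx'.
have [w [t [hw _ eg]]] := hg; exists c, w; split=> //.
have [M _ wM] := weyl_mx hPhi hw.
rewrite e ey -gx eg; congr (_ *: _).
by rewrite !wM opprD addrACA subrr addr0 mulmxBl.
Qed.

Lemma direction_special y : y \in C `\ x -> direction x y y.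
Proof. by move=> yC; split=> //; exists 1, id; rewrite scale1r; split=> //; exact: weyl_id. Qed.

Definition direction_label u v := sigma (xget x [set y | direction u v y]).

Lemma direction_labelE u v y : direction u v y -> direction_label u v = sigma y.
Proof.
move=> h; rewrite /direction_label; case: xgetP => [y' _ h'|/(_ y)//].
by rewrite (direction_uniq h h').
Qed.

Lemma direction_eaw g u v y : eaw g -> direction u v y -> direction (g u) (g v) y.
Proof.
move=> [w [t [hw ht ->]]] [yC [c [w' [c0 hw' e]]]]; split=> //.
exists c, (w \o w'); split=> //; first exact: weyl_comp.
have [M _ wM] := weyl_mx hPhi hw.
by rewrite /= !wM opprD addrACA subrr addr0 -mulmxBl e scalemxAl.
Qed.

Lemma direction_label_ordering : coxeter_ordering Phi direction_label.
Proof.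
have [b1 b2 b3] := (set_bij_fsetP _ _ _).1 sigma_bij; split.
- by move=> u v /direction_exists[y h]; rewrite (direction_labelE h); case: h => /b1.
- move=> C' x' sC' cC' x'C' sx'; have aC' : alcove Phi C' by [].
  have [g [hg gx eC']] := eaw_transitive hPhi ai aC aC' xC x'C' sx sx'.
  have ginj := symmetry_inj (eaw_symmetry hPhi hg).
  have lab y : y \in C `\ x -> direction_label x' (g y) = sigma y.
    by move=> yC; apply: direction_labelE; rewrite -gx; apply: direction_eaw => //; exact: direction_special.
  have pre y' : y' \in C' `\ x' -> exists2 y, y \in C `\ x & y' = g y.
    rewrite eC' -gx => /fsetD1P[yx /imfsetP[y /= yC ey]].
    rewrite ey (inj_eq ginj) in yx.
    by exists y; rewrite // in_fsetD1 yx.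
  apply/set_bij_fsetP; split.
  + by move=> _ /pre[y yC ->]; rewrite lab // b1.
  + move=> _ _ /pre[y yC ->] /pre[z zC ->]; rewrite !lab // => e.
    by rewrite (b2 y z).
  move=> k /b3[y yC <-]; exists (g y); last exact: lab.
  case/fsetD1P: yC => yx yC.
  rewrite in_fsetD1 -gx (inj_eq ginj) yx eC'; apply/imfsetP; by exists y.
- move=> g u v hg /direction_exists[y h].
  by rewrite (direction_labelE h) (direction_labelE (direction_eaw hg h)).
move=> p q u v u' v' spq [e [a [b [a0 ab _ eu ev']]]] [e' [a' [b' [a'0 ab' _ eu' ev'']]]].
have huv : v - u = (b - a) *: (q - p).
  by rewrite eu ev' opprD addrACA subrr add0r -scalerBl.
have huv' : v' - u' = (b' - a') *: (q - p).
  by rewrite eu' ev'' opprD addrACA subrr add0r -scalerBl.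
(* Both edges are positive multiples of [q - p], so they have the same candidates [y] and [xget]
   makes the same choice. *)
rewrite /direction_label; congr (sigma (xget _ _)); apply: funext => y; apply: propext.
have go (u1 v1 u2 v2 : V) (r1 r2 : R) : v1 - u1 = r1 *: (q - p) -> v2 - u2 = r2 *: (q - p) ->
    0 < r1 -> 0 < r2 -> direction u1 v1 y -> direction u2 v2 y.
  move=> h1 h2 r10 r20 [yC [c [w [c0 hw e0]]]]; split=> //.
  exists (r2 / r1 * c), w; split=> //; first by rewrite mulr_gt0 // divr_gt0.
  by rewrite -scalerA -e0 h1 h2 scalerA divfK // gt_eqF.
by split; apply: go; eauto; rewrite subr_gt0.
Qed.

End Existence.
End Coxeter_orderings.

(** * Charts of apartments and retractions *)

Lemma imfset_fset1 (T T' : choiceType) (f : T -> T') u :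
  [fset f x | x in [fset u]] = [fset f u].
Proof.
apply/fsetP => y; rewrite inE; apply/imfsetP/eqP => [[x /=]|->].
  by rewrite inE => /eqP-> ->.
by exists u; rewrite //= inE.
Qed.

Lemma simplicial_isometry_comp (R : realType) (T1 T2 T3 : choiceType) (K1 : complex R T1)
    (K2 : complex R T2) (K3 : complex R T3) f g :
  simplicial_isometry K1 K2 f -> simplicial_isometry K2 K3 g ->
  simplicial_isometry K1 K3 (g \o f).
Proof.
move=> [f1 f2 f3 f4] [g1 g2 g3 g4]; split.
- by move=> s /f1/g1; rewrite -imfset_comp.
- move=> x y hx hy /g2 e; apply: f2 => //; apply: e.
    by rewrite -imfset_fset1; exact: f1.
  by rewrite -imfset_fset1; exact: f1.
- move=> s' /g3[s /f3[s0 h0 ->] ->]; exists s0 => //.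
  by rewrite -imfset_comp.
move=> s x y hs xs ys; rewrite /= (g4 [fset f z | z in s]) ?(f4 s) //.
- exact: f1.
- by apply/imfsetP; exists x.
by apply/imfsetP; exists y.
Qed.

Section Charts.
Variables (R : realType) (n : nat) (Phi : {fset 'rV[R]_n}).
Hypothesis hPhi : root_system Phi.
Local Notation V := 'rV[R]_n.
Local Notation cf := (closed_facet Phi).
Local Notation Sigma := (coxeter_complex Phi).
Local Notation vset := (vset hPhi).
Local Notation vertex := (coxeter_vertex Phi).
Local Notation cqs := (coxeter_quasi_special Phi).
Implicit Types (v w p q a b : V).
Variables (T : choiceType) (K : complex R T) (A : set (set {fset T})).
Hypothesis hK : euclidean_building Phi K A.
Implicit Types (S : set {fset T}) (f : V -> T) (C D : {fset V}).

Lemma chart_simplex S f (s : {fset V}) : chart Phi K S f -> simplex Sigma s ->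
  S [fset f x | x in s].
Proof. by case=> h _ _ _; exact: h. Qed.

Lemma apartment_simplex S (s : {fset T}) : A S -> S s -> simplex K s.
Proof. by move=> /(eb_apartment hK)[h _]; exact: h. Qed.

Lemma chart_inj S f : chart Phi K S f -> forall v w, vertex v -> vertex w -> f v = f w -> v = w.
Proof.
by move=> [_ h _ _] v w vv vw; apply: h; exact: simplex_vertex.
Qed.

Lemma chart_inj_in S f (s : {fset V}) : chart Phi K S f -> simplex Sigma s -> {in s &, injective f}.
Proof.
move=> hf sS v w vs ws; apply: (chart_inj hf).
  exact: vertex_of_simplex vs.
exact: vertex_of_simplex ws.
Qed.

Lemma chart_len S f (s : {fset V}) x y : chart Phi K S f -> simplex Sigma s ->
  x \in s -> y \in s -> len K (f x) (f y) = edist x y.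
Proof. by move=> [_ _ _ h]; exact: h. Qed.

Lemma chart_surj S f (t : {fset T}) : chart Phi K S f -> S t ->
  exists2 s, simplex Sigma s & t = [fset f x | x in s].
Proof. by case=> _ _ h _; exact: h. Qed.

Lemma chart_alcove S f (t : {fset T}) : chart Phi K S f -> S t -> #|` t| = n.+1 ->
  exists2 C, alcove Phi C & t = [fset f x | x in C].
Proof.
move=> hf /(chart_surj hf)[C sC ->]; rewrite card_in_imfset /=; last exact: chart_inj_in hf sC.
by exists C.
Qed.

Lemma chart_card S f C : chart Phi K S f -> alcove Phi C -> #|` [fset f x | x in C]| = n.+1.
Proof. by move=> hf [sC cC]; rewrite card_in_imfset //=; exact: chart_inj_in hf sC. Qed.

Lemma chart_point S f t : chart Phi K S f -> S [fset t] -> exists2 v, vertex v & f v = t.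
Proof.
move=> hf /(chart_surj hf)[s sS e]; have : t \in [fset t] by rewrite inE.
rewrite e => /imfsetP[v /= vs ->]; exists v => //; exact: vertex_of_simplex vs.
Qed.

Lemma chart_pair S f (u v : T) : chart Phi K S f -> S [fset u; v] ->
  exists u' v', [/\ u = f u', v = f v' & simplex Sigma [fset u'; v']].
Proof.
move=> hf /(chart_surj hf)[s sS e].
have : u \in [fset u; v] by rewrite !inE eqxx.
have : v \in [fset u; v] by rewrite !inE eqxx orbT.
rewrite {1 2}e => /imfsetP[v' /= v's ev] /imfsetP[u' /= u's eu].
exists u', v'; split=> //; suff -> : [fset u'; v'] = s by [].
apply/fsetP => w; rewrite !inE; apply/orP/idP => [[]/eqP->//|ws].
have : f w \in [fset u; v] by rewrite e; apply/imfsetP; exists w.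
rewrite !inE eu ev => /orP[]/eqP/(chart_inj_in hf sS) e'; [left|right]; apply/eqP; exact: e'.
Qed.

Lemma polarization_zero (I : Type) (s : seq I) N N' (c : I -> R) (p : I -> 'rV[R]_N)
    (p' : I -> 'rV[R]_N') :
  \sum_(x <- s) c x = 0 -> \sum_(x <- s) c x *: p x = 0 ->
  \sum_(x <- s) \sum_(y <- s) c x * c y * edist (p x) (p y) ^+ 2 =
  \sum_(x <- s) \sum_(y <- s) c x * c y * edist (p' x) (p' y) ^+ 2 ->
  \sum_(x <- s) c x *: p' x = 0.
Proof.
move=> c0 cp e; apply/eqP; rewrite -dot_eq0 polarization // -e -polarization //.
by rewrite cp dot0l.
Qed.

(** By polarization an affine relation is visible in the distances, so it passes to the Euclidean
    model of the image simplex in [K], possibly of another dimension, where the points are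
    independent. *)
Lemma coxeter_simplices_independent S f : A S -> chart Phi K S f ->
  forall s, simplex Sigma s -> affinely_independent s id.
Proof.
move=> AS hf s sS c c0 cs.
have [N [p [ip ep]]] := pe_euclidean (eb_complex hK) (apartment_simplex AS (chart_simplex hf sS)).
have finj := chart_inj_in hf sS.
(* The choice inverts [f] on [s], which moves the coefficients to the image simplex. *)
have gK x : x \in s -> xget 0 [set y | y \in s /\ f y = f x] = x.
  move=> xs; case: xgetP => [y _ [ys e]|/(_ x)]; first exact: finj.
  by case.
pose c' t := c (xget 0 [set y | y \in s /\ f y = t]).
have sum0 : \sum_(t <- [fset f x | x in s]) c' t = 0.
  rewrite big_imfset //= -[RHS]c0; apply: eq_big_seq => x xs.
  by rewrite /c' gK.
have comb0 : \sum_(t <- [fset f x | x in s]) c' t *: p t = 0.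
  rewrite big_imfset //=.
  transitivity (\sum_(x <- s) c x *: p (f x)).
    by apply: eq_big_seq => x xs; rewrite /c' gK.
  apply: (polarization_zero c0 cs); apply: eq_big_seq => x xs; apply: eq_big_seq => y ys.
  rewrite -ep; last 2 first.
  - by apply/imfsetP; exists x.
  - by apply/imfsetP; exists y.
  by rewrite (chart_len hf sS).
move=> x xs; have := ip c' sum0 comb0 (f x); rewrite /c' gK //; apply.
by apply/imfsetP; exists x.
Qed.

Hypothesis ai : forall s, simplex Sigma s -> affinely_independent s id.

Lemma alcove_exists : exists C, alcove Phi C.
Proof. by have [q gq _] := generic_near hPhi 0; exists (vset q); exact: alcove_vset. Qed.

Lemma symmetry_folding F : symmetry Phi F -> folding Phi Sigma F.
Proof.
move=> sF; split=> [s|s x y _ _ _]; first exact: symmetry_simplex.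
exact: (symmetry_edist x y sF).
Qed.

Lemma symmetry_fix C F : alcove Phi C -> symmetry Phi F -> (forall x, x \in C -> F x = x) ->
  forall v, vertex v -> F v = v.
Proof.
move=> aC sF e; apply: (folding_bij hPhi ai (symmetry_folding sF) aC (symmetry_id Phi)) => //.
by move=> x y _ _; exact: (symmetry_inj sF).
Qed.

(** The vertex map [g], that is, [f] followed by the inverse of [f'], is an injective folding of the
    Coxeter complex, so [folding_bij] applies. *)
Lemma charts_differ_by_symmetry S f f' : chart Phi K S f -> chart Phi K S f' ->
  exists2 F, symmetry Phi F & forall v, vertex v -> f v = f' (F v).
Proof.
move=> hf hf'.
pose g v := xget 0 [set w | vertex w /\ f' w = f v].
have gP v : vertex v -> vertex (g v) /\ f' (g v) = f v.
  move=> vv; rewrite /g; case: xgetP => [//|h].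
  have [|w vw e] := chart_point (t := f v) hf'; last by case: (h w).
  by rewrite -imfset_fset1; apply: chart_simplex hf _; exact: simplex_vertex.
have fg : folding Phi Sigma g.
  have gs s : simplex Sigma s -> exists2 s', simplex Sigma s' & [fset g x | x in s] = s' /\
      [fset f x | x in s] = [fset f' x | x in s'].
    move=> sS; have [s' s'S e] := chart_surj hf' (chart_simplex hf sS).
    exists s' => //; split=> //; apply/fsetP => w; apply/imfsetP/idP => [[v /= vs ->]|ws'].
      have vv := vertex_of_simplex hPhi sS vs; have [vg eg] := gP v vv.
      have : f v \in [fset f' x | x in s'] by rewrite -e; apply/imfsetP; exists v.
      move=> /imfsetP[w' /= ws' ew]; suff -> : g v = w' by [].
      by apply: (chart_inj hf') => //; [exact: vertex_of_simplex ws'|rewrite eg].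
    have : f' w \in [fset f x | x in s] by rewrite e; apply/imfsetP; exists w.
    move=> /imfsetP[v /= vs ev']; exists v => //.
    have vv := vertex_of_simplex hPhi sS vs; have [vg eg] := gP v vv.
    by apply: (chart_inj hf') => //; [exact: vertex_of_simplex ws'|rewrite eg].
  split=> [s /gs[s' s'S [-> _]]//|s x y sS xs ys].
  have [s' s'S [e1 _]] := gs s sS.
  rewrite -(chart_len hf' s'S); last 2 first.
  - by rewrite -e1; apply/imfsetP; exists x.
  - by rewrite -e1; apply/imfsetP; exists y.
  rewrite (gP x (vertex_of_simplex hPhi sS xs)).2 (gP y (vertex_of_simplex hPhi sS ys)).2.
  exact: chart_len hf sS xs ys.
have [C aC] := alcove_exists.
have [F sF e] := folding_on_alcove hPhi ai fg aC.
exists F => // v vv; rewrite -(folding_bij hPhi ai fg aC sF e) ?(gP v vv).2 //.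
move=> x y vx vy exy; apply: (chart_inj hf) => //.
by rewrite -(gP x vx).2 exy (gP y vy).2.
Qed.

Lemma chart_transport S S' f h : chart Phi K S f ->
  simplicial_isometry (restrict_complex K S) (restrict_complex K S') h ->
  chart Phi K S' (h \o f).
Proof. exact: simplicial_isometry_comp. Qed.

Section Centered.
Variables (S : set {fset T}) (f : V -> T) (C : {fset V}).
Hypothesis AS : A S.
Hypothesis hf : chart Phi K S f.
Hypothesis aC : alcove Phi C.

Definition centered_chart S' f' := [/\ A S', chart Phi K S' f' & forall x, x \in C -> f' x = f x].

Let fC : {fset T} := [fset f x | x in C].

Let SfC : S fC. Proof. exact: chart_simplex hf aC.1. Qed.

Lemma centered_self : centered_chart S f.
Proof. by []. Qed.

Lemma centered_in S' f' : centered_chart S' f' -> S' fC.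
Proof.
move=> [_ hf' e]; have := chart_simplex hf' aC.1.
suff -> : [fset f' x | x in C] = fC by [].
by apply/fsetP => t; apply/imfsetP/imfsetP => -[x /= xC ->]; exists x => //; rewrite e.
Qed.

Lemma centered_chart_exists (s : {fset T}) : simplex K s ->
  exists S' f', centered_chart S' f' /\ S' s.
Proof.
move=> sK; have [S' [AS' S'C S's]] := eb_B1 hK (apartment_simplex AS SfC) sK.
have [h [hh fixh]] := eb_B2 hK AS AS' SfC S'C (chart_card hf aC).
exists S', (h \o f); split=> //; split=> //; first exact: chart_transport hf hh.
by move=> x xC; apply: fixh SfC S'C _; apply/imfsetP; exists x.
Qed.

(* Two charts that agree on the alcove C agree wherever their images meet:
   by (B2) one is carried to the other, and a symmetry of the Coxeter complex
   that fixes an alcove is the identity. *)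
Lemma centered_chart_unique S1 f1 S2 f2 v1 v2 : centered_chart S1 f1 -> centered_chart S2 f2 ->
  vertex v1 -> vertex v2 -> f1 v1 = f2 v2 -> v1 = v2.
Proof.
move=> c1 c2 vv1 vv2 e; have S1C := centered_in c1; have S2C := centered_in c2.
have [AS1 hf1 e1] := c1; have [AS2 hf2 e2] := c2.
have [h [hh fixh]] := eb_B2 hK AS1 AS2 S1C S2C (chart_card hf aC).
have [F sF eF] := charts_differ_by_symmetry (chart_transport hf1 hh) hf2.
have Fid : forall v, vertex v -> F v = v.
  apply: (symmetry_fix aC sF) => x xC.
  have vx := vertex_of_simplex hPhi aC.1 xC.
  apply: (chart_inj hf2) => //; first exact: symmetry_vertex sF vx.
  rewrite -eF //= e1 // e2 //; apply: fixh S1C S2C _; by apply/imfsetP; exists x.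
apply: (chart_inj hf2) => //; rewrite -{1}(Fid v1 vv1) -eF //= e.
apply: (fixh [fset f2 v2]); last by rewrite inE.
  by rewrite -e -imfset_fset1; apply: chart_simplex hf1 _; exact: simplex_vertex.
by rewrite -imfset_fset1; apply: chart_simplex hf2 _; exact: simplex_vertex.
Qed.

(** The choice is unambiguous by [centered_chart_unique], and by (B1) and (B2) every vertex is in
    the image of a centred chart, so the default is never taken. *)
Definition retraction t : V :=
  xget 0 [set v | vertex v /\ exists S' f', centered_chart S' f' /\ f' v = t].

Lemma retractionK S' f' v : centered_chart S' f' -> vertex v -> retraction (f' v) = v.
Proof.
move=> c vv; rewrite /retraction; case: xgetP => [w _ [vw [S'' [f'' [c' e]]]]|h].
  exact: centered_chart_unique c' c vw vv e.
by case: (h v); split=> //; exists S', f'.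
Qed.

Lemma retraction_folding : folding Phi K retraction.
Proof.
have im S' f' s : centered_chart S' f' -> simplex Sigma s ->
    [fset retraction t | t in [fset f' x | x in s]] = s.
  move=> c sS; rewrite -imfset_comp; apply/fsetP => v.
  apply/imfsetP/idP => [[w /= ws ->]|vs]; first by rewrite (retractionK c) //; exact: vertex_of_simplex ws.
  by exists v; rewrite //= (retractionK c) //; exact: vertex_of_simplex vs.
split=> [s /centered_chart_exists[S' [f' [c S's]]]|s x y /centered_chart_exists[S' [f' [c S's]]]].
  by have [_ hf' _] := c; have [s' s'S ->] := chart_surj hf' S's; rewrite (im S').
have [_ hf' _] := c; have [s' s'S ->] := chart_surj hf' S's.
move=> /imfsetP[v /= vs ->] /imfsetP[w /= ws ->].
rewrite !(retractionK c) ?(chart_len hf' s'S) //; exact: vertex_of_simplex s'S _.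
Qed.

End Centered.

Lemma retraction_exists S f C : A S -> chart Phi K S f -> alcove Phi C -> exists r,
  [/\ folding Phi K r, forall v, vertex v -> r (f v) = v &
    forall s, simplex K s -> exists S' f', [/\ A S', chart Phi K S' f', S' s,
      forall x, x \in C -> f' x = f x & forall v, vertex v -> r (f' v) = v]].
Proof.
move=> AS hf aC; exists (retraction f C); split; first exact: (retraction_folding AS hf aC).
  by move=> v; exact: (retractionK hf aC (centered_self C AS hf)).
move=> s /(centered_chart_exists AS hf aC)[S' [f' [c S's]]]; have [AS' hf' e] := c.
by exists S', f'; split=> // v; exact: (retractionK hf aC c).
Qed.

Lemma folding_chart S f r : A S -> chart Phi K S f -> folding Phi K r -> folding Phi Sigma (r \o f).
Proof.
move=> AS hf [r1 r2]; split=> [s sS|s x y sS xs ys].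
  by have := r1 _ (apartment_simplex AS (chart_simplex hf sS)); rewrite -imfset_comp.
rewrite /= (r2 [fset f x | x in s]) ?(chart_len hf sS) //.
- by apply: apartment_simplex AS _; exact: chart_simplex.
- by apply/imfsetP; exists x.
by apply/imfsetP; exists y.
Qed.

Lemma folding_local r (s : {fset V}) : folding Phi Sigma r -> simplex Sigma s ->
  exists2 G, symmetry Phi G & forall x, x \in s -> r x = G x.
Proof.
move=> fr sS; have [C aC] := alcove_exists.
have [F sF e] := folding_on_alcove hPhi ai fr aC.
have [g hg eg] := folding_simplex hPhi ai fr aC sF e sS.
by exists (F \o g) => //; apply: symmetry_comp sF _; exact: eaw_symmetry hg.
Qed.

Lemma folding_special r v : folding Phi Sigma r -> vertex v ->
  coxeter_special Phi (r v) <-> coxeter_special Phi v.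
Proof.
move=> fr vv; have [G sG ->] := folding_local fr (simplex_vertex hPhi vv); last by rewrite inE.
exact: symmetry_specialE.
Qed.

Lemma vertex_apartment t : exists S, A S /\ S [fset t].
Proof. by have [S AS St] := eb_union hK (pe_vertex (eb_complex hK) t); exists S. Qed.

Lemma special_vertex_folding r t : folding Phi K r ->
  special_vertex Phi K A t <-> coxeter_special Phi (r t).
Proof.
move=> fr; split=> [[S [f [v [AS hf sv ->]]]]|h].
  by apply/(folding_special (folding_chart AS hf fr) sv.1).
have [S [AS St]] := vertex_apartment t; have [f hf] := eb_B0 hK AS.
have [v vv ev'] := chart_point hf St; exists S, f, v; split=> //.
by apply/(folding_special (folding_chart AS hf fr) vv); rewrite /= ev'.
Qed.

Lemma special_vertex_chart S f v : A S -> chart Phi K S f -> vertex v ->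
  special_vertex Phi K A (f v) <-> coxeter_special Phi v.
Proof.
move=> AS hf vv; have [C aC] := alcove_exists.
have [r [fr rf _]] := retraction_exists AS hf aC.
by rewrite (special_vertex_folding _ fr) rf.
Qed.

End Charts.

Lemma fset_card_le2 (T : choiceType) (s : {fset T}) : s != fset0 -> (#|` s| <= 2)%N ->
  exists u v, s = [fset u; v].
Proof.
move=> /fset0Pn[u us] cs; exists u.
have [e|/fset0Pn[v vs]] := eqVneq (s `\ u) fset0.
  by exists u; rewrite fsetUid -(fsetD1K us) e fsetU0.
exists v; rewrite -(fsetD1K us) -(fsetD1K vs); congr (u |` _).
suff -> : s `\ u `\ v = fset0 by rewrite fsetU0.
apply: cardfs0_eq; move: cs; rewrite (cardfsD1 u s) us (cardfsD1 v (s `\ u)) vs.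
by rewrite !add1n !ltnS leqn0 => /eqP.
Qed.

(** * Geometric realization and geodesics *)

Section Metric.
Variables (R : realType) (n : nat) (Phi : {fset 'rV[R]_n}).
Hypothesis hPhi : root_system Phi.
Local Notation V := 'rV[R]_n.
Local Notation cf := (closed_facet Phi).
Local Notation Sigma := (coxeter_complex Phi).
Local Notation vset := (vset hPhi).
Local Notation bary := (bary hPhi).
Local Notation vertex := (coxeter_vertex Phi).
Local Notation cqs := (coxeter_quasi_special Phi).
Implicit Types (p q a d : V).
Variables (T : choiceType) (K : complex R T) (A : set (set {fset T})).
Hypothesis hK : euclidean_building Phi K A.
Implicit Types (S : set {fset T}) (f : V -> T) (C D : {fset V}) (r : T -> V) (b c : T -> R).
Hypothesis ai : forall s : {fset V}, simplex Sigma s -> affinely_independent s id.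

(** The chart extended from vertices to points: barycentric coordinates are pushed forward along
    [f]. *)
Definition emb f p : T -> R := fun t => \sum_(v <- vset p) bary p v * (f v == t)%:R.

Lemma emb_vertex S f p v : chart Phi K S f -> vertex v -> emb f p (f v) = bary p v.
Proof.
move=> hf vv; have z w : w \in vset p -> w != v -> bary p w * (f w == f v)%:R = 0.
  move=> wp wv; have [e|] := eqVneq (f w) (f v); last by rewrite mulr0.
  by case/eqP: wv; apply: (chart_inj hPhi hf) e => //; case/in_vset: wp.
rewrite /emb; have [vp|vp] := boolP (v \in vset p).
  rewrite (big_fsetD1 v) //= eqxx mulr1 big1_fset ?addr0 // => w.
  by rewrite in_fsetD1 => /andP[wv wp] _; exact: z.
rewrite big1_fset => [|w wp _]; last by apply: z => //; apply: contraNneq vp => <-.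
by case: (bary_in hPhi p) => _ -> .
Qed.

Lemma emb_out f p t : t \notin [fset f v | v in vset p] -> emb f p t = 0.
Proof.
move=> tp; rewrite /emb big1_fset // => w wp _; have [e|] := eqVneq (f w) t; last by rewrite mulr0.
by case/negP: tp; rewrite -e; apply/imfsetP; exists w.
Qed.

Lemma emb_in S f p w : chart Phi K S f -> cf w p ->
  in_simplex [fset f v | v in vset w] (emb f p).
Proof.
move=> hf wp; have sub := vset_sub wp (hPhi := hPhi); split=> [t|t tw|].
- rewrite /emb sumr_ge0 // => v _; rewrite mulr_ge0 ?ler0n //.
  by case: (bary_in hPhi p) => h _ _; exact: h.
- apply: emb_out; apply: contra tw => /imfsetP[v /= vp ->].
  by apply/imfsetP; exists v => //; exact: sub.
rewrite big_imfset /=; last exact: (chart_inj_in hPhi hf (simplex_vset hPhi w)).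
have [_ _ <-] := in_simplex_incl sub (bary_in hPhi p).
apply: eq_big_seq => v vw; apply: (emb_vertex _ hf).
by case/in_vset: vw.
Qed.

Lemma bary_vertex v : vertex v -> bary v v = 1.
Proof.
by move=> vv; case: (bary_in hPhi v) => _ _; rewrite vset_vertex // big_seq_fset1.
Qed.

Lemma emb_vertex_point f v : vertex v -> emb f v = vertex_point R (f v).
Proof.
move=> vv; apply: funext => t; rewrite /emb vset_vertex // big_seq_fset1.
by rewrite bary_vertex // mul1r /vertex_point eq_sym.
Qed.

Lemma in_vset_emb S f p v : chart Phi K S f -> vertex v -> (v \in vset p) = (emb f p (f v) != 0).
Proof. by move=> hf vv; rewrite (emb_vertex _ hf vv) in_vset_bary. Qed.

Lemma emb_eq_vertex_point S f p t : chart Phi K S f -> emb f p = vertex_point R t ->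
  vertex p /\ f p = t.
Proof.
move=> hf e; have ft v : v \in vset p -> f v = t.
  move=> vp; have vv := ((in_vset hPhi p v).1 vp).1.
  move: vp; rewrite (in_vset_emb _ hf vv) e /vertex_point.
  by case: (f v =P t) => // _; rewrite eqxx.
have [v vp] : exists v, v \in vset p by apply/fset0Pn; exact: vset_neq0.
have ev' : vset p = [fset v].
  apply/fsetP => w; rewrite inE; apply/idP/eqP => [wp|->//].
  by apply: (chart_inj_in hPhi hf (simplex_vset hPhi p) wp vp); rewrite !ft.
have -> : p = v.
  have [_ _] := bary_in hPhi p; have := bary_comb hPhi p.
  by rewrite ev' !big_seq_fset1 => e1 e2; rewrite -[LHS]e1 e2 scale1r.
by split; [case/in_vset: vp|exact: ft].
Qed.

Lemma emb_point S f (s : {fset V}) b : chart Phi K S f -> simplex Sigma s ->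
  in_simplex [fset f v | v in s] b ->
  b = emb f (\sum_(v <- s) b (f v) *: v) /\ {subset vset (\sum_(v <- s) b (f v) *: v) <= s}.
Proof.
move=> hf sS [b0 bs b1]; set p := \sum_(v <- s) _.
have finj := chart_inj_in hPhi hf sS.
pose c v := if v \in s then b (f v) else 0.
have cs : in_simplex s c.
  split=> [v|v /negbTE vs|]; rewrite /c; first by case: ifP.
    by rewrite vs.
  rewrite -b1 big_imfset //=; apply: eq_big_seq => v ->//.
have ep : p = \sum_(v <- s) c v *: v by apply: eq_big_seq => v vs; rewrite /c vs.
have ec : c = bary p by rewrite ep; exact: bary_uniq.
have sub : {subset vset p <= s}.
  move=> v; rewrite in_vset_bary // -ec /c; case: ifP => //; by rewrite eqxx.
split=> //; apply: funext => t; have [/imfsetP[v /= vs ->]|ts] := boolP (t \in [fset f v | v in s]).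
  rewrite (emb_vertex _ hf) -?ec ?/c ?vs //; exact: vertex_of_simplex vs.
rewrite bs // emb_out //; apply: contra ts => /imfsetP[v /= /sub vs ->].
by apply/imfsetP; exists v.
Qed.

(** The affine extension of [r] to the geometric realization; by [projE] any simplex carrying [b]
    gives the same value. *)
Definition proj r b : V := \sum_(x <- xget fset0 [set s | in_simplex s b]) b x *: r x.

Lemma projE r b (s : {fset T}) : in_simplex s b -> proj r b = \sum_(x <- s) b x *: r x.
Proof.
move=> sb; rewrite /proj; case: xgetP => [s' _ s'b|/(_ s)//].
rewrite -(comb_incl r (s' := s `|` s') _ sb) => [|x xs]; last by rewrite inE xs.
by rewrite -(comb_incl r (s' := s `|` s') _ s'b) => [//|x xs]; rewrite inE xs orbT.
Qed.

Lemma simplex_dist_proj r (s : {fset T}) b c : folding Phi K r -> simplex K s ->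
  in_simplex s b -> in_simplex s c -> simplex_dist K s b c = edist (proj r b) (proj r c).
Proof.
move=> [_ hr] sK bs cs; rewrite (projE _ bs) (projE _ cs) /edist.
have -> : \sum_(x <- s) b x *: r x - \sum_(x <- s) c x *: r x = \sum_(x <- s) (b x - c x) *: r x.
  by rewrite -sumrB; apply: eq_bigr => x _; rewrite scalerBl.
rewrite polarization; last first.
  by rewrite sumrB; case: bs cs => _ _ -> [_ _ ->]; rewrite subrr.
congr (Num.sqrt (- _ / 2)); apply: eq_big_seq => x xs; apply: eq_big_seq => y ys.
by rewrite (hr s).
Qed.

Lemma string_length_proj r b l c : folding Phi K r -> is_string K b l c ->
  edist (proj r b) (proj r c) <= string_length K b l.
Proof.
move=> fr; elim: l b => [b ->|[s b'] l IH b /= [sK bs b's h]]; first by rewrite edistxx.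
rewrite (simplex_dist_proj fr sK bs b's).
by apply: (le_trans (edist_triangle _ (proj r b') _)); rewrite lerD2l IH.
Qed.

Lemma dist_ge_proj r b l c : folding Phi K r -> is_string K b l c ->
  edist (proj r b) (proj r c) <= dist K b c.
Proof.
move=> fr h; apply: lb_le_inf; first by exists (string_length K b l); exists l.
by move=> _ [l' /= h' <-]; exact: string_length_proj.
Qed.

Lemma string_length_ge0 b l : 0 <= string_length K b l.
Proof. by elim: l b => //= -[s b'] l IH b; rewrite addr_ge0 // sqrtr_ge0. Qed.

Lemma dist_le_string b l c : is_string K b l c -> dist K b c <= string_length K b l.
Proof.
move=> h; apply: ge_inf; last by exists l.
by exists 0 => _ [l' _ <-]; exact: string_length_ge0.
Qed.

Lemma string_cat b l c l' (d : T -> R) : is_string K b l c -> is_string K c l' d ->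
  is_string K b (l ++ l') d /\
  string_length K b (l ++ l') = string_length K b l + string_length K c l'.
Proof.
elim: l b => [b /= -> h|[s b'] l IH b /= [sK bs b's h] h']; first by rewrite add0r.
have [h1 h2] := IH b' h h'; split; first by split.
by rewrite h2 addrA.
Qed.

Lemma edist_line p d (t t' : R) :
  edist (p + t *: d) (p + t' *: d) = `|t - t'| * Num.sqrt (dot d d).
Proof.
rewrite /edist opprD addrACA subrr add0r -scalerBl !dotl mulrA -expr2.
by rewrite sqrtrM ?sqr_ge0 // sqrtr_sqr.
Qed.

Section In_apartment.
Variables (S : set {fset T}) (f : V -> T).
Hypothesis AS : A S.
Hypothesis hf : chart Phi K S f.

Lemma proj_emb r p : (forall v, vertex v -> r (f v) = v) -> proj r (emb f p) = p.
Proof.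
move=> rf; rewrite (projE _ (emb_in hf (@cf_refl _ _ Phi p))) big_imfset /=; last first.
  exact: (chart_inj_in hPhi hf (simplex_vset hPhi p)).
rewrite -[RHS](bary_comb hPhi); apply: eq_big_seq => v /in_vset[vv _].
by rewrite (emb_vertex _ hf vv) rf.
Qed.

(** A continuity argument: [good] spreads inside each closed facet. Local finiteness, applied
    backwards at the supremum [s] of the good parameters, shows that [s] is good; applied forwards,
    that [s] is not below 1. *)
Lemma straight_string p q : exists2 l, is_string K (emb f p) l (emb f q) &
  string_length K (emb f p) l = edist p q.
Proof.
have [C aC] := alcove_exists hPhi ai.
have [r [fr rf _]] := retraction_exists hPhi hK ai AS hf aC.
pose d := q - p; pose z (t : R) := p + t *: d; pose L := edist p q.
have zL (t t' : R) : edist (z t) (z t') = `|t - t'| * L.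
  by rewrite edist_line /L edistC.
pose good t := exists2 l, is_string K (emb f p) l (emb f (z t)) &
  string_length K (emb f p) l = t * L.
have step (t t' : R) w : t <= t' -> good t -> cf w (z t) -> cf w (z t') -> good t'.
  move=> tt [l hl el] wt wt'.
  have st := emb_in hf wt; have st' := emb_in hf wt'.
  have sK : simplex K [fset f v | v in vset w].
    by apply: (apartment_simplex hK AS); apply: chart_simplex hf _; exact: simplex_vset.
  have [h1 h2] := string_cat hl (And4 sK st st' (erefl (emb f (z t'))) :
    is_string K (emb f (z t)) [:: ([fset f v | v in vset w], emb f (z t'))] (emb f (z t'))).
  exists (l ++ [:: ([fset f v | v in vset w], emb f (z t'))]) => //.
  rewrite h2 el /= addr0 (simplex_dist_proj fr sK st st') !proj_emb // zL.
  by rewrite distrC ger0_norm ?subr_ge0 // mulrBl addrC subrK.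
have good0 : good 0.
  by exists [::]; rewrite /= ?mul0r // /z scale0r addr0.
pose G := [set t : R | 0 <= t <= 1 /\ good t].
have G0 : G 0 by split; rewrite ?lexx ?ler01.
have Gub : has_ubound G by exists 1 => t [/andP[]].
have Gsup : has_sup G by split=> //; exists 0.
pose s := sup G.
have s0 : 0 <= s by apply: (ub_le_sup Gub).
have s1 : s <= 1 by apply: ge_sup; [exists 0|move=> t [/andP[]]].
have gs : good s.
  have [e e0 he] := near_cf Phi (z s) (- d).
  have [g [/andP[g0 g1] gg] ge] := sup_adherent e0 Gsup.
  have gs : g <= s by apply: (ub_le_sup Gub); split; rewrite ?g0.
  apply: (step g s (z g) gs gg) => //.
  have -> : z g = z s + (s - g) *: (- d).
    by rewrite /z; apply/rowP => i; rewrite !mxE; lra.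
  by apply: he; rewrite subr_ge0 gs lerBlDr -lerBlDl ltW.
have s1' : s = 1.
  apply/eqP; rewrite eq_le s1 leNgt; apply/negP => s_lt1.
  have [e e0 he] := near_cf Phi (z s) d.
  pose u := Num.min e (1 - s); have u0 : 0 < u by rewrite lt_min e0 subr_gt0.
  have ue : u <= e by rewrite ge_min lexx.
  have us : u <= 1 - s by rewrite ge_min lexx orbT.
  have : s + u <= s.
    apply: (ub_le_sup Gub); split.
      by rewrite addr_ge0 ?(ltW u0) //=; lra.
    apply: (step s (s + u) (z (s + u))) => //; first by rewrite lerDl ltW.
    have -> : z (s + u) = z s + u *: d by rewrite /z scalerDl addrA.
    by apply: he; rewrite ue ltW.
  by rewrite gerDl leNgt u0.
have [l hl el] := gs; exists l; last by rewrite el s1' mul1r.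
by have -> : q = z s by rewrite s1' /z scale1r /d addrC subrK.
Qed.

(** The straight string bounds the distance from above, and the projection of strings by a
    retraction bounds it from below. *)
Lemma dist_emb p q : dist K (emb f p) (emb f q) = edist p q.
Proof.
have [C aC] := alcove_exists hPhi ai.
have [r [fr rf _]] := retraction_exists hPhi hK ai AS hf aC.
have [l hl el] := straight_string p q.
apply/eqP; rewrite eq_le -{1}el dist_le_string //=.
by have := dist_ge_proj fr hl; rewrite !proj_emb.
Qed.

End In_apartment.

(** Ensures that the infimum in [dist] is over a nonempty set, as [dist_ge_proj] requires. *)
Lemma string_exists (s s' : {fset T}) b c : simplex K s -> simplex K s' ->
  in_simplex s b -> in_simplex s' c -> exists l, is_string K b l c.
Proof.
move=> sK s'K; have [S [AS Ss Ss']] := eb_B1 hK sK s'K; have [f hf] := eb_B0 hK AS.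
have [s0 s0S ->] := chart_surj hf Ss; have [s0' s0'S ->] := chart_surj hf Ss'.
move=> /(emb_point hf s0S)[-> _] /(emb_point hf s0'S)[-> _].
by have [l hl _] := straight_string AS hf (\sum_(v <- s0) b (f v) *: v)
  (\sum_(v <- s0') c (f v) *: v); exists l.
Qed.

(* Uniqueness of geodesics: a retraction centred at an alcove through the
   point z of the straight segment does not increase distances, so it sends g t
   to z, and z has no other preimage. *)
Lemma geodesic_in_apartment S f p q (L : R) (g : R -> T -> R) : A S -> chart Phi K S f ->
  vertex p -> vertex q -> 0 < L -> line_segment K (f p) (f q) L g ->
  L = edist p q /\ forall t, 0 <= t <= L -> g t = emb f (p + (t / L) *: (q - p)).
Proof.
move=> AS hf vp vq L0 [_ g0 gL gs gd].
have eL : L = edist p q.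
  have := gd 0 L; rewrite g0 gL -!emb_vertex_point // (dist_emb AS hf) lexx (ltW L0) lexx.
  by move=> -> //; rewrite sub0r normrN gtr0_norm.
split=> // t tL; set z := _ + _.
have [C aC zC] := simplex_sub_alcove hPhi ai (simplex_vset hPhi z).
have [r [fr rf rc]] := retraction_exists hPhi hK ai AS hf aC.
have [s sK sg] := gs t tL.
have [S' [f' [AS' hf' S's ef' rf']]] := rc s sK.
have [s0 s0S es] := chart_surj hf' S's; rewrite es in sg.
have [eg _] := emb_point hf' s0S sg; move: eg; set p' := \sum_(v <- s0) _ => eg.
have pr : proj r (g t) = p' by rewrite eg (proj_emb hf').
have sgt : in_simplex s (g t) by rewrite es.
have L00 : (0 : R) <= 0 <= L by rewrite lexx ltW.
have LLL : (0 : R) <= L <= L by rewrite lexx ltW.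
have [t0 t1] := andP tL.
have ge0 v : vertex v -> in_simplex [fset f v] (emb f v).
  move=> vv; have := emb_in hf (@cf_refl _ _ Phi v).
  by rewrite (vset_vertex hPhi vv) imfset_fset1.
have vK v : simplex K [fset f v] by exact: (pe_vertex (eb_complex hK)).
have h1 : edist p p' <= t.
  have [l hl] := string_exists (vK p) sK (ge0 p vp) sgt.
  have := dist_ge_proj fr hl; rewrite (proj_emb hf) // pr emb_vertex_point // -g0 gd //.
  by rewrite sub0r normrN ger0_norm.
have h2 : edist p' q <= L - t.
  have [l hl] := string_exists sK (vK q) sgt (ge0 q vq).
  have := dist_ge_proj fr hl; rewrite (proj_emb hf) // pr emb_vertex_point // -gL gd //.
  by rewrite distrC ger0_norm // subr_ge0.
have ez : p' = z.
  by rewrite /z eL in tL h2 L0 *; exact: edist_between.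
rewrite eg ez; apply: funext => y; apply: eq_big_seq => v /zC vC.
by rewrite ef'.
Qed.

End Metric.

(** * Orderings of the building *)

Section Building_orderings.
Variables (R : realType) (n : nat) (Phi : {fset 'rV[R]_n}).
Hypothesis hPhi : root_system Phi.
Local Notation V := 'rV[R]_n.
Local Notation cf := (closed_facet Phi).
Local Notation Sigma := (coxeter_complex Phi).
Local Notation vset := (vset hPhi).
Local Notation bary := (bary hPhi).
Local Notation emb := (emb hPhi).
Local Notation vertex := (coxeter_vertex Phi).
Local Notation cqs := (coxeter_quasi_special Phi).
Implicit Types (p q a d : V).
Variables (T : choiceType) (K : complex R T) (A : set (set {fset T})).
Hypothesis hK : euclidean_building Phi K A.
Local Notation qs := (quasi_special Phi K A).
Implicit Types (u v t x y : T) (S : set {fset T}) (f : V -> T) (C D : {fset V}) (r : T -> V).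
Hypothesis ai : forall s : {fset V}, simplex Sigma s -> affinely_independent s id.

Lemma edge_vertices p q : edge Sigma p q -> vertex p /\ vertex q.
Proof.
by move=> [_ s]; split; apply: (vertex_of_simplex hPhi s); rewrite !inE eqxx ?orbT.
Qed.

(** The apartment is chosen through the special end points of the segment; [geodesic_in_apartment]
    then places the whole segment, and with it the edge, in the chart. *)
Lemma qs_chart u v : qs u v -> exists S f p q,
  [/\ A S, chart Phi K S f, u = f p, v = f q & cqs p q].
Proof.
move=> [[uv suv] [x [y [L [g [spx spy seg gsk huv]]]]]].
have [L0 g0 gL _ _] := seg.
have [S [AS Sx Sy]] := eb_B1 hK (pe_vertex (eb_complex hK) x) (pe_vertex (eb_complex hK) y).
have [f hf] := eb_B0 hK AS.
have [x' vx ex] := chart_point hPhi hf Sx; have [y' vy ey] := chart_point hPhi hf Sy.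
have vu : in_simplex [fset u; v] (vertex_point R u).
  split=> [t|t|]; first exact: ler0n.
    by rewrite /vertex_point !inE negb_or => /andP[/negbTE->].
  by rewrite big_fset2 // /vertex_point eqxx eq_sym (negbTE uv) addr0.
have vv : in_simplex [fset u; v] (vertex_point R v).
  split=> [t|t|]; first exact: ler0n.
    by rewrite /vertex_point !inE negb_or => /andP[_ /negbTE->].
  by rewrite big_fset2 // /vertex_point eqxx (negbTE uv) add0r.
have [t1 t1L e1] := huv _ vu; have [t2 t2L e2] := huv _ vv.
have Lp : 0 < L.
  rewrite lt_neqAle L0 andbT; apply/eqP => L00.
  have z (t : R) : 0 <= t <= L -> t = 0 by rewrite -L00 => h; apply/eqP; rewrite eq_le andbC.
  have : vertex_point R u u = vertex_point R v u by rewrite -e1 -e2 (z _ t1L) (z _ t2L).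
  by rewrite /vertex_point eqxx (negbTE uv) => /eqP; rewrite oner_eq0.
have := seg; rewrite -ex -ey => seg'.
have [eL eg] := geodesic_in_apartment hPhi hK ai AS hf vx vy Lp seg'.
rewrite eg // in e1; rewrite eg // in e2.
have [vp fp] := emb_eq_vertex_point ai hf e1.
have [vq fq] := emb_eq_vertex_point ai hf e2.
set p := x' + (t1 / L) *: (y' - x') in vp fp e1 *.
set q := x' + (t2 / L) *: (y' - x') in vq fq e2 *.
exists S, f, p, q; split=> //.
have pq : p != q by apply: contraNneq uv => e; rewrite -fp -fq e.
have spq : simplex Sigma [fset p; q].
  (* The midpoint of [[u, v]] is on the geodesic too, and its carrier in the chart shows that [p]
     and [q] span a simplex. *)
  pose b t : R := if (t == u) || (t == v) then 2^-1 else 0.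
  have bu : b u = 2^-1 by rewrite /b eqxx.
  have bv : b v = 2^-1 by rewrite /b eqxx orbT.
  have hb : in_simplex [fset u; v] b.
    split=> [t|t|]; first by rewrite /b; case: ifP => // _; rewrite invr_ge0.
      by rewrite /b !inE => /negbTE->.
    by rewrite big_fset2 // bu bv; lra.
  have [t3 t3L e3] := huv _ hb; rewrite eg // in e3.
  set m := x' + (t3 / L) *: (y' - x') in e3.
  have mem w : vertex w -> (w \in vset m) = (f w == u) || (f w == v).
    move=> vw; rewrite (in_vset_emb hPhi ai m hf vw) e3 /b.
    by case: ifP; rewrite ?eqxx // invr_eq0 pnatr_eq0.
  suff -> : [fset p; q] = vset m by exact: simplex_vset.
  apply/fsetP => w; rewrite !inE; apply/orP/idP => [[]/eqP->|wm].
  - by rewrite mem // fp eqxx.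
  - by rewrite mem // fq eqxx orbT.
  have vw := ((in_vset hPhi m w).1 wm).1; move: wm; rewrite mem // -fp -fq.
  by case/orP => /eqP/(chart_inj hPhi hf vw) e; [left|right]; apply/eqP; exact: e.
split=> //; exists x', y'.
have inL (t : R) : 0 <= t <= L -> 0 <= t / L <= 1.
  move=> /andP[h0 h1]; rewrite divr_ge0 ?(ltW Lp) //=.
  by rewrite ler_pdivrMr // mul1r.
split; last first.
  move=> _ [s /= /andP[s0 s1] <-].
  have /andP[a0 a1] := inL _ t1L; have /andP[b0 b1] := inL _ t2L.
  exists ((1 - s) * (t1 / L) + s * (t2 / L)) => /=.
    have s1' : 0 <= 1 - s by rewrite subr_ge0.
    have c1 := mulr_ge0 s1' a0; have c2 := mulr_ge0 s0 b0.
    have c3 := ler_wpM2l s1' a1; have c4 := ler_wpM2l s0 b1.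
    by apply/andP; split; [exact: addr_ge0|lra].
  by rewrite /p /q; apply/rowP => i; rewrite !mxE; lra.
split.
- by apply/(special_vertex_chart hPhi hK ai AS hf vx); rewrite ex.
- by apply/(special_vertex_chart hPhi hK ai AS hf vy); rewrite ey.
move=> _ [s /= /andP[s0 s1] <-]; set z := _ + _.
have sL : 0 <= s * L <= L.
  by rewrite mulr_ge0 //= ler_piMl.
have ez : x' + (s * L / L) *: (y' - x') = z by rewrite mulfK // gt_eqF.
have [s2 [s2K c2 ins2]] := gsk _ sL; rewrite eg // ez in ins2.
(* The carrier of [z] is mapped injectively into a simplex of [K] with at most two vertices. *)
have [u1 [u2 e12]] : exists u1 u2 : V, vset z = [fset u1; u2].
  apply: fset_card_le2; first exact: vset_neq0.
  have sub : ([fset f w | w in vset z] `<=` s2)%fset.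
    apply/fsubsetP => _ /imfsetP[w /= wz ->]; have vw := ((in_vset hPhi z w).1 wz).1.
    move: wz; rewrite (in_vset_emb hPhi ai z hf vw); apply: contraR => ws.
    by case: ins2 => _ h _; rewrite h.
  have := fsubset_leq_card sub; rewrite card_in_imfset /=.
    by move=> h; exact: leq_trans h c2.
  exact: (chart_inj_in hPhi hf (simplex_vset hPhi z)).
exact: vset_pair_1skeleton e12.
Qed.

Lemma cqs_chart S f p q : A S -> chart Phi K S f -> cqs p q -> qs (f p) (f q).
Proof.
move=> AS hf [epq [x [y [sxy pqxy]]]]; have [pq spq] := epq.
have [vp vq] := edge_vertices epq.
have fpq : f p != f q by apply: contraNneq pq => /(chart_inj hPhi hf vp vq) ->.
split; first by split=> //; rewrite -imfset_fset2; apply: (apartment_simplex hK AS); exact: chart_simplex hf spq.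
have [sx sy sk] := sxy.
have xy : x != y.
  apply: contraNneq pq => exy; have := pqxy _ (segment_left p q); have := pqxy _ (segment_right p q).
  by rewrite exy => -[s _ <-] [s' _ <-]; rewrite subrr !scaler0.
pose L := edist x y; have L0 : 0 < L.
  by rewrite lt_neqAle edist_ge0 andbT eq_sym; apply: contraNneq xy => /edist_eq0 ->.
pose z (t : R) := x + (t / L) *: (y - x).
have inL (t : R) : 0 <= t <= L -> segment x y (z t).
  move=> /andP[h0 h1]; exists (t / L) => //=.
  by rewrite divr_ge0 ?(ltW L0) //= ler_pdivrMr // mul1r.
exists (f x), (f y), L, (fun t : R => emb f (z t)); split.
- by exists S, f, x.
- by exists S, f, y.
- split.
  + exact: ltW.
  + by rewrite /z mul0r scale0r addr0; exact: (emb_vertex_point hPhi f sx.1).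
  + by rewrite /z divff ?gt_eqF // scale1r addrC subrK; exact: (emb_vertex_point hPhi f sy.1).
  + move=> t _; exists [fset f v | v in vset (z t)]; last exact: (emb_in hPhi hf (@cf_refl _ _ Phi (z t))).
    by apply: (apartment_simplex hK AS); apply: chart_simplex hf _; exact: simplex_vset.
  move=> t t' _ _; rewrite (dist_emb hPhi hK ai AS hf) edist_line -mulrBl normrM.
  have -> : Num.sqrt (dot (y - x) (y - x)) = L by rewrite /L edistC.
  by rewrite normfV (gtr0_norm L0) divfK // gt_eqF.
- move=> t tL; have [u [v [suv uvz]]] := sk _ (inL t tL).
  exists [fset f u; f v]; split.
  + rewrite -imfset_fset2; apply: (apartment_simplex hK AS); exact: chart_simplex hf suv.
  + by rewrite cardfs2; case: (_ != _).
  apply: in_simplex_incl (emb_in hPhi hf (@cf_refl _ _ Phi (z t))) => _ /imfsetP[w /= wz ->].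
  by rewrite -imfset_fset2; apply/imfsetP; exists w => //; exact: vset_segment suv uvz _ wz.
move=> b; rewrite -imfset_fset2 => hb.
have [eb _] := emb_point hPhi ai hf spq hb; move: eb; rewrite big_fset2 //= => eb.
have [b0 _] := hb; rewrite imfset_fset2 big_fset2 // => b1.
have [s /= /andP[s0 s1] es] : segment x y (b (f p) *: p + b (f q) *: q).
  apply: pqxy; exists (b (f q)) => /=; first by have := b0 (f p); have := b0 (f q); move=> -> /=; lra.
  have -> : b (f p) = 1 - b (f q) by lra.
  by apply/rowP => i; rewrite !mxE; lra.
exists (s * L); first by rewrite mulr_ge0 ?(ltW L0) //= ler_piMl // ltW.
by rewrite eb /z mulfK ?gt_eqF // es.
Qed.

(** On each simplex a folding acts in a chart as a symmetry, so an edge is tested by its image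
    alone, whatever apartment contains it. *)
Lemma qs_folding r u v : folding Phi K r -> qs u v <-> edge K u v /\ cqs (r u) (r v).
Proof.
move=> fr; split=> [huv|[[uv suv] h]].
  split; first by case: huv.
  have [S [f [p [q [AS hf -> -> hpq]]]]] := qs_chart huv.
  have [G sG e] := folding_local hPhi ai (folding_chart hK AS hf fr) hpq.1.2.
  rewrite -[r (f p)]/((r \o f) p) -[r (f q)]/((r \o f) q) !e ?inE ?eqxx ?orbT //.
  exact: symmetry_cqs.
have [S AS Suv] := eb_union hK suv; have [f hf] := eb_B0 hK AS.
have [p [q [eu ev' spq]]] := chart_pair hPhi hf Suv.
have [G sG e] := folding_local hPhi ai (folding_chart hK AS hf fr) spq.
rewrite eu ev'; apply: (cqs_chart AS hf).
move: h; rewrite eu ev' -[r (f p)]/((r \o f) p) -[r (f q)]/((r \o f) q) !e ?inE ?eqxx ?orbT //.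
by rewrite symmetry_cqsE.
Qed.

Lemma ordering_ext (tau tau' : V -> V -> nat) : coxeter_ordering Phi tau ->
  (forall p q, cqs p q -> tau' p q = tau p q) -> coxeter_ordering Phi tau'.
Proof.
move=> [h1 h2 h3 h4] e; split.
- by move=> p q hpq; rewrite e //; exact: h1.
- move=> C p sC cC pC sp; have aC : alcove Phi C by [].
  have e' q : q \in C `\ p -> tau' p q = tau p q.
    by move=> /fsetD1P[qp qC]; apply: e; exact: special_edge_cqs aC sp pC qC qp.
  have [g1 g2 g3] := (set_bij_fsetP _ _ _).1 (h2 C p sC cC pC sp).
  apply/set_bij_fsetP; split=> [q qC|q q' qC q'C|k /g3[q qC <-]].
  + by rewrite e' // g1.
  + by rewrite !e' //; exact: g2.
  by exists q => //; exact: e'.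
- move=> g p q hg hpq; rewrite !e //; first exact: h3.
  exact: symmetry_cqs (eaw_symmetry hPhi hg) hpq.
move=> x y p q p' q' sxy d1 d2.
have go p1 q1 : directed_edge_on Phi p1 q1 x y -> cqs p1 q1.
  move=> [ed [a [b [a0 ab b1 ep eq]]]]; split=> //; exists x, y; split=> //.
  move=> _ [s /= /andP[s0 s1] <-]; exists (a + s * (b - a)) => /=.
    have ba : 0 <= b - a by rewrite subr_ge0 ltW.
    have := mulr_ge0 s0 ba; have := ler_wpM2r ba s1; rewrite mul1r => h5 h6.
    by apply/andP; split; lra.
  by rewrite ep eq; apply/rowP => i; rewrite !mxE; lra.
by rewrite !e ?(h4 _ _ _ _ _ _ sxy d1 d2); auto.
Qed.

Definition pullback (tau0 : V -> V -> nat) r u v : nat :=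
  if `[< qs u v >] then tau0 (r u) (r v) else 0%N.

Lemma pullbackE tau0 r u v : qs u v -> pullback tau0 r u v = tau0 (r u) (r v).
Proof. by move=> h; rewrite /pullback asboolT. Qed.

Lemma pullback_ordering tau0 r : coxeter_ordering Phi tau0 -> folding Phi K r ->
  building_ordering Phi K A (pullback tau0 r).
Proof.
move=> ht fr; split.
- move=> u v huv; rewrite pullbackE //; apply: (co_range ht).
  by case: ((qs_folding u v fr).1 huv).
- by move=> u v huv; rewrite /pullback asboolF.
move=> S AS; have [f hf] := eb_B0 hK AS; exists f => //.
have frf := folding_chart hK AS hf fr; have [C aC] := alcove_exists hPhi ai.
have [F sF e] := folding_on_alcove hPhi ai frf aC.
apply: (ordering_ext (ordering_symmetry hPhi sF ht)) => p q hpq.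
rewrite pullbackE; last exact: cqs_chart AS hf hpq.
have [g hg eg] := folding_simplex hPhi ai frf aC sF e hpq.1.2.
rewrite -[r (f p)]/((r \o f) p) -[r (f q)]/((r \o f) q) !eg ?inE ?eqxx ?orbT //.
(* The group element [g] depends on the edge and is absorbed by invariance, whereas [F] is the same
   for all edges. *)
exact: (co_invariant (ordering_symmetry hPhi sF ht) hg hpq).
Qed.

(** [bo_apartment] provides one chart for each apartment; any other differs from it by a symmetry,
    and symmetries preserve orderings. *)
Lemma building_ordering_chart tau S f : building_ordering Phi K A tau -> A S -> chart Phi K S f ->
  coxeter_ordering Phi (fun p q => tau (f p) (f q)).
Proof.
move=> ht AS hf; have [f0 hf0 h0] := bo_apartment ht AS.
have [F sF e] := charts_differ_by_symmetry hPhi ai hf hf0.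
apply: (ordering_ext (ordering_symmetry hPhi sF h0)) => p q hpq.
by have [vp vq] := edge_vertices hpq.1; rewrite !e.
Qed.

(** The origin is special, and a gallery carries an alcove containing it to [C]. *)
Lemma alcove_special C : alcove Phi C -> exists2 p, p \in C & coxeter_special Phi p.
Proof.
move=> aC.
have s0 : coxeter_special Phi (0 : V).
  by apply/(specialP hPhi) => a _; rewrite dot0l rpred0.
have [D aD sD] := simplex_sub_alcove hPhi ai (simplex_vertex hPhi s0.1).
have [l hl ->] := alcove_gallery hPhi ai aD aC.
exists (ev l 0); last exact: symmetry_special (ev_symmetry hPhi hl) s0.
by apply/imfsetP; exists 0 => //; apply: sD; rewrite inE.
Qed.

Section From_alcove.
Variables (C : {fset T}) (x : T).
Hypothesis KC : simplex K C.
Hypothesis cC : #|` C| = n.+1.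
Hypothesis xC : x \in C.
Hypothesis sx : special_vertex Phi K A x.

Lemma chart_through s : simplex K s -> exists S f D p, [/\ A S, chart Phi K S f, S s, S C &
  [/\ alcove Phi D, C = [fset f q | q in D], p \in D, coxeter_special Phi p & x = f p]].
Proof.
move=> sK; have [S [AS SC Ss]] := eb_B1 hK KC sK; have [f hf] := eb_B0 hK AS.
have [D aD eC] := chart_alcove hPhi hf SC cC.
have : x \in [fset f q | q in D] by rewrite -eC.
move=> /imfsetP[p /= pD ex].
exists S, f, D, p; split=> //; split=> //.
apply/(special_vertex_chart hPhi hK ai AS hf (vertex_of_simplex hPhi aD.1 pD)).
by rewrite -ex.
Qed.

(** By (B1) every quasi-special edge shares an apartment with [C], and there [ordering_unique]
    applies. *)
Lemma building_ordering_unique tau tau' : building_ordering Phi K A tau ->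
  building_ordering Phi K A tau' -> (forall y, y \in C `\ x -> tau x y = tau' x y) -> tau = tau'.
Proof.
move=> h h' e; apply: funext => u; apply: funext => v.
have [huv|nuv] := pselect (qs u v); last by rewrite (bo_support h nuv) (bo_support h' nuv).
have [S [f [D [p [AS hf Suv SC [aD eC pD sp ex]]]]]] := chart_through huv.1.2.
have [p' [q' [eu ev' spq]]] := chart_pair hPhi hf Suv.
(* As [r] inverts [f], [qs_folding] turns quasi-specialness in [K] into quasi-specialness in the
   chart. *)
have [r [fr rf _]] := retraction_exists hPhi hK ai AS hf aD.
have [_ hc] := (qs_folding u v fr).1 huv.
have vp' : vertex p' by apply: (vertex_of_simplex hPhi spq); rewrite !inE eqxx.
have vq' : vertex q' by apply: (vertex_of_simplex hPhi spq); rewrite !inE eqxx orbT.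
rewrite eu ev' !rf // in hc; rewrite eu ev'.
apply: (ordering_unique hPhi ai (building_ordering_chart h AS hf)
  (building_ordering_chart h' AS hf) aD pD sp) => // y yD yp.
rewrite -ex; apply: e; rewrite in_fsetD1 eC; apply/andP; split.
  by rewrite ex (inj_in_eq (chart_inj_in hPhi hf aD.1)).
by apply/imfsetP; exists y.
Qed.

(** The pullback along [r] of the ordering seen in the chart has the same values as [tau] on the
    special edges of [C] at [x], so uniqueness identifies the two. *)
Lemma building_ordering_pullback tau : building_ordering Phi K A tau ->
  exists tau0 r, [/\ coxeter_ordering Phi tau0, folding Phi K r & tau = pullback tau0 r].
Proof.
move=> h; have [S [f [D [p [AS hf _ SC [aD eC pD sp ex]]]]]] := chart_through KC.
have [r [fr rf _]] := retraction_exists hPhi hK ai AS hf aD.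
have ht := building_ordering_chart h AS hf.
exists (fun p q => tau (f p) (f q)), r; split=> //.
apply: building_ordering_unique h (pullback_ordering ht fr) _ => y.
rewrite eC => /fsetD1P[yx /imfsetP[q /= qD ey]].
have qp : q != p by apply: contraNneq yx => e; rewrite ey ex e.
rewrite ey ex pullbackE; first by rewrite !rf //; apply: (vertex_of_simplex hPhi aD.1).
exact: cqs_chart AS hf (special_edge_cqs hPhi ai aD sp pD qD qp).
Qed.

Lemma building_ordering_exists (sigma : T -> nat) :
  set_bij [set` C `\ x] [set k | (1 <= k <= n)%N] sigma ->
  exists tau, building_ordering Phi K A tau /\ forall y, y \in C `\ x -> tau x y = sigma y.
Proof.
move=> /set_bij_fsetP[b1 b2 b3].
have [S [f [D [p [AS hf _ SC [aD eC pD sp ex]]]]]] := chart_through KC.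
have finj := chart_inj_in hPhi hf aD.1.
have mem q : q \in D `\ p -> f q \in C `\ x.
  move=> /fsetD1P[qp qD]; rewrite in_fsetD1 eC ex (inj_in_eq finj) // qp.
  by apply/imfsetP; exists q.
have pre y : y \in C `\ x -> exists2 q, q \in D `\ p & y = f q.
  rewrite eC => /fsetD1P[yx /imfsetP[q /= qD ey]]; exists q => //.
  by rewrite in_fsetD1 qD andbT; apply: contraNneq yx => e; rewrite ey ex e.
have bij : set_bij [set` D `\ p] [set k | (1 <= k <= n)%N] (sigma \o f).
  apply/set_bij_fsetP; split=> [q /mem/b1//|q q' qD q'D /= e|k /b3[y /pre[q qD ->] <-]].
    apply: finj; [by case/fsetD1P: qD|by case/fsetD1P: q'D|].
    by apply: b2 => //; exact: mem.
  by exists q.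
have [r [fr rf _]] := retraction_exists hPhi hK ai AS hf aD.
have ht := direction_label_ordering hPhi ai aD pD sp bij.
exists (pullback (direction_label Phi D p (sigma \o f)) r); split.
  exact: pullback_ordering ht fr.
move=> y /pre[q qD ->]; have [qp qD'] := fsetD1P _ _ _ qD.
rewrite ex pullbackE.
  rewrite !rf; try exact: (vertex_of_simplex hPhi aD.1).
  by rewrite (direction_labelE hPhi ai (sigma \o f) aD pD sp (direction_special Phi qD)).
exact: cqs_chart AS hf (special_edge_cqs hPhi ai aD sp pD qD' qp).
Qed.

Lemma alcove_labelling : exists sigma, set_bij [set` C `\ x] [set k | (1 <= k <= n)%N] sigma.
Proof.
have sz : size (C `\ x : seq T) = n by exact: card_fsetD1 cC.
exists (fun y => (index y (C `\ x : seq T)).+1); apply/set_bij_fsetP; split.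
- by move=> y yC; rewrite /= -[X in (_ <= X)%N]sz index_mem.
- by move=> y z yC zC [e]; rewrite -(nth_index x yC) e nth_index.
move=> [//|k] /= kn; rewrite -sz in kn.
by exists (nth x (C `\ x : seq T) k); rewrite ?mem_nth // index_uniq // fset_uniq.
Qed.

(** By uniqueness [phi] recovers an ordering from its values at [x], which form an element of a
    finite function type. Value functions that come from no ordering are sent to the default. *)
Lemma building_orderings_finite : finite_set [set tau | building_ordering Phi K A tau].
Proof.
pose phi (g : {ffun (C `\ x) -> 'I_n.+1}) : T -> T -> nat :=
  xget (fun _ _ => 0%N) [set tau | building_ordering Phi K A tau /\
    forall y : C `\ x, tau x (val y) = g y].
apply: (@sub_finite_set _ _ (phi @` setT)); last by apply: finite_image; exact: finite_finset.
move=> tau /= htau.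
have [S [f [D [p [AS hf _ SC [aD eC pD sp ex]]]]]] := chart_through KC.
have rg (y : C `\ x) : (tau x (val y) < n.+1)%N.
  rewrite ltnS; have := valP y; set z := val y; rewrite eC => /fsetD1P[zx /imfsetP[q /= qD ez]].
  have qp : q != p by apply: contraNneq zx => e; rewrite ez ex e.
  have : qs x z.
    by rewrite ez ex; exact: cqs_chart AS hf (special_edge_cqs hPhi ai aD sp pD qD qp).
  by move/(bo_range htau)/andP => -[].
exists [ffun y => Ordinal (rg y)] => //; rewrite /phi; case: xgetP => [tau' _ [h' e']|/(_ tau)[]].
  apply: building_ordering_unique h' htau _ => y yC.
  by rewrite (e' [` yC]%fset) ffunE.
by split=> // y; rewrite ffunE.
Qed.

End From_alcove.

Lemma special_alcove_exists t : exists (C : {fset T}) x,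
  [/\ simplex K C, #|` C| = n.+1, x \in C & special_vertex Phi K A x].
Proof.
have [S [AS _]] := vertex_apartment hK t; have [f hf] := eb_B0 hK AS.
have [D aD] := alcove_exists hPhi ai; have [p pD sp] := alcove_special aD.
exists [fset f q | q in D], (f p); split.
- by apply: (apartment_simplex hK AS); exact: chart_simplex hf aD.1.
- exact: (chart_card hPhi hf aD).
- by apply/imfsetP; exists p.
by exists S, f, p.
Qed.

(** Every isometry as in (B2) is order-preserving: [f \o c] is a chart of [S'] that agrees with [c]
    on [D], so the orderings seen in these two charts coincide by uniqueness. *)
Lemma B2_isometry_preserves tau S S' (C : {fset T}) (f : T -> T) :
  building_ordering Phi K A tau -> A S -> A S' -> S C -> S' C -> #|` C| = n.+1 ->
  simplicial_isometry (restrict_complex K S) (restrict_complex K S') f ->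
  fixes_intersection S S' f ->
  forall u v, S [fset u; v] -> qs u v -> tau (f u) (f v) = tau u v.
Proof.
move=> ht AS AS' SC S'C cC hf ff u v Suv huv; have [c hc] := eb_B0 hK AS.
have [D aD eC] := chart_alcove hPhi hc SC cC; have [p pD sp] := alcove_special aD.
have [p' [q' [eu ev' spq]]] := chart_pair hPhi hc Suv.
have [r [fr rf _]] := retraction_exists hPhi hK ai AS hc aD.
have [_ hcq] := (qs_folding u v fr).1 huv.
have vp' : vertex p' by apply: (vertex_of_simplex hPhi spq); rewrite !inE eqxx.
have vq' : vertex q' by apply: (vertex_of_simplex hPhi spq); rewrite !inE eqxx orbT.
rewrite eu ev' !rf // in hcq; rewrite eu ev'.
have hfc := chart_transport hc hf.
apply: (ordering_unique hPhi ai (building_ordering_chart ht AS' hfc)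
  (building_ordering_chart ht AS hc) aD pD sp) => // y yD _ /=.
have fix_c q : q \in D -> f (c q) = c q.
  by move=> qD; apply: ff SC S'C _; rewrite eC; apply/imfsetP; exists q.
by rewrite !fix_c.
Qed.

Lemma automorphism_edge phi u v : simplicial_isometry K K phi ->
  edge K (phi u) (phi v) <-> edge K u v.
Proof.
move=> [h1 h2 h3 _]; have inj (a b : T) : phi a = phi b -> a = b.
  by apply: h2; exact: (pe_vertex (eb_complex hK)).
split=> [[uv suv]|[uv suv]]; split.
- by apply: contraNneq uv => ->.
- have [s sK e] := h3 _ suv; suff -> : [fset u; v] = s by [].
  apply/fsetP => w; have : (phi w \in [fset phi u; phi v]) = (phi w \in [fset phi x | x in s]) by rewrite e.
  rewrite !inE (inj_eq inj) (inj_eq inj) => ->.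
  by apply/imfsetP/idP => [[w' /= w's /inj->]|ws]; [exact: w's|exists w].
- by apply: contraNneq uv => /inj ->.
by rewrite -imfset_fset2; exact: h1.
Qed.

Lemma automorphism_folding phi r : simplicial_isometry K K phi -> folding Phi K r ->
  folding Phi K (r \o phi).
Proof.
move=> [h1 _ _ h4] [r1 r2]; split=> [s /h1/r1|s x y sK xs ys]; first by rewrite -imfset_comp.
rewrite /= (r2 [fset phi z | z in s]) ?(h4 s) //; first exact: h1.
  by apply/imfsetP; exists x.
by apply/imfsetP; exists y.
Qed.

(** [phi] is not assumed to permute the apartments in [A]. Foldings refer to [K] alone, so [r] and
    [r \o phi] are both available as tests for quasi-special edges. *)
Lemma automorphism_qs phi u v : simplicial_isometry K K phi -> qs (phi u) (phi v) <-> qs u v.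
Proof.
move=> hphi; have [S [AS _]] := vertex_apartment hK u; have [f hf] := eb_B0 hK AS.
have [D aD] := alcove_exists hPhi ai.
have [r [fr _ _]] := retraction_exists hPhi hK ai AS hf aD.
by rewrite (qs_folding _ _ fr) (qs_folding _ _ (automorphism_folding hphi fr)) automorphism_edge.
Qed.

Lemma automorphism_ordering phi tau t : simplicial_isometry K K phi ->
  building_ordering Phi K A tau -> building_ordering Phi K A (fun u v => tau (phi u) (phi v)).
Proof.
move=> hphi ht; have [C [x [KC cC xC sx]]] := special_alcove_exists t.
have [tau0 [r [h0 fr ->]]] := building_ordering_pullback KC cC xC sx ht.
suff -> : (fun u v => pullback tau0 r (phi u) (phi v)) = pullback tau0 (r \o phi).
  by apply: pullback_ordering h0 _; exact: automorphism_folding.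
apply: funext => u; apply: funext => v; rewrite /pullback.
by congr (if _ then _ else _); apply: asbool_equiv_eq; exact: automorphism_qs.
Qed.

End Building_orderings.

Lemma empty_building_ordering (R : realType) (n : nat) (Phi : {fset 'rV[R]_n})
    (T : choiceType) (K : complex R T) (A : set (set {fset T})) tau :
  euclidean_building Phi K A -> (T -> False) -> building_ordering Phi K A tau.
Proof.
move=> hK nT; split=> [u|u|S AS]; [by case: (nT u)|by case: (nT u)|].
by have [f _] := eb_B0 hK AS; case: (nT (f 0)).
Qed.

Local Open Scope fset_scope.
Local Open Scope classical_set_scope.
Local Open Scope ring_scope.

Theorem mainTheorem4 (R : realType) (n : nat) (Phi : {fset 'rV[R]_n})
    (T : choiceType) (K : complex R T) (A : set (set {fset T}))
    (hPhi : root_system Phi) (hK : euclidean_building Phi K A) :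
  [/\ exists tau, building_ordering Phi K A tau,
      forall (C : {fset T}) (x : T) (sigma : T -> nat),
        simplex K C -> #|` C| = n.+1 -> x \in C -> special_vertex Phi K A x ->
        set_bij [set` (C `\ x)%fset] [set k | (1 <= k <= n)%N] sigma ->
        exists! tau, building_ordering Phi K A tau /\
          (forall y, y \in (C `\ x)%fset -> tau x y = sigma y),
      finite_set [set tau | building_ordering Phi K A tau],
      forall tau, building_ordering Phi K A tau ->
        forall (S S' : set {fset T}) (C : {fset T}),
        A S -> A S' -> S C -> S' C -> #|` C| = n.+1 ->
        exists f : T -> T,
          [/\ simplicial_isometry (restrict_complex K S) (restrict_complex K S') f,
              fixes_intersection S S' f
            & forall u v, S [fset u; v] -> quasi_special Phi K A u v ->
                tau (f u) (f v) = tau u v]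
    & forall (phi : T -> T) tau,
        simplicial_isometry K K phi -> building_ordering Phi K A tau ->
        building_ordering Phi K A (fun u v => tau (phi u) (phi v)) ].
Proof.
(* The axioms admit an empty vertex type, with no apartment at all. This case is separate because
   affine independence is obtained from a chart. *)
have [[t _]|nT] := pselect (exists t : T, True); last first.
  have nT' : T -> False by move=> t; apply: nT; exists t.
  have h tau := empty_building_ordering tau hK nT'.
  have all_eq (tau tau' : T -> T -> nat) : tau = tau'.
    by apply: funext => u; case: (nT' u).
  split.
  - by exists (fun _ _ => 0%N).
  - by move=> C x; case: (nT' x).
  - by apply: (sub_finite_set _ (finite_set1 (fun _ _ => 0%N))) => tau _; exact: all_eq.
  - by move=> tau _ S S' C AS; have [f _] := eb_B0 hK AS; case: (nT' (f 0)).
  by move=> phi tau _ _; exact: h.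
have [S [AS _]] := vertex_apartment hK t; have [f hf] := eb_B0 hK AS.
have ai := coxeter_simplices_independent hPhi hK AS hf.
have [C [x [KC cC xC sx]]] := special_alcove_exists hPhi hK ai t.
split.
- have [sigma bij] := alcove_labelling cC xC.
  have [tau [htau _]] := building_ordering_exists hPhi hK ai KC cC xC sx bij.
  by exists tau.
- move=> C' x' sigma KC' cC' xC' sx' bij.
  have [tau [htau e]] := building_ordering_exists hPhi hK ai KC' cC' xC' sx' bij.
  exists tau; split=> // tau' [htau' e'].
  apply: (building_ordering_unique hPhi hK ai KC' cC' xC' sx') => // y yC.
  by rewrite e // e'.
- exact: (building_orderings_finite hPhi hK ai KC cC xC sx).
- move=> tau htau S1 S2 C' AS1 AS2 S1C S2C cC'.
  have [g [hg fg]] := eb_B2 hK AS1 AS2 S1C S2C cC'.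
  exists g; split=> //.
  exact: (B2_isometry_preserves hPhi hK ai htau AS1 AS2 S1C S2C cC' hg fg).
move=> phi tau hphi htau.
exact: (automorphism_ordering hPhi hK ai t hphi htau).
Qed.
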